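(* Let $d\ge2$. Let the random vector $(Y_1,Y_2,\dots,Y_{|\mathbb{T}_N\times\{0\}|})$ be the vertices of $\mathbb{T}_N\times\{0\}$ ordered by their entrance time with $Y_1$ being hit last, so that $$C_{\mathbb{T}_N\times\{0\}}=H_{Y_1}>H_{Y_2}>\dots>H_{Y_{|\mathbb{T}_N\times\{0\}|}}=H_{\mathbb{T}_N\times\{0\}}.$$ Then for all $k\ge2$, $$\lim_{\delta\to0}\ \limsup_{N\to\infty}\ P\big(\exists\,1\le i<j\le k\text{ such that }d(Y_i,Y_j)\le\delta N\big)=0.$$
   Context: Fix an integer $d\ge2$. $\mathbb{T}_N=(\mathbb{Z}/N\mathbb{Z})^d$ and $E_N=\mathbb{T}_N\times\mathbb{Z}$ is the discrete cylinder (nearest-neighbour graph), with $d(\cdot,\cdot)$ the distance on $E_N$ induced by the Euclidean norm. $P$ (depending on $N$) is the law of discrete time simple random walk $(X_n)_{n\ge0}$ on $E_N$ whose starting point is uniform on $\mathbb{T}_N\times\{0\}$. For $U\subset E_N$, $H_U=\inf\{n\ge0:X_n\in U\}$ and $H_x=H_{\{x\}}$; for finite $F\subset E_N$, $C_F=\inf\{n\ge0:F\subset\{X_0,\dots,X_n\}\}$ is the cover time. *)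

(* Defs.v *)
From HB Require Import structures.
From mathcomp Require Import all_boot all_order all_algebra.
From mathcomp Require Import finmap.
From mathcomp Require Import all_classical all_reals all_analysis.

Set Implicit Arguments.
Unset Strict Implicit.
Unset Printing Implicit Defensive.

Import Order.TTheory GRing.Theory Num.Theory.
Import numFieldNormedType.Exports.

Local Open Scope classical_set_scope.
Local Open Scope ring_scope.

(* (Z/NZ)^d for N >= 2 only: 'Z_0 and 'Z_1 are both Z/2Z. *)
Notation torus d N := {ffun 'I_d -> 'Z_N}.

Notation cylinder d N := (torus d N * int)%type.

Definition level0 (d N : nat) : set (cylinder d N) := [set x | x.2 = 0].

Definition cyl_proj (d N : nat) (u : {ffun 'I_d -> int} * int) : cylinder d N :=
  ([ffun i => (u.1 i)%:~R], u.2).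

Definition eucl_norm (R : realType) (d : nat) (u : {ffun 'I_d -> int} * int) : R :=
  Num.sqrt (\sum_(i < d) (u.1 i)%:~R ^+ 2 + u.2%:~R ^+ 2).

(* The distance induced on the quotient by the Euclidean norm: the infimum of
   the Euclidean distances between representatives in Z^d x Z. *)
Definition cyl_dist (R : realType) (d N : nat) (x y : cylinder d N) : R :=
  inf [set eucl_norm R (u - v) |
        u in [set u | cyl_proj N u = x] & v in [set v | cyl_proj N v = y]].

Definition neighbours (R : realType) (d N : nat) (x : cylinder d N) :
    set (cylinder d N) :=
  [set y | cyl_dist R x y = 1].

(* [fset_set] is the finite set with the given elements (there are 2d+2 of them
   as soon as N >= 3). *)
Definition srw_kernel (R : realType) (d N : nat) (x y : cylinder d N) : R :=
  if y \in neighbours R x then (#|` fset_set (neighbours R x)|%fset%:R)^-1 else 0.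

(* Measurability with respect to the discrete sigma-algebra on the target. *)
Definition discrete_measurable_fun (disp : measure_display)
    (Omega : measurableType disp) (V : Type) (f : Omega -> V) : Prop :=
  forall A : set V, measurable (f @^-1` A).

Record is_srw (R : realType) (d N : nat) (disp : measure_display)
    (Omega : measurableType disp) (P : probability Omega R)
    (X : nat -> Omega -> cylinder d N) : Prop := IsSRW {
  srw_measurable : forall n, discrete_measurable_fun (X n) ;
  srw_start : forall x : cylinder d N,
    P [set w | X 0%N w = x] =
      (if x.2 == 0 then (#|{: torus d N}|%:R)^-1 else 0)%:E ;
  srw_step : forall (n : nat) (x : nat -> cylinder d N),
    P [set w | forall m, (m <= n.+1)%N -> X m w = x m] =
      (P [set w | forall m, (m <= n)%N -> X m w = x m] *
        (srw_kernel R (x n) (x n.+1))%:E)%E }.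

(* Times take values in the extended reals: the infimum of the empty set
   is +oo. *)
Definition hitting_time (R : realType) (V T : Type) (X : nat -> T -> V)
    (U : set V) (w : T) : \bar R :=
  ereal_inf [set n%:R%:E | n in [set n : nat | U (X n w)]].

Definition cover_time (R : realType) (V T : Type) (X : nat -> T -> V)
    (F : set V) (w : T) : \bar R :=
  ereal_inf [set n%:R%:E | n in
    [set n : nat | F `<=` [set X m w | m in [set m | (m <= n)%N]]]].

(* Indices start at 0: [Y ord0] is the vertex that is hit last. *)
Record ordered_by_entrance (R : realType) (d N : nat) (T : Type)
    (X : nat -> T -> cylinder d N)
    (Y : 'I_#|{: torus d N}| -> T -> cylinder d N) (w : T) : Prop :=
  OrderedByEntrance {
  entrance_enum :
    set_bij [set: 'I_#|{: torus d N}|] (@level0 d N) (fun i => Y i w) ;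
  entrance_last : forall i : 'I_#|{: torus d N}|, i = 0%N :> nat ->
    cover_time R X (@level0 d N) w = hitting_time R X [set Y i w] w ;
  entrance_decr : forall i j : 'I_#|{: torus d N}|, (i < j)%N ->
    (hitting_time R X [set Y j w] w < hitting_time R X [set Y i w] w)%E ;
  entrance_first : forall i : 'I_#|{: torus d N}|, i.+1 = #|{: torus d N}| ->
    hitting_time R X [set Y i w] w = hitting_time R X (@level0 d N) w }.

(* Main.v *)
Require Import Defs.
From HB Require Import structures.
From mathcomp Require Import all_boot all_order all_algebra.
From mathcomp Require Import finmap.
From mathcomp Require Import all_classical all_reals all_analysis.
From mathcomp Require Import zify ring lra.

Set Implicit Arguments.
Unset Strict Implicit.
Unset Printing Implicit Defensive.

Import Order.TTheory GRing.Theory Num.Theory.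
Import numFieldNormedType.Exports.

Local Open Scope classical_set_scope.
Local Open Scope ring_scope.

(* The trace of the walk on level 0 is a symmetric random walk on the torus, and
   the order in which the vertices are covered only depends on this trace.  Its
   spectrum is explicit: for cas = cos + sin, r ^ |z| * cas (2 pi k.y / N) with
   r + 1/r = 2 (1 + a), a = sum_i (1 - cos (2 pi k_i / N)), is harmonic off
   level 0, so the trace has eigenvalues 1 - sqrt (a ^ 2 + 2 a) / (d + 1) and
   relaxation time O(N), much smaller than n = N ^ d.

   Let G be the Green function of the trace on functions of mean 0.  A function
   vanishing at x and y has a mean controlled by its Dirichlet form and by
   G(0) + G(x - y) (Cauchy-Schwarz), so both vertices are still uncovered after t
   steps with probability at most about exp (- 2 t / (n (G(0) + G(x - y)))),
   while the test function 1 - G(x - .) / G(0) shows that x is uncovered with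
   probability at least about exp (- t / (n G(0))).

   Choose t such that about M vertices are expected to be uncovered.  As the sum
   of G ^ 2 is O(log N ^ 2), all but polylogarithmically many displacements have
   G <= eta / log n, and the corresponding pairs are asymptotically independent;
   the others satisfy G(x - y) <= G(0) - 1/2 and contribute O(N ^ -c) by a union
   bound.  Hence the number of uncovered vertices has variance close to M, so
   that it is at least k outside an event of probability O(1 / M), and the
   expected number of uncovered pairs at distance at most delta N is
   O(M ^ 2 delta ^ d) + o(1).  When at least k vertices are uncovered, the last k
   vertices are among them. *)

(** * Spectral calculus in an orthogonal basis *)

(** The trace is never built as a process. Its transition operator is defined through its spectrum,
    and the walk is tied to it by a recursion over finite step sequences: after [m] steps the two
    descriptions differ by at most a constant times the probability of few visits to level 0, which
    vanishes as [m] grows because the vertical coordinate is recurrent.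

    The killed operator is symmetric on functions vanishing on the killing set, so an avoidance
    probability over an even number of steps is a squared norm: contraction bounds it from above,
    log-convexity of norms bounds it from below. The relaxation time enters these bounds only as a
    term [tau] added to n G(0). For t near n G(0) log (n / M) it shifts the exponent by an amount of
    order tau log n / n, which tends to 0 because tau = O(N) and d >= 2.

    The second moment needs the sharp exponent, twice that of one vertex, for all typical pairs. For
    the exceptional pairs any exponent beating that of one vertex by a fixed factor is enough, as
    their displacements are so few. *)

Section InnerProduct.
Context (R : realFieldType) (T : finType).
Implicit Types f g : T -> R.

Definition dot f g := \sum_x f x * g x.

Lemma dotC f g : dot f g = dot g f.
Proof. by apply: eq_bigr => x _; rewrite mulrC. Qed.

Lemma dot_ge0 f : 0 <= dot f f.
Proof. by apply: sumr_ge0 => x _; rewrite -expr2 sqr_ge0. Qed.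

Lemma eq_dot f1 f2 g1 g2 : f1 =1 f2 -> g1 =1 g2 -> dot f1 g1 = dot f2 g2.
Proof. by move=> e1 e2; apply: eq_bigr => x _; rewrite e1 e2. Qed.

Lemma dotDl f1 f2 g : dot (fun x => f1 x + f2 x) g = dot f1 g + dot f2 g.
Proof. by rewrite -big_split; apply: eq_bigr => x _; rewrite mulrDl. Qed.

Lemma dotDr f g1 g2 : dot f (fun x => g1 x + g2 x) = dot f g1 + dot f g2.
Proof. by rewrite dotC dotDl !(dotC f). Qed.

Lemma dotZl a f g : dot (fun x => a * f x) g = a * dot f g.
Proof. by rewrite mulr_sumr; apply: eq_bigr => x _; rewrite mulrA. Qed.

Lemma dotZr a f g : dot f (fun x => a * g x) = a * dot f g.
Proof. by rewrite dotC dotZl dotC. Qed.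

Lemma dot_cauchy_schwarz f g : dot f g ^+ 2 <= dot f f * dot g g.
Proof.
have [g0|gN0] := eqVneq (dot g g) 0.
  have gz x : g x = 0.
    move/eqP: g0; rewrite psumr_eq0 => [/allP /(_ x)|y _]; last first.
      by rewrite -expr2 sqr_ge0.
    by rewrite mem_index_enum => /(_ isT); rewrite mulf_eq0 orbb => /eqP.
  rewrite g0 mulr0 /dot big1 ?expr0n // => x _; by rewrite gz mulr0.
have gp : 0 < dot g g by rewrite lt_def gN0 dot_ge0.
have := dot_ge0 (fun x => dot g g * f x + (- dot f g) * g x).
rewrite dotDl !dotDr !dotZl !dotZr (dotC g f).
set a := dot f f; set b := dot f g; set e := dot g g in gp *.
rewrite [X in 0 <= X -> _](_ : _ = e * (a * e - b ^+ 2)); last by ring.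
by rewrite pmulr_rge0 // subr_ge0.
Qed.

Lemma dot_lin r s f g :
  dot (fun x => r * f x + s * g x) (fun x => r * f x + s * g x) =
  r ^+ 2 * dot f f + 2 * (r * s) * dot f g + s ^+ 2 * dot g g.
Proof. by rewrite dotDl !dotDr !dotZl !dotZr (dotC g f); ring. Qed.

End InnerProduct.

Section Spectral.
Context (R : realFieldType) (T : finType) (c : T -> T -> R).
Local Notation n := (#|T|%:R : R).
Context (c_sym : forall k x, c k x = c x k).
Context (c_orth : forall x y, \sum_k c k x * c k y = n * (x == y)%:R).
Implicit Types f g a b : T -> R.

Definition hat f k := \sum_y f y * c k y.
(** The operator that is diagonal in the basis [c k] with eigenvalues [a k]. As [c] is symmetric,
    one finite type indexes both points and frequencies. *)
Definition spec a f x := n^-1 * \sum_k a k * hat f k * c k x.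

Lemma card_neq0 (x : T) : n != 0.
Proof. by rewrite pnatr_eq0 -lt0n; apply/card_gt0P; exists x. Qed.

Lemma hat_inv f x : f x = n^-1 * \sum_k hat f k * c k x.
Proof.
rewrite [X in _ * X](_ : _ = \sum_y f y * (n * (y == x)%:R)); last first.
  under eq_bigr do rewrite mulr_suml; rewrite exchange_big /=.
  by apply: eq_bigr => y _; rewrite -c_orth mulr_sumr; apply: eq_bigr => k _; ring.
rewrite (bigD1 x) //= eqxx big1 => [|y /negPf ->]; last by rewrite !mulr0.
by rewrite addr0 mulr1 mulrCA mulVf ?mulr1 // (card_neq0 x).
Qed.

Lemma dot_hat f g : dot f g = n^-1 * \sum_k hat f k * hat g k.
Proof.
rewrite /dot; under eq_bigr do rewrite (hat_inv f).
rewrite mulr_sumr; under eq_bigr do rewrite mulr_sumr mulr_suml.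
rewrite exchange_big /=; apply: eq_bigr => k _; rewrite !mulr_sumr.
by apply: eq_bigr => x _; ring.
Qed.

Lemma hat_spec a f k : hat (spec a f) k = a k * hat f k.
Proof.
rewrite {1}/hat /spec.
transitivity (n^-1 * \sum_l (\sum_y c y l * c y k) * (a l * hat f l)).
  rewrite mulr_sumr; under eq_bigr do rewrite mulr_sumr mulr_suml.
  rewrite exchange_big /=; apply: eq_bigr => l _.
  transitivity (\sum_y (n^-1 * (a l * hat f l)) * (c y l * c y k)).
    by apply: eq_bigr => y _; rewrite (c_sym l y) (c_sym k y); ring.
  by rewrite -mulr_sumr; ring.
under eq_bigr do rewrite c_orth.
rewrite (bigD1 k) //= eqxx big1 => [|l /negPf ->]; last by rewrite mulr0 mul0r.
by rewrite addr0 mulr1 mulKf // (card_neq0 k).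
Qed.

Lemma dot_spec a f g : dot f (spec a g) = n^-1 * \sum_k a k * hat f k * hat g k.
Proof.
by rewrite dot_hat; congr (_ * _); apply: eq_bigr => k _; rewrite hat_spec; ring.
Qed.

Lemma dot_specC a f g : dot f (spec a g) = dot (spec a f) g.
Proof.
by rewrite (dotC (spec a f)) !dot_spec; congr (_ * _); apply: eq_bigr => k _; rewrite mulrAC.
Qed.

Lemma hatD f g k : hat (fun x => f x + g x) k = hat f k + hat g k.
Proof. by rewrite /hat -big_split; apply: eq_bigr => x _; rewrite mulrDl. Qed.

Lemma hatZ r f k : hat (fun x => r * f x) k = r * hat f k.
Proof. by rewrite /hat mulr_sumr; apply: eq_bigr => x _; rewrite mulrA. Qed.

Lemma eq_hat f g k : f =1 g -> hat f k = hat g k.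
Proof. by move=> e; apply: eq_bigr => x _; rewrite e. Qed.

Lemma eq_spec a f g x : f =1 g -> spec a f x = spec a g x.
Proof. by move=> e; congr (_ * _); apply: eq_bigr => k _; rewrite (eq_hat _ e). Qed.

Lemma specD a f g x : spec a (fun x => f x + g x) x = spec a f x + spec a g x.
Proof.
rewrite /spec -mulrDr -big_split; congr (_ * _); apply: eq_bigr => k _.
by rewrite hatD /=; ring.
Qed.

Lemma specZ a r f x : spec a (fun x => r * f x) x = r * spec a f x.
Proof.
rewrite /spec mulrCA [X in _ = _ * X]mulr_sumr; congr (_ * _); apply: eq_bigr => k _.
by rewrite hatZ; ring.
Qed.


Lemma dot_spec_lin a r s f g :
  dot (fun x => r * f x + s * g x) (spec a (fun x => r * f x + s * g x)) =
  r ^+ 2 * dot f (spec a f) + 2 * (r * s) * dot f (spec a g) +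
  s ^+ 2 * dot g (spec a g).
Proof.
have e : dot g (spec a f) = dot f (spec a g) by rewrite dot_specC dotC.
transitivity (dot (fun x => r * f x + s * g x)
    (fun x => r * spec a f x + s * spec a g x)).
  by apply: eq_dot => // x; rewrite specD !specZ.
move: (spec a f) (spec a g) e => u v e.
by rewrite dotDl !dotDr !dotZl !dotZr e; ring.
Qed.

Section SpectralGap.
Context (k0 : T) (c_k0 : forall x, c k0 x = 1).
Context (lam : T -> R) (lam_k0 : lam k0 = 1).
Context (lam_lt1 : forall k, k != k0 -> lam k < 1).

(** The value 0 at [k0] removes the constants, on which [1 - Q] is not invertible. *)
Definition green_weight k := if k == k0 then 0 else (1 - lam k)^-1.
Definition green x y := n^-1 * \sum_k green_weight k * c k x * c k y.

Local Notation w := green_weight.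
Local Notation Q := (spec lam).

Lemma green_weight_ge0 k : 0 <= w k.
Proof.
rewrite /w; case: eqVneq => // kN0; by rewrite invr_ge0 subr_ge0 ltW ?lam_lt1.
Qed.

Lemma card_gt0R : 0 < n.
Proof. by rewrite lt_def (card_neq0 k0) ler0n. Qed.

Lemma sum_c k : \sum_x c k x = n * (k == k0)%:R.
Proof.
rewrite -c_orth; apply: eq_bigr => x _.
by rewrite (c_sym x k0) c_k0 mulr1 c_sym.
Qed.

Lemma hat_green x k : hat (green x) k = w k * c k x.
Proof.
rewrite {1}/hat /green.
transitivity (n^-1 * \sum_l (\sum_y c y l * c y k) * (w l * c l x)).
  transitivity (\sum_y \sum_l n^-1 * ((c y l * c y k) * (w l * c l x))).
    apply: eq_bigr => y _; rewrite -mulr_sumr -mulrA; congr (_ * _).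
    rewrite mulr_suml; apply: eq_bigr => l _.
    by rewrite (c_sym l y) (c_sym k y); ring.
  rewrite exchange_big /= mulr_sumr; apply: eq_bigr => l _.
  by rewrite -mulr_sumr mulr_suml.
under eq_bigr do rewrite c_orth.
rewrite (bigD1 k) //= eqxx big1 => [|l /negPf ->]; last by rewrite mulr0 mul0r.
by rewrite addr0 mulr1 mulKf // (card_neq0 k).
Qed.

Lemma sum_green x : \sum_y green x y = 0.
Proof.
transitivity (hat (green x) k0).
  by apply: eq_bigr => y _; rewrite c_k0 mulr1.
by rewrite hat_green /w eqxx mul0r.
Qed.

Lemma dot_green x : dot (green x) (green x) = n^-1 * \sum_k (w k * c k x) ^+ 2.
Proof.
by rewrite dot_hat; congr (_ * _); apply: eq_bigr => k _; rewrite hat_green expr2.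
Qed.

(** [G] inverts [1 - Q] on functions of mean 0, so (1 - Q) G(x, .) is the point mass at [x] minus
    its mean. *)
Lemma spec_green x y : Q (green x) y = green x y - (x == y)%:R + n^-1.
Proof.
have E : \sum_k lam k * hat (green x) k * c k y =
    \sum_k w k * c k x * c k y - \sum_k c k x * c k y + 1.
  rewrite -sumrB !(bigD1 k0 (P := predT)) //= hat_green /w eqxx !c_k0.
  rewrite !mulr1 mulr0 !add0r addrAC addNr add0r.
  apply: eq_bigr => k kN0; rewrite hat_green /w (negPf kN0).
  have : 1 - lam k != 0 by rewrite subr_eq0 eq_sym lt_eqF ?lam_lt1.
  by move=> ?; field.
by rewrite /spec E mulrDr mulrBr c_orth mulKf ?mulr1 // (card_neq0 x).
Qed.

End SpectralGap.
End Spectral.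

(** * Chains killed on a set *)

Section KilledChain.
Context (R : rcfType) (T : finType) (c : T -> T -> R).
Local Notation n := (#|T|%:R : R).
Context (c_sym : forall k x, c k x = c x k).
Context (c_orth : forall x y, \sum_k c k x * c k y = n * (x == y)%:R).
Context (k0 : T) (c_k0 : forall x, c k0 x = 1).
Context (lam : T -> R) (lam_k0 : lam k0 = 1).
Context (lam_lt1 : forall k, k != k0 -> lam k < 1).
Context (tau : R) (w_tau : forall k, green_weight k0 lam k <= tau).
Context (g0 : R) (green_diag : forall x, green c k0 lam x x = g0).
Implicit Types f g : T -> R.

Local Notation w := (green_weight k0 lam).
Local Notation G := (green c k0 lam).
Local Notation Q := (spec c lam).

Lemma dirichlet_form f :
  dot f f - dot f (Q f) = n^-1 * \sum_(k | k != k0) (1 - lam k) * hat c f k ^+ 2.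
Proof.
rewrite (dot_spec c_sym c_orth) (dot_hat c_orth) -mulrBr -sumrB (bigD1 k0) //=.
rewrite lam_k0 mul1r subrr add0r; congr (_ * _); apply: eq_bigr => k _; ring.
Qed.

(* Cauchy-Schwarz between the Dirichlet form of [f] and the Green function
   bounds the mean of [f], and the spectral gap bounds its fluctuations. *)
Lemma dirichlet_form_pair f x y gam : f x = 0 -> f y = 0 -> G x y <= gam ->
  dot f f <= (dot f f - dot f (Q f)) * (n * (g0 + gam) / 2 + tau).
Proof.
move=> fx fy Ggam; set h := hat c f; set E := _ - _.
have n0 : 0 < n := card_gt0R R k0.
have gap0 k : k != k0 -> 0 < 1 - lam k by move=> kN; rewrite subr_gt0 lam_lt1.
have EE : \sum_(k | k != k0) (1 - lam k) * h k ^+ 2 = n * E.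
  by rewrite /E dirichlet_form mulrA mulfV ?mul1r // gt_eqF.
have E0 : 0 <= E.
  rewrite -(pmulr_rge0 _ n0) -EE; apply: sumr_ge0 => k kN.
  by rewrite mulr_ge0 ?sqr_ge0 // ltW ?gap0.
pose d k := c k x + c k y.
pose u k := if k == k0 then 0 else Num.sqrt (1 - lam k) * h k.
pose v k := Num.sqrt (w k) * d k.
(* Adding the inversion formulas at [x] and [y], where [f] vanishes, expresses the mean of [f]
   through the other modes. The weights split [d k * h k] into a Dirichlet factor and a Green
   factor. *)
have h0E : 2 * h k0 = - dot u v.
  have : n^-1 * \sum_k h k * c k x + n^-1 * \sum_k h k * c k y = 0.
    by rewrite -!(hat_inv c_orth) fx fy addr0.
  rewrite -mulrDr => /eqP; rewrite mulf_eq0 invr_eq0 gt_eqF //= -big_split /=.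
  rewrite (bigD1 k0) //= !c_k0 mulr1 -mulr2n -[_ *+ 2]mulr_natl => /eqP /addr0_eq e.
  apply: oppr_inj; rewrite opprK e /dot [RHS](bigD1 k0) //= {1}/u eqxx mul0r add0r.
  apply: eq_bigr => k kN; rewrite /u /v /green_weight (negPf kN) -mulrDr -/(d k).
  rewrite mulrACA [_ * Num.sqrt _^-1]mulrC -sqrtrM ?invr_ge0 ?ltW ?gap0 //.
  by rewrite mulVf ?gt_eqF ?gap0 // sqrtr1 mul1r.
have uu : dot u u = n * E.
  rewrite -EE /dot (bigD1 k0) //= {1}/u eqxx mul0r add0r.
  apply: eq_bigr => k kN; rewrite /u (negPf kN) -expr2 exprMn sqr_sqrtr //.
  by rewrite ltW ?gap0.
have vv : dot v v = n * (2 * (g0 + G x y)).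
  have -> : n * (2 * (g0 + G x y)) = n * (G x x + 2 * G x y + G y y).
    by rewrite !green_diag; ring.
  rewrite /green -/w; set A := \sum_k _; set B := \sum_k _; set D := \sum_k _.
  transitivity (A + 2 * B + D); last by field; rewrite gt_eqF.
  rewrite /A /B /D mulr_sumr -!big_split; apply: eq_bigr => k _ /=.
  rewrite /v -expr2 exprMn sqr_sqrtr /d; first by ring.
  exact: green_weight_ge0.
have := dot_cauchy_schwarz u v; rewrite -sqrrN -h0E uu vv => CS.
have H0 : h k0 ^+ 2 <= n ^+ 2 * (E * (g0 + gam) / 2).
  have : (2 * h k0) ^+ 2 <= n * E * (n * (2 * (g0 + gam))).
    apply: le_trans CS _; rewrite ler_wpM2l ?mulr_ge0 ?(ltW n0) //.
    by rewrite ler_pM2l // ler_pM2l // lerD2l.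
  by rewrite exprMn; lra.
have Hk : \sum_(k | k != k0) h k ^+ 2 <= tau * (n * E).
  rewrite -EE mulr_sumr; apply: ler_sum => k kN; rewrite mulrA.
  rewrite -[leLHS]mul1r ler_wpM2r ?sqr_ge0 //.
  have := w_tau k; rewrite /green_weight (negPf kN) -ler_pdivrMr ?gap0 // div1r.
  by [].
rewrite (dot_hat c_orth) -/h (bigD1 k0) //= -!expr2.
under eq_bigr do rewrite -expr2.
rewrite mulrC ler_pdivrMr //.
have -> : E * (n * (g0 + gam) / 2 + tau) * n =
  n ^+ 2 * (E * (g0 + gam) / 2) + tau * (n * E) by ring.
exact: lerD.
Qed.

Section Killing.
Context (A : {pred T}).

Definition off x : R := (x \notin A)%:R.
Definition killed f x := off x * Q f x.

Lemma killed_in f x : x \in A -> killed f x = 0.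
Proof. by move=> xA; rewrite /killed /off xA mul0r. Qed.

Lemma iter_killed_in f j x : (forall y, y \in A -> f y = 0) -> x \in A ->
  iter j killed f x = 0.
Proof. by case: j => [|j] H xA /=; [exact: H|exact: killed_in]. Qed.

Lemma dot_killed f g : (forall x, x \in A -> f x = 0) ->
  dot f (killed g) = dot f (Q g).
Proof.
move=> H; apply: eq_bigr => x _; rewrite /killed /off.
by case: (boolP (x \in A)) => [/H ->|_]; rewrite ?mul0r ?mul1r.
Qed.

(** On all functions [killed] need not be symmetric, but the iterates that matter vanish on [A]. *)
Lemma dot_killedC f g : (forall x, x \in A -> f x = 0) ->
  (forall x, x \in A -> g x = 0) -> dot f (killed g) = dot (killed f) g.
Proof.
by move=> Hf Hg; rewrite dot_killed // (dot_specC c_sym c_orth) dotC -dot_killed // dotC.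
Qed.

Lemma dot_iter_killed f g i j : (forall x, x \in A -> f x = 0) ->
  (forall x, x \in A -> g x = 0) ->
  dot f (iter (i + j) killed g) = dot (iter i killed f) (iter j killed g).
Proof.
move=> Hf Hg; elim: i j => [//|i IH] j.
rewrite addSnnS IH iterS dot_killedC //; by move=> x; exact: iter_killed_in.
Qed.

Lemma killed_ext f g : f =1 g -> killed f =1 killed g.
Proof. by move=> e x; rewrite /killed (eq_spec _ _ _ e). Qed.

Lemma iter_killedD f g j :
  iter j killed (fun x => f x + g x) =1
  (fun x => iter j killed f x + iter j killed g x).
Proof.
elim: j => [//|j IH] x /=; rewrite (killed_ext IH) /killed specD mulrDr //.
Qed.

(* By polarization, at [f] and [mu^-1 * killed f]. *)
Lemma killed_contract mu f : 0 < mu ->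
  (forall g, (forall x, x \in A -> g x = 0) -> `|dot g (Q g)| <= mu * dot g g) ->
  (forall x, x \in A -> f x = 0) ->
  dot (killed f) (killed f) <= mu ^+ 2 * dot f f.
Proof.
move=> mu0 bnd Hf; set h := killed f.
have Hh x : x \in A -> h x = 0 by exact: killed_in.
have H s x : x \in A -> mu^-1 * h x + s * f x = 0.
  by move=> xA; rewrite Hh // Hf // !mulr0 addr0.
have := bnd _ (H (-1)); have := bnd _ (H 1).
rewrite !ler_norml !(dot_spec_lin c_sym c_orth) !dot_lin -(dot_killed f Hh) -/h.
rewrite !(dotC h f) => /andP[_ p2] /andP[q1 _].
have {p2 q1} : 4 * mu^-1 * dot h h <= 2 * mu * (mu^-2 * dot h h + dot f f).
  by lra.
have -> : 2 * mu * (mu^-2 * dot h h + dot f f) = 2 * mu^-1 * dot h h + 2 * mu * dot f f.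
  by field; rewrite gt_eqF.
move=> p; have {}p : dot h h * mu^-1 <= mu * dot f f by lra.
by rewrite ler_pdivrMr // in p; apply: le_trans p _; rewrite mulrAC -expr2.
Qed.

Lemma iter_killed_contract mu f j : 0 < mu ->
  (forall g, (forall x, x \in A -> g x = 0) -> `|dot g (Q g)| <= mu * dot g g) ->
  (forall x, x \in A -> f x = 0) ->
  dot (iter j killed f) (iter j killed f) <= (mu ^+ 2) ^+ j * dot f f.
Proof.
move=> mu0 bnd Hf; elim: j => [|j IH]; first by rewrite expr0 mul1r.
rewrite iterS exprS -mulrA; apply: le_trans (killed_contract mu0 bnd _) _.
  by move=> x; exact: iter_killed_in.
by rewrite ler_wpM2l ?sqr_ge0.
Qed.

(* The probability that the stationary chain with transition operator [Q]
   avoids [A] at times 0, ..., j. *)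
Definition avoid j := n^-1 * \sum_x iter j killed off x.

(** Symmetry moves half of the steps to the other argument, which turns a probability into a squared
    norm. This is why times are even from here on. *)
Lemma avoid_double j :
  avoid j.*2 = n^-1 * dot (iter j killed off) (iter j killed off).
Proof.
have Ho x : x \in A -> off x = 0 by rewrite /off => ->.
congr (_ * _); rewrite -dot_iter_killed // addnn; apply: eq_bigr => x _.
rewrite {2}/off; case: (boolP (x \in A)) => [xA|]; last by rewrite mul1r.
by rewrite mul0r iter_killed_in.
Qed.

End Killing.

Lemma dot_off_le (A : {pred T}) : dot (off A) (off A) <= n.
Proof.
rewrite -sum1_card natr_sum; apply: ler_sum => x _.
by rewrite /off; case: (x \in A); rewrite ?mul0r ?mul1r.
Qed.

(** The upper half is the Dirichlet form estimate; the lower half only needs the spectrum to stay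
    above [- b]. *)
Lemma killed_form_bound (A : {pred T}) x y gam b f : x \in A -> y \in A ->
  G x y <= gam -> 0 < n * (g0 + gam) / 2 + tau ->
  (forall k, - b <= lam k) -> b <= 1 - (n * (g0 + gam) / 2 + tau)^-1 ->
  (forall z, z \in A -> f z = 0) ->
  `|dot f (Q f)| <= (1 - (n * (g0 + gam) / 2 + tau)^-1) * dot f f.
Proof.
move=> xA yA Gg kap0 lamb b1 Hf; rewrite ler_norml; apply/andP; split; last first.
  have := dirichlet_form_pair (Hf _ xA) (Hf _ yA) Gg.
  by rewrite -ler_pdivrMr //; lra.
apply: (@le_trans _ _ (- b * dot f f)).
  by rewrite -mulNr ler_wpM2r ?dot_ge0 // lerN2.
rewrite (dot_spec c_sym c_orth) (dot_hat c_orth f f) mulrCA.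
apply: ler_wpM2l; first by rewrite invr_ge0 ler0n.
rewrite mulr_sumr; apply: ler_sum => k _; rewrite -mulrA ler_wpM2r //.
by rewrite -expr2 sqr_ge0.
Qed.

(** The case [x = y], [gam = g0] is the bound for a single point, with rate 1 / (n g0 + tau). *)
Lemma avoid_pair_le (A : {pred T}) x y gam b j : x \in A -> y \in A ->
  G x y <= gam -> 0 < n * (g0 + gam) / 2 + tau -> 0 < b ->
  (forall k, - b <= lam k) -> b <= 1 - (n * (g0 + gam) / 2 + tau)^-1 ->
  avoid A j.*2 <= (1 - (n * (g0 + gam) / 2 + tau)^-1) ^+ j.*2.
Proof.
move=> xA yA Gg kap0 b0 lamb b1; rewrite avoid_double -mul2n exprM.
set mu := 1 - _; rewrite ler_pdivrMl ?(card_gt0R R k0) // mulrC.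
have mu0 : 0 < mu by exact: lt_le_trans b0 b1.
apply: le_trans (iter_killed_contract _ mu0 _ _) _ => [g Hg|z zA|].
- exact: (killed_form_bound xA yA Gg).
- by rewrite /off zA.
- by rewrite ler_wpM2l ?dot_off_le // exprn_ge0 ?sqr_ge0.
Qed.

Lemma spec_const y : Q (fun=> 1) y = 1.
Proof.
have H k : hat c (fun=> 1) k = n * (k == k0)%:R.
  by rewrite -(sum_c c_sym c_orth c_k0); apply: eq_bigr => x _; rewrite mul1r c_sym.
rewrite /spec (bigD1 k0) //= big1 ?addr0; last first.
  by move=> k kN; rewrite H (negPf kN) !mulr0 mul0r.
by rewrite H eqxx lam_k0 c_k0 mulr1 mul1r mulr1 mulVf ?(card_neq0 R k0).
Qed.

(** Log-convexity makes the ratios of consecutive terms nondecreasing, so the first ratio controls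
    them all. *)
Lemma log_convex_growth (u : nat -> R) r : 0 < u 0%N -> 0 < r -> r * u 0%N <= u 1%N ->
  (forall j, u j.+1 ^+ 2 <= u j * u j.+2) -> forall j, r ^+ j * u 0%N <= u j.
Proof.
move=> u0 r0 u1 uc.
have H j : 0 < u j /\ r * u j <= u j.+1.
  elim: j => [//|j [up ur]].
  have up1 : 0 < u j.+1 by apply: lt_le_trans ur; exact: mulr_gt0.
  split=> //; rewrite -(ler_pM2l up); apply: le_trans (uc j).
  by rewrite mulrCA mulrA expr2 ler_wpM2r // ltW.
elim=> [|j IH]; first by rewrite expr0 mul1r.
rewrite exprS -mulrA; apply: le_trans (H j).2; rewrite ler_wpM2l //; exact: ltW.
Qed.

(** The test function [phi] = 1 - G(x, .) / g0 vanishes at [x] and is nearly invariant under the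
    killed operator, so by log-convexity the squared norm of its image after [s] steps is at least n
    rho^(2 s). It differs from [off A] by [psi], whose norm is that of G / g0 at most and contracts
    at rate [mu]. *)
Lemma avoid_point_ge x b e s : 0 < e -> 0 < g0 -> 1 < n * g0 -> 0 <= tau -> 0 < b ->
  (forall k, - b <= lam k) -> b <= 1 - (n * g0 + tau)^-1 ->
  n * (1 - (n * g0)^-1) ^+ s.*2 -
  (1 + e^-1) * ((1 - (n * g0 + tau)^-1) ^+ s.*2 * (dot (G x) (G x) / g0 ^+ 2)) <=
  (1 + e) * (n * avoid (pred1 x) s.*2).
Proof.
move=> e0 gp ng1 tau0 b0 lamb b1; set rho := 1 - (n * g0)^-1; set mu := 1 - _.
have n0 : 0 < n := card_gt0R R k0.
have eqle (a a' : R) : a = a' -> a <= a' by move=> ->.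
have ngp : 0 < n * g0 by exact: mulr_gt0.
have rho0 : 0 < rho by rewrite subr_gt0 invf_lt1.
pose A := pred1 x; pose K := killed A; pose f := off A.
pose phi y := 1 + (- g0^-1) * G x y.
pose psi y := f y * (- g0^-1 * G x y).
have phix : phi x = 0 by rewrite /phi green_diag mulNr mulVf ?subrr ?gt_eqF.
have inA (g : T -> R) : g x = 0 -> forall y, y \in A -> g y = 0.
  by move=> gx y; rewrite inE => /eqP ->.
have fE y : f y = (y != x)%:R by [].
have fx : f x = 0 by rewrite fE eqxx.
have phiE : phi =1 (fun y => f y + psi y).
  move=> y; rewrite /psi; case: (eqVneq y x) => [->|yx].
    by rewrite phix fx mul0r addr0.
  by rewrite fE yx mul1r.
(* Away from [x], the equation of [G] makes [Q] lower [phi] by the constant 1 / (n g0). *)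
have Kphi : K phi =1 (fun y => phi y + (- (n * g0)^-1) * f y).
  move=> y; rewrite /K /killed -/f; case: (eqVneq y x) => [->|yx].
    by rewrite fx phix mul0r mulr0 addr0.
  have -> : f y = 1 by rewrite fE yx.
  rewrite mul1r mulr1 /phi specD specZ spec_const (spec_green c_sym c_orth c_k0 lam_lt1).
  rewrite eq_sym (negPf yx) subr0 mulrDr addrA; congr (_ + _).
  by rewrite invfM mulNr mulrC.
have sumphi : \sum_y phi y = n.
  by rewrite big_split /= -mulr_sumr (sum_green c_sym c_orth c_k0) mulr0 addr0 sumr_const.
have phif : dot phi f = n.
  rewrite -sumphi; apply: eq_bigr => y _; rewrite fE.
  by case: eqVneq => [->|_]; rewrite ?phix ?mul0r ?mulr1.
have phiphi : dot phi phi = n + (g0 ^- 2) * dot (G x) (G x).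
  have -> : dot phi phi = \sum_y (phi y + (- g0^-1 * G x y + g0 ^- 2 * (G x y * G x y))).
    by apply: eq_bigr => y _; rewrite /phi; field; rewrite gt_eqF.
  rewrite big_split /= sumphi big_split /= -[X in _ + (X + _)]mulr_sumr.
  by rewrite (sum_green c_sym c_orth c_k0) mulr0 add0r -mulr_sumr.
have a0 : n <= dot phi phi.
  by rewrite phiphi lerDl mulr_ge0 ?dot_ge0 // invr_ge0 sqr_ge0.
pose u j := dot (iter j K phi) (iter j K phi).
have phiA := inA _ phix.
have fA := inA _ fx.
have Kiter g j : (forall y, y \in A -> g y = 0) -> forall y, y \in A -> iter j K g y = 0.
  by move=> Hg y; exact: iter_killed_in.
have uc j : u j.+1 ^+ 2 <= u j * u j.+2.
  have -> : u j.+1 = dot (iter j K phi) (iter j.+2 K phi).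
    symmetry; exact: (dot_killedC (g := iter j.+1 K phi) (Kiter _ j phiA) (Kiter _ j.+1 phiA)).
  exact: dot_cauchy_schwarz.
have ug j : (rho ^+ 2) ^+ j * u 0%N <= u j.
  apply: log_convex_growth => //; first exact: lt_le_trans n0 a0.
    by rewrite exprn_gt0.
  rewrite /u /= -(ler_pM2l (lt_le_trans n0 a0)).
  apply: le_trans (dot_cauchy_schwarz _ _).
  (* As [u 0] is at least [n], subtracting 1 / g0 leaves at least [rho * u 0]. *)
  have -> : dot phi (K phi) = dot phi phi - g0^-1.
    rewrite (eq_dot (frefl phi) Kphi) dotDr dotZr phif invfM mulNr.
    by congr (_ - _); rewrite mulrAC mulVf ?mul1r // gt_eqF.
  rewrite mulrCA -expr2 -exprMn ler_pXn2r // ?nnegrE.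
  - rewrite /rho mulrBl mul1r lerD2l lerN2 invfM mulrAC.
    by rewrite -[leLHS]mul1r ler_wpM2r ?invr_ge0 ?(ltW gp) // ler_pdivlMl ?mulr1.
  - by rewrite mulr_ge0 ?dot_ge0 // ltW.
  - rewrite subr_ge0; apply: le_trans a0.
    by rewrite -div1r ler_pdivrMr // ltW.
rewrite avoid_double mulVKf ?gt_eqF // -/f -/K.
rewrite -!mul2n !exprM -/mu.
set F := iter s K f; pose W := iter s K psi.
have psix : psi x = 0 by rewrite /psi fx mul0r.
have WW : dot W W <= (mu ^+ 2) ^+ s * (dot (G x) (G x) / g0 ^+ 2).
  have muE : mu = 1 - (n * (g0 + g0) / 2 + tau)^-1.
    by congr (1 - _^-1); congr (_ + _); field.
  have mu0 : 0 < mu by exact: lt_le_trans b0 b1.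
  apply: le_trans (iter_killed_contract _ mu0 _ _) _ => [g Hg||].
  - rewrite muE; apply: (killed_form_bound (x := x) (y := x)) lamb _ Hg => //.
    + by rewrite inE.
    + by rewrite inE.
    + by rewrite green_diag.
    + have -> : n * (g0 + g0) / 2 = n * g0 by field.
      exact: ltr_wpDr.
    + by rewrite -muE.
  - exact: inA.
  - apply: ler_wpM2l; first by rewrite exprn_ge0 ?sqr_ge0.
    rewrite /dot mulr_suml; apply: ler_sum => y _.
    rewrite /psi fE; case: eqP => _ /=; rewrite ?mul0r ?mul1r.
      by rewrite -expr2 divr_ge0 ?sqr_ge0.
    by apply: eqle; field; rewrite gt_eqF.
have uE : u s = dot (fun y => 1 * F y + 1 * W y) (fun y => 1 * F y + 1 * W y).
  apply: eq_dot => y; rewrite !mul1r -[RHS](iter_killedD A f psi s y).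
    by elim: s {ug WW F W} y => [|j IH] y /=; [exact: phiE|exact: killed_ext].
  by elim: s {ug WW F W} y => [|j IH] y /=; [exact: phiE|exact: killed_ext].
have uF : u s <= (1 + e) * dot F F + (1 + e^-1) * dot W W.
  rewrite uE dot_lin.
  (* Young's inequality with weight [e], in the form e^-1 |e F - W|^2 >= 0. *)
  have := dot_ge0 (fun y => e * F y + (-1) * W y); rewrite dot_lin => H.
  have {}H : 0 <= e^-1 * (e ^+ 2 * dot F F + 2 * (e * -1) * dot F W + (-1) ^+ 2 * dot W W).
    by rewrite mulr_ge0 // invr_ge0 ltW.
  rewrite -subr_ge0; apply: le_trans H _; apply: eqle; field; by rewrite gt_eqF.
rewrite lerBlDr; apply: (@le_trans _ _ (u s)); last first.
  apply: le_trans uF _; rewrite lerD2l ler_wpM2l // addr_ge0 // invr_ge0 ltW //.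
apply: le_trans (ug s); rewrite mulrC ler_wpM2l ?exprn_ge0 ?sqr_ge0 //; exact: ltW.
Qed.

End KilledChain.

(** * Fourier analysis on the torus *)

(** A crude Jordan inequality: up to pi / 4 the mean value theorem applies, with cos^2 >= 1/2;
    beyond it already sin^2 >= 1/2. *)
Lemma sin_ge_quarter (R : realType) (x : R) : 0 <= x <= pi / 2 -> x / 4 <= sin x.
Proof.
move=> /andP[x0 xpi]; have pi2 := pihalf_lt2 R; have pi0 := pi_gt0 R.
have [xs|xl] := leP x (pi / 4).
  have [x00|xn0] := eqVneq x 0; first by rewrite x00 mul0r sin0.
  have xp : 0 < x by rewrite lt_def xn0.
  have [y yx] : exists2 y, y \in `]0, x[ & sin x - sin 0 = cos y * (x - 0).
    apply: (@MVT _ sin cos _ _ xp).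
    by apply: continuous_subspaceT => z; exact: continuous_sin.
  rewrite sin0 !subr0 => ->; move: yx; rewrite in_itv /= => /andP[y0 yx].
  have c2 : 0 <= cos (y *+ 2) by apply: cos_ge0_pihalf; lra.
  have cp : 0 <= cos y by apply: cos_ge0_pihalf; lra.
  rewrite cos_mulr2n in c2.
  suff : 1 / 4 <= cos y by move=> ?; rewrite mulrC ler_pM2r //; lra.
  by nra.
have c2 : cos (x *+ 2) <= 0.
  have : 0 <= cos (x *+ 2 - pi) by apply: cos_ge0_pihalf; lra.
  by rewrite cosB cospi sinpi; lra.
have s0 : 0 <= sin x by apply: sin_ge0_pi; lra.
rewrite cos_mulr2n cos2sin2 in c2.
suff : 1 / 2 <= sin x by lra.
by nra.
Qed.

Section CyclicTrig.
Context (R : realType) (N : nat).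
Local Notation p := (Zp_trunc N).+2.
Implicit Types a b : 'Z_N.

Definition angle (m : nat) : R := m%:R * (pi *+ 2 / p%:R).
Definition zcos a : R := cos (angle a).
Definition zsin a : R := sin (angle a).

Lemma angle_modn m : angle m = angle (m %% p) + (pi *+ 2) *+ (m %/ p).
Proof.
rewrite /angle {1}(divn_eq m p) natrD mulrDl addrC; congr (_ + _).
by rewrite natrM -[RHS]mulr_natl; field.
Qed.

Lemma cos_angle_modn m : cos (angle (m %% p)) = cos (angle m).
Proof. by rewrite (angle_modn m) (periodicn (@cosD2pi R)). Qed.

Lemma sin_angle_modn m : sin (angle (m %% p)) = sin (angle m).
Proof. by rewrite (angle_modn m) (periodicn (@sinD2pi R)). Qed.

Lemma angleD m1 m2 : angle (m1 + m2) = angle m1 + angle m2.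
Proof. by rewrite /angle natrD mulrDl. Qed.

Lemma zcosD a b : zcos (a + b) = zcos a * zcos b - zsin a * zsin b.
Proof. by rewrite /zcos cos_angle_modn angleD cosD. Qed.

Lemma zsinD a b : zsin (a + b) = zsin a * zcos b + zcos a * zsin b.
Proof. by rewrite /zsin sin_angle_modn angleD sinD. Qed.

Lemma zcos0 : zcos 0 = 1.
Proof. by rewrite /zcos /angle mul0r cos0. Qed.

Lemma zsin0 : zsin 0 = 0.
Proof. by rewrite /zsin /angle mul0r sin0. Qed.

Lemma zcos2Dzsin2 a : zcos a ^+ 2 + zsin a ^+ 2 = 1.
Proof. exact: cos2Dsin2. Qed.

Lemma zcosN a : zcos (- a) = zcos a.
Proof.
have := zcosD (- a) a; have := zsinD (- a) a; rewrite addNr zcos0 zsin0 => s c.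
have q := zcos2Dzsin2 a.
transitivity (zcos (- a) * (zcos a ^+ 2 + zsin a ^+ 2)); first by rewrite q mulr1.
transitivity (zcos a * (zcos (- a) * zcos a - zsin (- a) * zsin a) +
  zsin a * (zsin (- a) * zcos a + zcos (- a) * zsin a)); first by ring.
by rewrite -s -c; ring.
Qed.

Lemma zsinN a : zsin (- a) = - zsin a.
Proof.
have := zcosD (- a) a; have := zsinD (- a) a; rewrite addNr zcos0 zsin0 => s c.
have q := zcos2Dzsin2 a.
transitivity (zsin (- a) * (zcos a ^+ 2 + zsin a ^+ 2)); first by rewrite q mulr1.
transitivity (zcos a * (zsin (- a) * zcos a + zcos (- a) * zsin a) -
  zsin a * (zcos (- a) * zcos a - zsin (- a) * zsin a)); first by ring.
by rewrite -s -c; ring.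
Qed.

Lemma zcos_le1 a : zcos a <= 1. Proof. exact: cos_le1. Qed.
Lemma zcos_geN1 a : -1 <= zcos a. Proof. exact: cos_geN1. Qed.

(** Distance to 0 around the cycle. *)
Definition zdist a : nat := minn a (p - a).

Lemma zdist_gt0 a : a != 0 -> (0 < zdist a)%N.
Proof.
move=> aN0; rewrite /zdist leq_min subn_gt0 ltn_ord andbT lt0n.
by apply: contra aN0 => /eqP a0; apply/eqP/val_inj.
Qed.

(** 1 - cos (2 x) = 2 sin(x)^2 at x = pi a / p. After reflecting x into [0, pi / 2], sin x >= x / 4
    and pi >= 2 give sin x >= zdist / (2 p). *)
Lemma zcos_gap a : (zdist a)%:R ^+ 2 / (2 * p%:R ^+ 2) <= 1 - zcos a.
Proof.
have p0 : 0 < p%:R :> R by rewrite ltr0n.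
pose x (m : nat) : R := m%:R * (pi / p%:R).
have pi2 := @pi_ge2 R.
have H m : (m.*2 <= p)%N -> m%:R / (2 * p%:R) <= sin (x m).
  move=> mp; apply: le_trans (sin_ge_quarter _); last first.
    rewrite /x mulr_ge0 ?divr_ge0 ?pi_ge0 ?(ltW p0) //=.
    rewrite mulrCA ler_wpM2l ?pi_ge0 // ler_pdivrMr // ler_pdivlMl //.
    by rewrite -natrM ler_nat mul2n.
  have y0 : 0 <= m%:R / p%:R :> R by rewrite divr_ge0 // ltW.
  have -> : m%:R / (2 * p%:R) = (m%:R / p%:R) / 2 :> R by field.
  have -> : x m / 4 = (m%:R / p%:R) * pi / 4 by rewrite /x; field.
  by move: y0 pi2; move: (m%:R / p%:R) (pi : R) => y q y0 q2; nra.
have ap : (a < p)%N by exact: ltn_ord.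
have s : (zdist a)%:R / (2 * p%:R) <= sin (x a).
  rewrite /zdist; have [le|lt] := leqP a (p - a); first by apply: H; lia.
  have -> : sin (x a) = sin (x (p - a)%N).
    have -> : x a = pi - x (p - a)%N.
      by rewrite /x natrB ?(ltnW ap) //; field; rewrite gt_eqF.
    by rewrite sinB sinpi cospi; ring.
  by apply: H; lia.
have -> : 1 - zcos a = 2 * sin (x a) ^+ 2.
  rewrite /zcos (_ : angle a = x a *+ 2); last by rewrite /angle /x; ring.
  by rewrite cos_mulr2n cos2sin2; ring.
have s0 : 0 <= (zdist a)%:R / (2 * p%:R) :> R by rewrite divr_ge0 // mulr_ge0 // ltW.
have -> : (zdist a)%:R ^+ 2 / (2 * p%:R ^+ 2) = 2 * ((zdist a)%:R / (2 * p%:R)) ^+ 2 :> R.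
  by field; rewrite gt_eqF.
by rewrite ler_pM2l // ler_pXn2r // nnegrE // (le_trans s0).
Qed.

Lemma zcos_lt1 a : a != 0 -> zcos a < 1.
Proof.
move=> aN0; rewrite -subr_gt0; apply: lt_le_trans (zcos_gap a).
by rewrite divr_gt0 ?exprn_gt0 ?mulr_gt0 ?exprn_gt0 ?ltr0n ?zdist_gt0.
Qed.

End CyclicTrig.

Section TorusFourier.
Context (R : realType) (d N : nat).
Local Notation T := (torus d N).
Local Notation n := (#|{: T}|%:R : R).
Implicit Types k x y z : T.

Definition torus_dot k x : 'Z_N := \sum_i k i * x i.

Lemma torus_dotC k x : torus_dot k x = torus_dot x k.
Proof. by apply: eq_bigr => i _; rewrite mulrC. Qed.

Lemma torus_dotDr k x y : torus_dot k (x + y) = torus_dot k x + torus_dot k y.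
Proof. by rewrite -big_split; apply: eq_bigr => i _; rewrite ffunE mulrDr. Qed.

Lemma torus_dotDl k x y : torus_dot (x + y) k = torus_dot x k + torus_dot y k.
Proof. by rewrite -!(torus_dotC k) torus_dotDr. Qed.

Lemma torus_dotNr k x : torus_dot k (- x) = - torus_dot k x.
Proof. by rewrite -sumrN; apply: eq_bigr => i _; rewrite ffunE mulrN. Qed.

Lemma torus_dotNl k x : torus_dot (- x) k = - torus_dot x k.
Proof. by rewrite -!(torus_dotC k) torus_dotNr. Qed.

Lemma torus_dot0l x : torus_dot 0 x = 0.
Proof. by apply: big1 => i _; rewrite ffunE mul0r. Qed.

Lemma torus_dot0r x : torus_dot x 0 = 0.
Proof. by rewrite torus_dotC torus_dot0l. Qed.

Lemma torus_neq0 k : k != 0 -> exists i, k i != 0.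
Proof.
move=> kN0; apply/existsP; rewrite -negb_forall; apply: contra kN0 => /forallP z0.
by apply/eqP/ffunP => i; rewrite ffunE; exact/eqP.
Qed.

Definition unit_vec (i : 'I_d) : T := [ffun j => (j == i)%:R].

Lemma torus_dot_unit k i : torus_dot k (unit_vec i) = k i.
Proof.
rewrite /torus_dot (bigD1 i) //= ffunE eqxx mulr1 big1 ?addr0 // => j /negPf ji.
by rewrite ffunE ji mulr0.
Qed.

(** The Hartley kernel: a real orthogonal family, symmetric in frequency and position, in place of
    the complex characters. *)
Definition cas k x : R := zcos R (torus_dot k x) + zsin R (torus_dot k x).

Lemma cas_sym k x : cas k x = cas x k.
Proof. by rewrite /cas torus_dotC. Qed.

Lemma cas0 x : cas 0 x = 1.
Proof. by rewrite /cas torus_dot0l zcos0 zsin0 addr0. Qed.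

(** The sine term is odd in [k], so it disappears from every sum with an even weight. *)
Lemma cas_mul k x y : cas k x * cas k y =
  zcos R (torus_dot k (x - y)) + zsin R (torus_dot k (x + y)).
Proof.
by rewrite /cas !torus_dotDr torus_dotNr zcosD zsinD zcosN zsinN; ring.
Qed.

Lemma casD_add_sub k x e :
  cas k (x + e) + cas k (x - e) = 2 * zcos R (torus_dot k e) * cas k x.
Proof.
by rewrite /cas !torus_dotDr torus_dotNr !(zcosD, zsinD) zcosN zsinN; ring.
Qed.

Lemma normr_cas k x : `|cas k x| <= 2.
Proof.
apply: le_trans (ler_normD _ _) _; rewrite -[leRHS]/(1 + 1).
by rewrite lerD //; [exact: cos_max|exact: sin_max].
Qed.

Lemma sum_zsin_even (w : T -> R) z : (forall k, w (- k) = w k) ->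
  \sum_k w k * zsin R (torus_dot k z) = 0.
Proof.
move=> w_even; set S := \sum_k _.
suff : S = - S by move=> ?; lra.
rewrite [LHS](reindex_inj (@oppr_inj T)) -sumrN; apply: eq_bigr => k _ /=.
by rewrite w_even torus_dotNl zsinN mulrN.
Qed.

Lemma sum_zsin z : \sum_k zsin R (torus_dot k z) = 0.
Proof.
rewrite -[RHS](@sum_zsin_even (fun=> 1) z (fun=> erefl)).
by apply: eq_bigr => k _; rewrite mul1r.
Qed.

(** Shifting the frequency along a coordinate with [z i != 0] multiplies the sum by [zcos R (z i)],
    which is less than 1. *)
Lemma sum_zcos z : \sum_k zcos R (torus_dot k z) = n * (z == 0)%:R.
Proof.
have [->|zN0] := eqVneq z 0.
  under eq_bigr do rewrite torus_dot0r zcos0.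
  by rewrite sumr_const mulr1.
rewrite mulr0; have [i ziN0] := torus_neq0 zN0.
set S := \sum_k _.
have : S = S * zcos R (z i).
  rewrite [LHS](reindex_inj (@addIr T (unit_vec i))) /=.
  under eq_bigr do rewrite torus_dotDl (torus_dotC (unit_vec i)) torus_dot_unit zcosD.
  by rewrite sumrB -!mulr_suml sum_zsin mul0r subr0.
have := zcos_lt1 R ziN0 => lt1 /eqP.
rewrite -subr_eq0 -{1}[S]mulr1 -mulrBr mulf_eq0 subr_eq0 => /orP[/eqP //|].
by rewrite gt_eqF.
Qed.

Lemma cas_orth x y : \sum_k cas k x * cas k y = n * (x == y)%:R.
Proof.
under eq_bigr do rewrite cas_mul; rewrite big_split /= sum_zcos sum_zsin.
by rewrite addr0 subr_eq0.
Qed.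

(* [decay k] is the root r <= 1 of r + 1/r = 2 (1 + vert_cost k), for which
   [r ^ |z| * cas k y] is harmonic off level 0. *)
Definition vert_cost k : R := \sum_i (1 - zcos R (k i)).
Definition decay k : R :=
  1 + vert_cost k - Num.sqrt (vert_cost k ^+ 2 + 2 * vert_cost k).
Definition trace_eig k : R :=
  1 - Num.sqrt (vert_cost k ^+ 2 + 2 * vert_cost k) / d.+1%:R.

Lemma vert_cost_ge0 k : 0 <= vert_cost k.
Proof. by apply: sumr_ge0 => i _; rewrite subr_ge0 zcos_le1. Qed.

Lemma vert_cost_ge k i : 1 - zcos R (k i) <= vert_cost k.
Proof.
rewrite /vert_cost (bigD1 i) //= lerDl; apply: sumr_ge0 => j _.
by rewrite subr_ge0 zcos_le1.
Qed.

Lemma vert_cost_le k : vert_cost k <= d%:R * 2.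
Proof.
apply: (@le_trans _ _ (\sum_(i < d) 2)); last first.
  by rewrite sumr_const card_ord -[_ *+ d]mulr_natl.
by apply: ler_sum => i _; have := @zcos_geN1 R N (k i); lra.
Qed.

Lemma vert_costN k : vert_cost (- k) = vert_cost k.
Proof. by apply: eq_bigr => i _; rewrite ffunE zcosN. Qed.

Lemma vert_cost0 : vert_cost 0 = 0.
Proof. by apply: big1 => i _; rewrite ffunE zcos0 subrr. Qed.

Lemma vert_cost_gt0 k : k != 0 -> 0 < vert_cost k.
Proof.
move=> kN0; have [i kiN0] := torus_neq0 kN0.
by apply: lt_le_trans (vert_cost_ge k i); rewrite subr_gt0 zcos_lt1.
Qed.

Let disc_ge0 k : 0 <= vert_cost k ^+ 2 + 2 * vert_cost k.
Proof. by rewrite addr_ge0 ?sqr_ge0 ?mulr_ge0 ?vert_cost_ge0. Qed.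

Lemma decay_gt0 k : 0 < decay k.
Proof.
rewrite subr_gt0 -[ltRHS]ger0_norm ?addr_ge0 ?vert_cost_ge0 // -sqrtr_sqr.
rewrite ltr_sqrt; last by rewrite exprn_gt0 // ltr_wpDr ?vert_cost_ge0.
by rewrite sqrrD expr1n; lra.
Qed.

Lemma decay_le1 k : decay k <= 1.
Proof.
rewrite /decay -addrA gerDl subr_le0 -[leLHS]ger0_norm ?vert_cost_ge0 //.
by rewrite -sqrtr_sqr ler_sqrt // lerDl mulr_ge0 ?vert_cost_ge0.
Qed.

Lemma decay_inv k : decay k + (decay k)^-1 = 2 * (1 + vert_cost k).
Proof.
have q := sqr_sqrtr (disc_ge0 k); have := decay_gt0 k; rewrite /decay.
move: q; set s := Num.sqrt _; set v := vert_cost k => q D0.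
apply: (@mulIf _ (1 + v - s)); first by rewrite gt_eqF.
rewrite mulrDl mulVf ?gt_eqF //; nra.
Qed.

(** This is the average over the 2 (d + 1) steps from level 0: horizontal steps contribute 2 (d -
    [vert_cost]), the two vertical ones 2 [decay]. *)
Lemma trace_eigE k : trace_eig k = (d%:R - vert_cost k + decay k) / d.+1%:R.
Proof.
have -> : d%:R = d.+1%:R - 1 :> R by rewrite -natr1 addrK.
by rewrite /trace_eig /decay; field; rewrite addrC natr1 pnatr_eq0.
Qed.

Lemma trace_eig0 : trace_eig 0 = 1.
Proof. by rewrite /trace_eig vert_cost0 expr0n mulr0 addr0 sqrtr0 mul0r subr0. Qed.

Lemma trace_eig_lt1 k : k != 0 -> trace_eig k < 1.
Proof.
move=> kN0; rewrite ltrBlDr ltrDl divr_gt0 // sqrtr_gt0 addr_gt0 ?exprn_gt0 //.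
  exact: vert_cost_gt0.
by rewrite mulr_gt0 ?vert_cost_gt0.
Qed.

(** Keeps the spectrum away from -1 uniformly in [N], so that only its upper part decides the
    contraction of the killed chain. *)
Lemma trace_eig_ge k : - (d%:R / d.+1%:R) <= trace_eig k.
Proof.
rewrite trace_eigE -mulNr ler_pM2r ?invr_gt0 ?ltr0n //.
by have := vert_cost_le k; have := decay_gt0 k; lra.
Qed.

Local Notation w := (green_weight (0 : T) trace_eig).

Lemma trace_weightN k : w (- k) = w k.
Proof. by rewrite /green_weight oppr_eq0 /trace_eig vert_costN. Qed.

Lemma trace_weight_ge_half k : k != 0 -> 1 / 2 <= w k.
Proof.
move=> kN0; rewrite /green_weight (negPf kN0).
have lt1 := trace_eig_lt1 kN0; have ge := trace_eig_ge k.
rewrite div1r lef_pV2 ?posrE ?subr_gt0 //.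
have : d%:R / d.+1%:R <= 1 :> R by rewrite ler_pdivrMr ?ltr0n // mul1r ler_nat.
move: ge; move: (_ / _) => q; lra.
Qed.

(** The square root in the eigenvalue turns the quadratic gap of a cycle into a linear one; hence a
    relaxation time of order N instead of N^2. *)
Lemma trace_gap k i : (zdist (k i))%:R / ((Zp_trunc N).+2%:R * d.+1%:R) <= 1 - trace_eig k.
Proof.
rewrite opprB addrC subrK invfM mulrA ler_pM2r ?invr_gt0 ?ltr0n //.
rewrite -[leLHS]ger0_norm ?divr_ge0 // -sqrtr_sqr ler_sqrt // expr_div_n.
apply: le_trans (_ : 2 * vert_cost k <= _); last by rewrite lerDr sqr_ge0.
apply: le_trans (_ : 2 * (1 - zcos R (k i)) <= _).
  apply: le_trans (_ : 2 * ((zdist (k i))%:R ^+ 2 / (2 * (Zp_trunc N).+2%:R ^+ 2)) <= _).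
    by rewrite le_eqVlt; apply/orP; left; apply/eqP; field.
  by rewrite ler_pM2l // zcos_gap.
by rewrite ler_pM2l // vert_cost_ge.
Qed.

Lemma trace_weight_le k i : k i != 0 ->
  w k <= (Zp_trunc N).+2%:R * d.+1%:R / (zdist (k i))%:R.
Proof.
move=> kiN0; have kN0 : k != 0 by apply: contra kiN0 => /eqP ->; rewrite ffunE.
rewrite /green_weight (negPf kN0) -invf_div lef_pV2 ?posrE ?trace_gap //.
  by rewrite subr_gt0 trace_eig_lt1.
by rewrite divr_gt0 ?mulr_gt0 ?ltr0n ?zdist_gt0.
Qed.

Lemma trace_weight_le_gap k : w k <= (Zp_trunc N).+2%:R * d.+1%:R.
Proof.
have [->|kN0] := eqVneq k 0.
  by rewrite /green_weight eqxx mulr_ge0.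
have [i kiN0] := torus_neq0 kN0.
apply: le_trans (trace_weight_le kiN0) _.
by rewrite ler_pdivrMr ?ltr0n ?zdist_gt0 // ler_peMr ?mulr_ge0 // ler1n zdist_gt0.
Qed.

Definition torus_green z : R := n^-1 * \sum_k w k * zcos R (torus_dot k z).

Lemma trace_greenE x y : green cas 0 trace_eig x y = torus_green (x - y).
Proof.
congr (_ * _); under eq_bigr do rewrite -mulrA cas_mul mulrDr.
by rewrite big_split /= sum_zsin_even ?addr0 //; exact: trace_weightN.
Qed.

Let n_gt0 : 0 < n. Proof. exact: (card_gt0R R (0 : T)). Qed.

Lemma torus_green0 : torus_green 0 = n^-1 * \sum_k w k.
Proof. by congr (_ * _); apply: eq_bigr => k _; rewrite torus_dot0r zcos0 mulr1. Qed.

(** G(0) - G(z) averages [w k] (1 - cos) over the frequencies. All weights off 0 are at least 1/2,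
    and 1 - cos has mean 1 when [z] is not 0. *)
Lemma torus_green_gap z : z != 0 -> torus_green z <= torus_green 0 - 1 / 2.
Proof.
move=> zN0; rewrite lerBrDl -lerBrDr -mulrBr -sumrB.
rewrite -(ler_pM2l n_gt0) mulVKf ?gt_eqF //.
have -> : n * (1 / 2) = \sum_k (1 / 2) * (1 - zcos R (torus_dot k z)).
  rewrite -mulr_sumr sumrB sum_zcos (negPf zN0) mulr0 subr0.
  by rewrite sumr_const mulrC.
apply: ler_sum => k _; rewrite torus_dot0r zcos0 -mulrBr.
have [->|kN0] := eqVneq k 0; first by rewrite torus_dot0l zcos0 subrr !mulr0.
by rewrite ler_wpM2r ?trace_weight_ge_half // subr_ge0 zcos_le1.
Qed.

Lemma torus_green0_ge : (1 < #|{: T}|)%N -> 1 / 4 <= torus_green 0.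
Proof.
move=> n1; rewrite torus_green0 ler_pdivlMl //.
apply: (@le_trans _ _ (\sum_(k : T | k != 0) (1 / 2))); last first.
  rewrite [leRHS](bigD1 (0 : T)) //= {1}/green_weight eqxx add0r.
  by apply: ler_sum => k kN0; exact: trace_weight_ge_half.
have E : \sum_(k : T) (1 / 2) = 1 / 2 + \sum_(k : T | k != 0) (1 / 2) :> R.
  by rewrite (bigD1 (0 : T)).
rewrite sumr_const -[LHS]mulr_natl in E.
have n2 : 2 <= n by rewrite ler_nat.
by lra.
Qed.

Lemma torus_green_sq x : dot (green cas 0 trace_eig x) (green cas 0 trace_eig x) =
  n^-1 * \sum_k w k ^+ 2.
Proof.
rewrite (dot_green cas_sym cas_orth); congr (_ * _).
under eq_bigr do rewrite exprMn expr2 (expr2 (cas _ _)) cas_mul subrr torus_dot0r zcos0 mulrDr mulr1.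
rewrite big_split /= sum_zsin_even ?addr0 // => k; by rewrite trace_weightN.
Qed.

End TorusFourier.

(** * Sums of the Green weights over frequencies *)

Section LatticeSums.
Context (R : realType) (d N : nat).
Local Notation T := (torus d N).
Local Notation n := (#|{: T}|%:R : R).
Local Notation p := (Zp_trunc N).+2.

Lemma sum_two_coordinates (f g : 'Z_N -> R) (i j : 'I_d) : i != j ->
  \sum_(k : T) f (k i) * g (k j) = (\sum_a f a) * (\sum_a g a) * p%:R ^+ (d - 2).
Proof.
move=> ij.
pose F (l : 'I_d) a := if l == i then f a else if l == j then g a else 1.
transitivity (\sum_(k : T) \prod_l F l (k l)).
  apply: eq_bigr => k _; rewrite (bigD1 i) //= (bigD1 j) 1?eq_sym //= big1 => [|l].
    by rewrite /F !eqxx eq_sym (negPf ij) mulr1.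
  by move=> /andP[/negPf li /negPf lj]; rewrite /F li lj.
rewrite -(bigA_distr_bigA F) /= (bigD1 i) //= (bigD1 j) 1?eq_sym //= mulrA.
congr (_ * _ * _).
- by apply: eq_bigr => a _; rewrite /F eqxx.
- by apply: eq_bigr => a _; rewrite /F eqxx eq_sym (negPf ij).
rewrite (eq_bigr (fun=> p%:R)) => [|l /andP[/negPf li /negPf lj]]; last first.
  rewrite (eq_bigr (fun=> 1)) => [|a _]; last by rewrite /F li lj.
  by rewrite sumr_const card_ord.
rewrite prodr_const; congr (_ ^+ _).
transitivity #|predC (pred2 i j)|; first by apply: eq_card => l; rewrite !inE negb_or.
have := cardC (pred2 i j); rewrite card2 ij card_ord => e.
by move/(congr1 (subn^~ 2)): e => <-; exact: esym (addKn 2 _).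
Qed.

Lemma sum_zdist (phi : nat -> R) : (forall m, 0 <= phi m) ->
  \sum_(a : 'Z_N | a != 0) phi (zdist a) <= 2 * \sum_(1 <= m < p.+1) phi m.
Proof.
move=> phi0; apply: (@le_trans _ _ (\sum_(1 <= m < p) (phi m + phi (p - m)%N))).
  rewrite big_mkcond /= (big_ord_recl _ (fun a => if a != 0 then _ else _)) /= add0r.
  rewrite big_add1 big_mkord; apply: ler_sum => a _; rewrite ?ifT //.
  by rewrite /zdist; case: leqP; rewrite /= ?lerDl ?lerDr phi0.
rewrite big_split /= mulr_natl mulr2n lerD //.
  by rewrite [leRHS]big_nat_recr //= lerDl.
rewrite big_nat_rev /= big_nat [leRHS]big_nat_recr //= [X in _ <= X + _]big_nat.
apply: (@le_trans _ _ (\sum_(1 <= i < p | (1 <= i < p)%N) phi i)).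
  apply: ler_sum => m mp; rewrite (_ : (p - (1 + p - m.+1))%N = m) //; lia.
by rewrite lerDl.
Qed.

(** Shifting by 1 makes distance 0 admissible. It accounts for one of the three sums; the two
    directions around the cycle account for the others. *)
Lemma sum_zdistS (phi : nat -> R) : (forall m, 0 <= phi m) ->
  (forall m, (0 < m)%N -> phi m.+1 <= phi m) ->
  \sum_(a : 'Z_N) phi (zdist a).+1 <= 3 * \sum_(1 <= m < p.+1) phi m.
Proof.
move=> phi0 phiS; rewrite (bigD1 0) //= {1}/zdist min0n.
have -> : 3 = 1 + 2 :> R by ring.
rewrite mulrDl mul1r lerD //.
  by rewrite big_nat_recl //= lerDl; apply: sumr_ge0.
apply: le_trans (sum_zdist phi0); apply: ler_sum => a aN0.
by rewrite phiS ?zdist_gt0.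
Qed.

(** Two coordinates suffice in every dimension d >= 2: one where [k] is nonzero, chosen in at most
    [d] ways, and a partner. The one-dimensional sums give 6 = 2 * 3, and the other d - 2
    coordinates are free. *)
Lemma sum_torus_bound (phi : nat -> R) (F : T -> R) C : (2 <= d)%N -> 0 <= C ->
  (forall m, 0 <= phi m) -> (forall m, (0 < m)%N -> phi m.+1 <= phi m) ->
  F 0 <= 0 ->
  (forall (k : T) (i j : 'I_d), k i != 0 -> F k <= C * (phi (zdist (k i)) * phi (zdist (k j)).+1)) ->
  \sum_k F k <= d%:R * (C * (6 * (\sum_(1 <= m < p.+1) phi m) ^+ 2 * p%:R ^+ (d - 2))).
Proof.
move=> d2 C0 phi0 phiS F0 HF; set S := \sum_(1 <= m < p.+1) phi m.
have S0 : 0 <= S by apply: sumr_ge0.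
have next (i : 'I_d) : exists j : 'I_d, i != j.
  have d0 : (0 < d)%N by apply: leq_trans d2.
  case: (posnP i) => i0; last by exists (Ordinal d0); rewrite -val_eqE /= -lt0n.
  by exists (Ordinal d2); rewrite -val_eqE /= i0.
pose nx i := xchoose (next i).
pose g i (k : T) := (k i != 0)%:R * phi (zdist (k i)) * phi (zdist (k (nx i))).+1.
apply: (@le_trans _ _ (\sum_k \sum_i C * g i k)).
  apply: ler_sum => k _; have [->|kN0] := eqVneq k 0.
    apply: le_trans F0 _; apply: sumr_ge0 => i _.
    by rewrite /g !mulr_ge0.
  have [i kiN0] := torus_neq0 kN0.
  rewrite (bigD1 i) //= /g kiN0 mul1r; apply: le_trans (HF k i (nx i) kiN0) _.
  by rewrite lerDl; apply: sumr_ge0 => j _; rewrite !mulr_ge0.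
rewrite exchange_big /=.
apply: (@le_trans _ _ (\sum_(i < d) C * (6 * S ^+ 2 * p%:R ^+ (d - 2)))); last first.
  by rewrite sumr_const card_ord -[_ *+ d]mulr_natl.
apply: ler_sum => i _; rewrite -mulr_sumr ler_wpM2l //.
rewrite (sum_two_coordinates (fun a => (a != 0)%:R * phi (zdist a)) (fun a => phi (zdist a).+1)); last first.
  exact: (xchooseP (next i)).
rewrite ler_wpM2r ?exprn_ge0 //.
have -> : 6 * S ^+ 2 = (2 * S) * (3 * S) by ring.
rewrite ler_pM ?sumr_ge0 ?sum_zdistS // => [a _|]; first by rewrite mulr_ge0.
apply: le_trans (sum_zdist phi0); rewrite [leRHS]big_mkcond /=.
by apply: ler_sum => a _; case: (a != 0); rewrite ?mul1r ?mul0r.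
Qed.

Lemma sum_invsqrt m : \sum_(1 <= j < m.+1) (Num.sqrt j%:R)^-1 <= 2 * Num.sqrt m%:R :> R.
Proof.
elim: m => [|m IH]; first by rewrite big_geq // mulr_ge0 ?sqrtr_ge0.
rewrite big_nat_recr //= -lerBrDr; apply: le_trans IH _.
set a := Num.sqrt m%:R; set b := Num.sqrt m.+1%:R.
have a2 : a ^+ 2 = m%:R by rewrite sqr_sqrtr.
have b2 : b ^+ 2 = m%:R + 1 by rewrite sqr_sqrtr // natr1.
have b0 : 0 < b by rewrite sqrtr_gt0 ltr0n.
have a0 : 0 <= a by rewrite sqrtr_ge0.
have : 1 / b <= 2 * (b - a) by rewrite ler_pdivrMr //; nra.
by rewrite div1r; lra.
Qed.

Lemma harmonic_le m : (0 < m)%N -> \sum_(1 <= j < m.+1) j%:R^-1 <= 1 + ln m%:R :> R.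
Proof.
elim: m => // -[_ _|m IH _]; first by rewrite big_nat1 ln1 invr1 addr0.
rewrite big_nat_recr //=; apply: le_trans (_ : 1 + ln m.+1%:R + m.+2%:R^-1 <= _).
  by rewrite lerD2r IH.
rewrite -addrA lerD2l -lerBrDl -ln_div ?posrE ?ltr0n //.
rewrite -[leLHS]opprK -lerN2 -lnV ?posrE ?divr_gt0 ?ltr0n // opprK invf_div.
have -> : m.+1%:R / m.+2%:R = 1 + (- m.+2%:R^-1) :> R.
  have -> : m.+1%:R = m.+2%:R - 1 :> R by apply/esym/eqP; rewrite subr_eq natr1.
  by rewrite mulrBl mulfV ?pnatr_eq0 // mul1r.
by rewrite le_ln1Dx // ltrN2 invf_lt1 ?ltr0n // ltr1n.
Qed.

Let card_torus : #|{: T}|%:R = p%:R ^+ d :> R.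
Proof. by rewrite card_ffun !card_ord natrX. Qed.

Let expp : (2 <= d)%N -> p%:R ^+ d = p%:R ^+ 2 * p%:R ^+ (d - 2) :> R.
Proof. by move=> d2; rewrite -exprD subnKC. Qed.

Local Notation w := (green_weight (0 : T) (@trace_eig R d N)).

(** One factor [w k] is spent on each coordinate. The successor covers [k j = 0], where only
    [w k <= u] is available, at the cost of a factor 2. *)
Let weight_sq (k : T) (i j : 'I_d) : k i != 0 ->
  w k ^+ 2 <= 2 * (p%:R * d.+1%:R) ^+ 2 * ((zdist (k i))%:R^-1 * (zdist (k j)).+1%:R^-1).
Proof.
move=> kiN0; set u := p%:R * d.+1%:R; set a := zdist (k i); set b := zdist (k j).
have u0 : 0 < u by rewrite mulr_gt0 ?ltr0n.
have w0 : 0 <= w k by apply: green_weight_ge0 => l; exact: trace_eig_lt1.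
have a1 : 1 <= a%:R :> R by rewrite ler1n zdist_gt0.
have a0 : 0 < a%:R :> R by apply: lt_le_trans a1.
have wa : w k * a%:R <= u by rewrite -ler_pdivlMr ?trace_weight_le.
have wb : w k * b%:R <= u.
  have [kj0|kjN0] := eqVneq (k j) 0.
    by rewrite /b kj0 /zdist min0n mulr0 ltW.
  by rewrite -ler_pdivlMr ?ltr0n ?zdist_gt0 ?trace_weight_le.
rewrite -invfM ler_pdivlMr ?mulr_gt0 ?(ltr0Sn _ b) // -natr1.
have : w k * a%:R * (w k * (b%:R + 1)) <= u * (2 * u).
  by apply: ler_pM => //; [rewrite mulr_ge0 // ltW|rewrite mulr_ge0 // addr_ge0|nra].
by lra.
Qed.

Lemma sum_trace_weight_sq : (2 <= d)%N ->
  \sum_k w k ^+ 2 <= 12 * (d%:R * d.+1%:R ^+ 2) * (1 + ln p%:R) ^+ 2 * n.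
Proof.
move=> d2.
have := @sum_torus_bound (fun m => m%:R^-1) (fun k => w k ^+ 2)
  (2 * (p%:R * d.+1%:R) ^+ 2) d2.
set S := \sum_(1 <= m < p.+1) _.
have S0 : 0 <= S by apply: sumr_ge0 => m _; rewrite invr_ge0.
have Sl : S <= 1 + ln p%:R by exact: harmonic_le.
move=> H; apply: le_trans (H _ _ _ _ _) _.
- by rewrite mulr_ge0 ?sqr_ge0.
- by move=> m; rewrite invr_ge0.
- by move=> m m0; rewrite lef_pV2 ?posrE ?ltr0n // ler_nat.
- by rewrite /green_weight eqxx expr0n.
- by move=> k i j; exact: weight_sq.
rewrite card_torus expp //; set e := p%:R ^+ (d - 2).
have -> : d%:R * (2 * (p%:R * d.+1%:R) ^+ 2 * (6 * S ^+ 2 * e)) =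
   (12 * (d%:R * d.+1%:R ^+ 2) * (p%:R ^+ 2 * e)) * S ^+ 2 by ring.
rewrite [leRHS]mulrAC ler_wpM2l //; last by rewrite ler_pXn2r // nnegrE // (le_trans S0).
by rewrite !mulr_ge0 ?exprn_ge0.
Qed.

(** The geometric mean of the bounds in two coordinates gives weights 1 / sqrt m, whose sums are of
    order sqrt p. No logarithm appears, so G(0) stays bounded even for d = 2. *)
Lemma sum_trace_weight : (2 <= d)%N ->
  \sum_k w k <= 48 * (d%:R * d.+1%:R) * n.
Proof.
move=> d2.
have := @sum_torus_bound (fun m => (Num.sqrt m%:R)^-1) w (2 * (p%:R * d.+1%:R)) d2.
set S := \sum_(1 <= m < p.+1) _.
have S0 : 0 <= S by apply: sumr_ge0 => m _; rewrite invr_ge0 sqrtr_ge0.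
have Sl : S <= 2 * Num.sqrt p%:R by exact: sum_invsqrt.
move=> H; apply: le_trans (H _ _ _ _ _) _.
- by rewrite !mulr_ge0.
- by move=> m; rewrite invr_ge0 sqrtr_ge0.
- move=> m m0; rewrite lef_pV2 ?posrE ?sqrtr_gt0 ?ltr0n //.
  by rewrite ler_sqrt ?ler_nat.
- by rewrite /green_weight eqxx.
- move=> k i j kiN0; have w0 : 0 <= w k by apply: green_weight_ge0 => l; exact: trace_eig_lt1.
  rewrite -[w k]ger0_norm // -sqrtr_sqr.
  apply: le_trans (_ : Num.sqrt ((2 * (p%:R * d.+1%:R)) ^+ 2 *
    ((zdist (k i))%:R^-1 * (zdist (k j)).+1%:R^-1)) <= _).
    rewrite ler_sqrt; last by rewrite !mulr_ge0 ?sqr_ge0 ?invr_ge0.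
    apply: le_trans (weight_sq j kiN0) _; rewrite ler_wpM2r //.
    by rewrite [leRHS]exprMn ler_wpM2r ?sqr_ge0 //; lra.
  rewrite sqrtrM ?sqr_ge0 // sqrtr_sqr ger0_norm; last by rewrite !mulr_ge0.
  by rewrite sqrtrM ?invr_ge0 // !sqrtrV.
rewrite card_torus expp //; set e := p%:R ^+ (d - 2).
have S2 : S ^+ 2 <= 4 * p%:R.
  have -> : 4 * p%:R = (2 * Num.sqrt p%:R) ^+ 2 :> R by rewrite exprMn sqr_sqrtr //; ring.
  by rewrite ler_pXn2r // nnegrE // (le_trans S0).
have -> : 48 * (d%:R * d.+1%:R) * (p%:R ^+ 2 * e) =
  (12 * d%:R * d.+1%:R * p%:R * e) * (4 * p%:R) by ring.
have -> : d%:R * (2 * (p%:R * d.+1%:R) * (6 * S ^+ 2 * e)) =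
  (12 * d%:R * d.+1%:R * p%:R * e) * S ^+ 2 by ring.
by rewrite ler_wpM2l // !mulr_ge0 ?exprn_ge0.
Qed.

End LatticeSums.

(** * The walk on the cylinder *)

Section CylinderGeometry.
Context (R : realType) (d N : nat).
Local Notation T := (torus d N).
Local Notation C := (cylinder d N).
Local Notation Z := ({ffun 'I_d -> int} * int)%type.

(** Labelling the steps turns the law of a path into a uniform average over sequences of labels. *)
Definition step : Type := ('I_d * bool) + bool.
HB.instance Definition _ := Finite.on step.

Definition move (s : step) (x : C) : C :=
  match s with
  | inl (i, b) => (x.1 + (if b then unit_vec N i else - unit_vec N i), x.2)
  | inr b => (x.1, x.2 + (if b then 1 else -1))
  end.

Lemma card_step : #|{: step}| = (2 * d.+1)%N.
Proof. by rewrite card_sum card_prod card_ord card_bool; lia. Qed.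

Definition sqnorm (u : Z) : nat := (\sum_(i < d) `|u.1 i| ^ 2 + `|u.2| ^ 2)%N.

Lemma eucl_normE u : eucl_norm R u = Num.sqrt (sqnorm u)%:R.
Proof.
have sq (a : int) : a%:~R ^+ 2 = (`|a| ^ 2)%N%:R :> R.
  by rewrite natrX natr_absz intr_norm real_normK ?num_real.
congr (Num.sqrt _); rewrite natrD natr_sum sq; congr (_ + _).
by apply: eq_bigr => i _; rewrite sq.
Qed.

Lemma sqnorm_eq0 u : sqnorm u = 0%N -> u = 0.
Proof.
move/eqP; rewrite addn_eq0 sum_nat_eq0 => /andP[/forallP u1 u2].
case: u u1 u2 => u1 u2 /= H1 H2; congr (_, _).
  by apply/ffunP => i; rewrite ffunE; apply/eqP; have := H1 i; rewrite /= expn_eq0 absz_eq0 andbT.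
by apply/eqP; move: H2; rewrite expn_eq0 absz_eq0 andbT.
Qed.

Lemma cyl_projB (u v : Z) : cyl_proj N (u - v) = cyl_proj N u - cyl_proj N v.
Proof.
by congr (_, _); apply/ffunP => i; rewrite !ffunE rmorphB.
Qed.

Lemma cyl_projD (u v : Z) : cyl_proj N (u + v) = cyl_proj N u + cyl_proj N v.
Proof.
by congr (_, _); apply/ffunP => i; rewrite !ffunE rmorphD.
Qed.

Definition cyl_lift (x : C) : Z := ([ffun i => (x.1 i : nat)%:Z], x.2).

Lemma cyl_liftK x : cyl_proj N (cyl_lift x) = x.
Proof.
case: x => x z; congr (_, _); apply/ffunP => i; rewrite !ffunE /=.
exact: natr_Zp.
Qed.

Let dist_set (x y : C) : set R := [set eucl_norm R (u - v) |
  u in [set u | cyl_proj N u = x] & v in [set v | cyl_proj N v = y]].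

Let dist_set_inf x y : has_inf (dist_set x y).
Proof.
split; last by exists 0 => _ [u _] [v _ <-]; exact: sqrtr_ge0.
exists (eucl_norm R (cyl_lift x - cyl_lift y)); exists (cyl_lift x); first exact: cyl_liftK.
by exists (cyl_lift y) => //; exact: cyl_liftK.
Qed.

Lemma cyl_dist_le (u v : Z) :
  cyl_dist R (cyl_proj N u) (cyl_proj N v) <= eucl_norm R (u - v).
Proof. by apply: ge_inf; [exact: (dist_set_inf _ _).2|exists u => //; exists v]. Qed.

Lemma cyl_dist_ltP x y r : cyl_dist R x y < r ->
  exists e : Z, y = x + cyl_proj N e /\ eucl_norm R e < r.
Proof.
rewrite -subr_gt0 => /(inf_adherent)/(_ (dist_set_inf x y)) [_ [u <-] [v <- <-]].
move=> lt.
have {}lt : eucl_norm R (u - v) < r.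
  by rewrite -[ltRHS](subrK (cyl_dist R (cyl_proj N u) (cyl_proj N v))) [ltRHS]addrC; exact: lt.
exists (v - u); split; first by rewrite cyl_projB addrC subrK.
apply: le_lt_trans lt; rewrite !eucl_normE ler_sqrt // ler_nat /sqnorm.
rewrite leq_eqVlt; apply/orP; left; apply/eqP.
congr (_ + _ ^ _)%N; last by rewrite -abszN opprB.
by apply: eq_bigr => i _; rewrite !ffunE -abszN opprB.
Qed.

Lemma cyl_distD1 x (e : Z) : cyl_dist R x (x + cyl_proj N e) <= eucl_norm R e.
Proof.
rewrite -{1 2}(cyl_liftK x) -cyl_projD; apply: le_trans (cyl_dist_le _ _) _.
rewrite !eucl_normE ler_sqrt // ler_nat /sqnorm leq_eqVlt; apply/orP; left; apply/eqP.
rewrite opprD addrA subrr sub0r; congr (_ + _ ^ _)%N; last by rewrite /= abszN.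
by apply: eq_bigr => i _; rewrite !ffunE abszN.
Qed.

Definition step_vec (s : step) : Z :=
  match s with
  | inl (i, b) => ([ffun j => if j == i then (if b then 1 else -1) else 0], 0)
  | inr b => (0, if b then 1 else -1)
  end.

Lemma sqnorm_step_vec s : sqnorm (step_vec s) = 1%N.
Proof.
case: s => [[i b]|b]; rewrite /sqnorm /=.
  rewrite (bigD1 i) //= ffunE eqxx big1 ?addn0 => [|j /negPf ji]; last by rewrite ffunE ji.
  by case: b.
by rewrite big1 => [|i _]; [case: b|rewrite ffunE].
Qed.

Lemma sqnorm1 e : sqnorm e = 1%N -> exists s, e = step_vec s.
Proof.
have pos (a : int) : a != 0 -> (0 < `|a| ^ 2)%N by rewrite expn_gt0 absz_gt0 orbF.
have abs1 (a : int) : (`|a| ^ 2 = 1)%N -> a = if 0 < a then 1 else -1 by case: ltP; nia.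
case: e => e1 e2; rewrite /sqnorm /=.
have [e20 h|/pos e2N0 h] := eqVneq e2 0; last first.
  have e2a : (`|e2| ^ 2 = 1)%N.
    by move: h; move: (\sum_(i < d) _)%N => S; lia.
  exists (inr (0 < e2)); rewrite /= -abs1 //; congr (_, _).
  have /eqP : (\sum_(i < d) `|e1 i| ^ 2 = 0)%N.
    by move: h; rewrite e2a; move: (\sum_(i < d) _)%N => S; lia.
  rewrite sum_nat_eq0 => /forallP H; apply/ffunP => i; rewrite ffunE.
  by apply/eqP; have := H i; rewrite /= expn_eq0 absz_eq0 andbT.
rewrite e20 /= addn0 in h *.
have [i ei] : exists i, e1 i != 0.
  apply/existsP; rewrite -negb_forall; apply/negP => /forallP H.
  by move: h; rewrite big1 // => i _; rewrite (eqP (H i)).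
rewrite (bigD1 i) //= in h.
exists (inl (i, 0 < e1 i)); congr (_, _) => /=; apply/ffunP => j; rewrite ffunE.
have [->|ji] := eqVneq j i; first by apply: abs1; move: h (pos _ ei); move: (\sum_(_ < d | _) _)%N (`|e1 i| ^ 2)%N => S a; lia.
have /eqP : (\sum_(i0 < d | i0 != i) `|e1 i0| ^ 2 = 0)%N.
  by move: h (pos _ ei); move: (\sum_(_ < d | _) _)%N (`|e1 i| ^ 2)%N => S a; lia.
by rewrite sum_nat_eq0 => /forallP /(_ j); rewrite ji /= expn_eq0 absz_eq0 andbT => /eqP.
Qed.

Lemma move_step_vec s x : move s x = x + cyl_proj N (step_vec s).
Proof.
case: x => x z; case: s => [[i b]|b]; congr (_, _) => /=; rewrite ?addr0 //.
  congr (_ + _); apply/ffunP => j; case: b; rewrite !ffunE /=;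
    by case: eqVneq => _; rewrite ?rmorphN1 ?oppr0.
by apply/ffunP => j; rewrite !ffunE addr0.
Qed.

Context (N3 : (3 <= N)%N).

Let pN : (Zp_trunc N).+2 = N. Proof. by rewrite Zp_cast //; exact: ltn_trans N3. Qed.

Let Zp_one_neq0 : 1 != 0 :> 'Z_N. Proof. exact: oner_neq0. Qed.

Let Zp_one_neqN1 : 1 != -1 :> 'Z_N.
Proof.
rewrite -subr_eq0 opprK -[1 + 1]/(2%:R) Zp_nat -val_eqE /=.
by rewrite modn_small // pN.
Qed.

Lemma move_neq s x : move s x != x.
Proof.
case: x => x z; case: s => [[i b]|b]; rewrite xpair_eqE /= ?eqxx ?andbT /=; last by case: b; lia.
rewrite -subr_eq0 addrAC subrr add0r; apply/negP => /eqP /ffunP /(_ i).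
by case: b; rewrite !ffunE eqxx => /eqP; rewrite ?oppr_eq0 (negPf Zp_one_neq0).
Qed.

(** Needs N >= 3: in Z/2Z the two steps along a coordinate coincide. *)
Lemma move_inj x : injective (move^~ x).
Proof.
case: x => x z [[i b]|b] [[i' b']|b'] [] /=; last by case: b; case: b' => //; lia.
- move=> /addrI e; suff ii : i = i'.
    rewrite -ii in e *; congr (inl (_, _)); move/ffunP/(_ i): e.
    by case: b; case: b' => //; rewrite !ffunE eqxx => /eqP;
      [|rewrite eq_sym]; rewrite (negPf Zp_one_neqN1).
  apply/eqP; apply: contraT => ii; move/ffunP/(_ i): e.
  by case: b; case: b'; rewrite !ffunE eqxx (negPf ii) => /eqP;
    rewrite ?oppr0 ?oppr_eq0 (negPf Zp_one_neq0).
- by move=> _; case: b'; lia.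
- by move=> _; case: b; lia.
Qed.

Lemma neighboursE x : neighbours R x = [set move s x | s in [set: step]].
Proof.
apply/seteqP; split => [y /= dxy|_ [s _ <-] /=].
  (* Squared norms are integers, so a representative of norm below sqrt 2 has squared norm 0 or 1;
     attainment of the infimum is not an issue. *)
  have sqrt2 : 1 < Num.sqrt 2 :> R by rewrite -[ltLHS]sqrtr1 ltr_sqrt // ltr1n.
  have [|e [ye]] := @cyl_dist_ltP x y (Num.sqrt 2); first by rewrite dxy.
  rewrite eucl_normE ltr_sqrt // ltr_nat => e2.
  have e0 : sqnorm e != 0%N.
    apply/negP => /eqP e0; have := cyl_distD1 x e.
    by rewrite -ye dxy eucl_normE e0 sqrtr0 ler10.
  have [s es] : exists s, e = step_vec s by apply: sqnorm1; lia.
  by exists s => //; rewrite move_step_vec -es.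
apply/le_anti/andP; split.
  rewrite move_step_vec; apply: le_trans (cyl_distD1 _ _) _.
  by rewrite eucl_normE sqnorm_step_vec sqrtr1.
rewrite leNgt; apply/negP => /cyl_dist_ltP [e [me]].
rewrite eucl_normE -[ltRHS]sqrtr1 ltr_sqrt // ltrn1 ltnS leqn0 => /eqP /sqnorm_eq0 e0.
have := move_neq s x; rewrite me e0; case: x {me} => x z.
rewrite xpair_eqE /= addr0 eqxx andbT => /negP; apply.
by apply/eqP/ffunP => i; rewrite !ffunE addr0.
Qed.

Lemma srw_kernel_move s x : srw_kernel R x (move s x) = (2 * d.+1)%:R^-1.
Proof.
rewrite /srw_kernel ifT; last by rewrite inE neighboursE; exists s.
have fin : finite_set [set: step] by exact: finite_finset.
congr (_^-1)%R; congr (_%:R)%R; rewrite neighboursE fset_set_image //.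
rewrite card_imfset /=; last exact: move_inj.
rewrite -card_step cardE; apply/perm_size/uniq_perm.
- exact: fset_uniq.
- exact: enum_uniq.
- by move=> t; apply/idP/idP => _; [rewrite mem_enum|rewrite in_fset_set // inE].
Qed.

Lemma card_close_le x r K : r < K%:R ->
  (#|[pred y : T | (cyl_dist R ((x, 0) : C) (y, 0) <= r)%R]| <= (2 * K).+1 ^ d)%N.
Proof.
move=> rK.
pose f (c : {ffun 'I_d -> 'I_(2 * K).+1}) : T := [ffun i => x i + ((c i)%:Z - K%:Z)%:~R].
apply: (@leq_trans #|codom f|); last by apply: leq_trans (leq_image_card f _) _;
  rewrite card_ffun !card_ord.
apply: subset_leq_card; apply/fintype.subsetP => y; rewrite inE => yr.
have [e [ye]] := cyl_dist_ltP (le_lt_trans yr rK).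
rewrite eucl_normE => lt; have K0 : 0 < K%:R :> R by apply: le_lt_trans lt; exact: sqrtr_ge0.
have {}lt : (sqnorm e < K ^ 2)%N.
  rewrite -(ltr_nat R) natrX; rewrite -(sqr_sqrtr (ler0n _ (sqnorm e))).
  by rewrite ltr_pXn2r // nnegrE ?sqrtr_ge0 // ltW.
have eK i : (`|e.1 i| < K)%N.
  have : (`|e.1 i| ^ 2 <= sqnorm e)%N by rewrite /sqnorm (bigD1 i) //=; lia.
  by nia.
apply/codomP; exists [ffun i => inord (absz (e.1 i + K%:Z)%R)].
apply/ffunP => i; rewrite !ffunE inordK; last by have := eK i; lia.
move: ye => /(congr1 fst) /= ->; rewrite !ffunE; congr (_ + _%:~R).
by have := eK i; lia.
Qed.

End CylinderGeometry.

Section FiniteProbability.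
Context (R : realType) (disp : measure_display) (Omega : measurableType disp).
Context (P : probability Omega R).
Implicit Types A B : set Omega.

Definition pr A : R := fine (P A).

Lemma prE A : measurable A -> P A = (pr A)%:E.
Proof. by move=> mA; rewrite fineK // fin_num_measure. Qed.

Lemma pr_ge0 A : 0 <= pr A.
Proof. by rewrite fine_ge0. Qed.

Lemma le_pr A B : measurable A -> measurable B -> A `<=` B -> pr A <= pr B.
Proof.
by move=> mA mB AB; rewrite -lee_fin -!prE // le_measure // inE.
Qed.

Lemma prD A B : measurable A -> measurable B -> pr B = pr (B `&` A) + pr (B `\` A).
Proof.
move=> mA mB; have mI := measurableI _ _ mB mA; have mD := measurableD mB mA.
apply: EFin_inj; rewrite EFinD -!prE // addeC; exact: measureDI.
Qed.

Lemma sum_pr_le (I : eqType) (l : seq I) (F : I -> set Omega) B : uniq l ->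
  (forall i, measurable (F i)) -> measurable B -> (forall i, F i `<=` B) ->
  (forall i j w, F i w -> F j w -> i = j) -> \sum_(i <- l) pr (F i) <= pr B.
Proof.
move=> + mF mB FB inj.
suff H (D : set Omega) : measurable D -> uniq l -> (forall i, i \in l -> F i `<=` D) ->
    \sum_(i <- l) pr (F i) <= pr D.
  by move=> ul; exact: H.
elim: l D => [|i l IH] D mD; first by rewrite big_nil pr_ge0.
rewrite cons_uniq => /andP[il ul] FD; rewrite big_cons (prD (mF i) mD) lerD //.
  apply: le_pr => //; first exact: measurableI.
  by move=> w Fw; split => //; apply: (FD i) => //; rewrite inE eqxx.
apply: IH => //; first exact: measurableD.
move=> j jl w Fw; split; first by apply: (FD j) => //; rewrite inE jl orbT.
by move=> Fiw; move: il; rewrite (inj _ _ _ Fiw Fw) jl.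
Qed.

(** The pieces are only required to carry the mass of [B], not to cover it: on a null event [X] may
    jump off the edges of the graph. *)
Lemma pr_partition_le (I : finType) (F : I -> set Omega) B E :
  (forall i, measurable (F i)) -> measurable B -> measurable E ->
  (forall i, F i `<=` B) -> (forall i j w, F i w -> F j w -> i = j) ->
  pr B <= \sum_i pr (F i) -> pr (B `&` E) <= \sum_i pr (F i `&` E).
Proof.
move=> mF mB mE FB inj BF.
have : \sum_i pr (F i `\` E) <= pr (B `\` E).
  apply: sum_pr_le => //; [exact: index_enum_uniq| | | |].
  - by move=> i; exact: measurableD.
  - exact: measurableD.
  - by move=> i w [Fw Ew]; split => //; exact: FB Fw.
  - by move=> i j w [Fi _] [Fj _]; exact: inj Fi Fj.
move: BF; rewrite (prD mE mB).
under eq_bigr do rewrite (prD mE (mF _)).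
by rewrite big_split /=; lra.
Qed.

End FiniteProbability.

(** * Averages over step sequences and the law of the walk *)

Section PathAverage.
Context (R : realType) (S : finType).
Local Notation c := (#|{: S}|%:R : R).
Implicit Types f g : seq S -> R.

Fixpoint avg m f : R :=
  if m is m'.+1 then c^-1 * \sum_s avg m' (fun l => f (s :: l)) else f [::].

Lemma avg_le m f g : (forall l, size l = m -> f l <= g l) -> avg m f <= avg m g.
Proof.
elim: m f g => [|m IH] f g H /=; first exact: H.
rewrite ler_wpM2l ?invr_ge0 //; apply: ler_sum => s _.
by apply: IH => l lm; apply: H; rewrite /= lm.
Qed.

Lemma eq_avg m f g : f =1 g -> avg m f = avg m g.
Proof. by move=> e; apply/le_anti/andP; split; apply: avg_le => l _; rewrite e. Qed.

Lemma avgD m f g : avg m (fun l => f l + g l) = avg m f + avg m g.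
Proof.
elim: m f g => [//|m IH] f g /=; rewrite -mulrDr -big_split; congr (_ * _).
by apply: eq_bigr => s _; rewrite IH.
Qed.

Lemma avgZ m a f : avg m (fun l => a * f l) = a * avg m f.
Proof.
elim: m f => [//|m IH] f /=; rewrite mulrCA [in RHS]mulr_sumr; congr (_ * _).
by apply: eq_bigr => s _; rewrite IH.
Qed.

Lemma avg0 m : avg m (fun=> 0) = 0.
Proof. by have := avgZ m 0 (fun=> 0); rewrite !mul0r. Qed.

Lemma avg_sum m (I : finType) (Q : pred I) (F : I -> seq S -> R) :
  avg m (fun l => \sum_(i | Q i) F i l) = \sum_(i | Q i) avg m (F i).
Proof.
elim: m F => [//|m IH] F /=.
under eq_bigr do rewrite IH; rewrite exchange_big mulr_sumr.
by apply: eq_bigr.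
Qed.

Lemma avg_ge0 m f : (forall l, 0 <= f l) -> 0 <= avg m f.
Proof. by move=> f0; rewrite -(avg0 m); apply: avg_le. Qed.

Lemma avg_const m a : (0 < #|{: S}|)%N -> avg m (fun=> a) = a.
Proof.
move=> S0; elim: m => [//|m IH] /=; under eq_bigr do rewrite IH.
by rewrite sumr_const -[a *+ _]mulr_natl mulKf // pnatr_eq0 -lt0n.
Qed.

End PathAverage.

Section PathLaw.
Context (R : realType) (d N : nat) (disp : measure_display).
Context (Omega : measurableType disp) (P : probability Omega R).
Context (X : nat -> Omega -> cylinder d N) (hX : is_srw P X) (N3 : (3 <= N)%N).
Local Notation T := (torus d N).
Local Notation C := (cylinder d N).
Local Notation n := (#|{: T}|%:R : R).
Local Notation c := (#|{: step d}|%:R : R).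

Definition walk (x : C) (l : seq (step d)) (i : nat) : C :=
  foldl (fun y s => move s y) x (take i l).

Definition path_event (x : C) (l : seq (step d)) : set Omega :=
  [set w | forall i, (i <= size l)%N -> X i w = walk x l i].

Lemma walk_rcons x l s i : (i <= size l)%N -> walk x (rcons l s) i = walk x l i.
Proof. by move=> il; rewrite /walk -cats1 takel_cat. Qed.

Lemma walk_rcons_last x l s :
  walk x (rcons l s) (size l).+1 = move s (walk x l (size l)).
Proof. by rewrite /walk !take_oversize ?size_rcons // -cats1 foldl_cat. Qed.

Lemma measurable_path_event x l : measurable (path_event x l).
Proof.
rewrite (_ : path_event x l =
  \bigcap_(i in [set i | (i <= size l)%N]) (X i @^-1` [set walk x l i])) //.
apply: bigcap_measurable => [|i _]; first by exists 0%N.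
exact: (srw_measurable hX).
Qed.

Lemma pr_path_event (x : T) l : pr P (path_event (x, 0) l) = n^-1 * c^-1 ^+ size l.
Proof.
elim/last_ind: l => [|l s IH].
  rewrite expr0 mulr1 /pr (_ : path_event _ _ = [set w | X 0%N w = (x, 0)]).
    by rewrite (srw_start hX) eqxx.
  by apply/seteqP; split => w /= => [|H [|]] //; exact.
have := srw_step hX (size l) (walk (x, 0) (rcons l s)).
rewrite walk_rcons_last walk_rcons // srw_kernel_move // /pr /path_event size_rcons => ->.
rewrite (_ : [set w | _] = path_event (x, 0) l); last first.
  by apply/seteqP; split => w /= H i il; rewrite ?walk_rcons // H ?walk_rcons.
rewrite prE; last exact: measurable_path_event.
by rewrite -EFinM /= -/(pr P _) IH exprSr mulrA card_step.
Qed.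

Lemma path_event_rcons x l s : path_event x (rcons l s) `<=` path_event x l.
Proof.
move=> w H i il; rewrite -(walk_rcons x s) //; apply: H.
by rewrite size_rcons ltnW // ltnS.
Qed.

Lemma step_gt0 : (0 < #|{: step d}|)%N.
Proof. by rewrite card_step. Qed.

(** Transfers finite computations to [Omega]: a function of [m] further steps that is at least 1
    whenever [E] occurs dominates [E], even though [E] depends on the whole trajectory. *)
Lemma pr_path_event_le (x : T) l m (E : set Omega) (f : seq (step d) -> R) :
  measurable E -> (forall l', 0 <= f l') ->
  (forall l' w, size l' = m -> E w -> path_event (x, 0) (l ++ l') w -> 1 <= f l') ->
  pr P (path_event (x, 0) l `&` E) <= n^-1 * c^-1 ^+ size l * avg m f.
Proof.
move=> mE; elim: m l f => [|m IH] l f f0 Hf.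
  rewrite /=; have [E0|/set0P [w [pw Ew]]] := eqVneq (path_event (x, 0) l `&` E) set0.
    by rewrite E0 /pr measure0 mulr_ge0 // mulr_ge0 ?exprn_ge0 ?invr_ge0.
  have f1 : 1 <= f [::] by apply: (Hf _ w) => //; rewrite cats0.
  apply: (@le_trans _ _ (pr P (path_event (x, 0) l))).
    apply: le_pr; last by move=> w' [].
      by apply: measurableI => //; exact: measurable_path_event.
    exact: measurable_path_event.
  by rewrite pr_path_event ler_peMr // mulr_ge0 ?exprn_ge0 ?invr_ge0.
have cN0 : c != 0 by rewrite pnatr_eq0 -lt0n step_gt0.
apply: (@le_trans _ _ (\sum_s pr P (path_event (x, 0) (rcons l s) `&` E))).
  apply: pr_partition_le => //.
  - by move=> s; exact: measurable_path_event.
  - exact: measurable_path_event.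
  - by move=> s; exact: path_event_rcons.
  - move=> s s' w /(_ (size l).+1) + /(_ (size l).+1).
    rewrite !size_rcons leqnn => /(_ isT) + /(_ isT) => ->.
    by rewrite !walk_rcons_last => /(move_inj N3).
  - under eq_bigr do rewrite pr_path_event size_rcons exprSr.
    rewrite sumr_const pr_path_event -[leRHS]mulr_natl.
    set u := c^-1 ^+ _; suff -> : n^-1 * u = c * (n^-1 * (u * c^-1)) by [].
    by field; rewrite cN0 (card_neq0 R (0 : T)).
rewrite /= mulrA -[_ * _ * c^-1]mulrA -exprSr mulr_sumr; apply: ler_sum => s _.
rewrite -(size_rcons l s); apply: IH => // l' w lm Ew; rewrite cat_rcons => H.
by apply: (Hf _ w) => //; rewrite /= lm.
Qed.

Lemma pr_le_avg m (E : set Omega) (f : T -> seq (step d) -> R) :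
  measurable E -> (forall x l, 0 <= f x l) ->
  (forall x l w, size l = m -> E w -> path_event (x, 0) l w -> 1 <= f x l) ->
  pr P E <= n^-1 * \sum_x avg m (f x).
Proof.
move=> mE f0 Hf.
have nN0 : n != 0 by exact: (card_neq0 R (0 : T)).
apply: (@le_trans _ _ (\sum_x pr P (path_event (x, 0) [::] `&` E))).
  rewrite -[E in leLHS]setTI; apply: pr_partition_le => //.
  - by move=> x; exact: measurable_path_event.
  - move=> x y w /(_ 0%N isT) + /(_ 0%N isT) => ->.
    by rewrite /walk /= => -[].
  - under eq_bigr do rewrite pr_path_event.
    by rewrite sumr_const -[leRHS]mulr_natl expr0 mulr1 mulfV // /pr probability_setT.
rewrite mulr_sumr; apply: ler_sum => x _.
have := @pr_path_event_le x [::] m E (f x) mE; rewrite expr0 mulr1; apply => //.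
exact: Hf.
Qed.

End PathLaw.

(** * Visits to level 0 and recurrence *)

Section Excursions.
Context (R : realType) (d N : nat).
Local Notation T := (torus d N).
Local Notation C := (cylinder d N).
Local Notation n := (#|{: T}|%:R : R).
Local Notation c := (#|{: step d}|%:R : R).
Local Notation casf := (@cas R d N).
Implicit Types (x : C) (f : T -> R) (A : {pred T}) (l : seq (step d)).

Fixpoint visits x l : seq T :=
  (if x.2 == 0 then [:: x.1] else [::]) ++
  (if l is s :: l' then visits (move s x) l' else [::]).

(** Trace times run from 0 to [t], hence [t + 1] visits. Walks too short to have made them do not
    count as missing [A]. *)
Definition misses A t x l : bool :=
  (t < size (visits x l))%N && all (fun y => y \notin A) (take t.+1 (visits x l)).

Lemma visits_off x l : x.2 != 0 ->
  visits x l = if l is s :: l' then visits (move s x) l' else [::].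
Proof. by case: l => [|s l] /= /negPf ->. Qed.

Lemma visits_on x l : x.2 = 0 ->
  visits x l = x.1 :: (if l is s :: l' then visits (move s x) l' else [::]).
Proof. by case: l => [|s l] /= ->. Qed.

Lemma sum_step (g : C -> R) x :
  \sum_s g (move s x) =
  \sum_i (g (x.1 + unit_vec N i, x.2) + g (x.1 - unit_vec N i, x.2)) +
  (g (x.1, x.2 + 1) + g (x.1, x.2 - 1)).
Proof.
rewrite big_sumType /= big_bool /=; congr (_ + _).
transitivity (\sum_i \sum_b g (move (inl (i, b)) x)).
  by rewrite pair_bigA; apply: eq_bigr => -[i b].
by apply: eq_bigr => i _; rewrite big_bool.
Qed.

Let cE : c = 2 * d.+1%:R. Proof. by rewrite card_step natrM. Qed.
Let c_gt0 : 0 < c. Proof. by rewrite cE mulr_gt0. Qed.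

(** The bounded harmonic extension of [f] from level 0 to the cylinder, mode by mode. *)
Definition harmonic_ext f x : R :=
  n^-1 * \sum_(k : T) decay R k ^+ `|x.2| * hat casf f k * casf k x.1.

Lemma harmonic_ext0 f x : x.2 = 0 -> harmonic_ext f x = f x.1.
Proof.
move=> x0; rewrite (hat_inv (@cas_orth R d N) f); congr (_ * _).
by apply: eq_bigr => k _; rewrite x0 expr0 mul1r.
Qed.

Lemma sum_cas_step (k : T) x (h : int -> R) :
  \sum_s (h (move s x).2 * casf k (move s x).1) =
  ((d%:R - vert_cost R k) * 2 * h x.2 + h (x.2 + 1) + h (x.2 - 1)) * casf k x.1.
Proof.
rewrite (sum_step (fun y => h y.2 * casf k y.1)) /=.
transitivity (\sum_i (2 * h x.2 * casf k x.1) * zcos R (k i) +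
  (h (x.2 + 1) * casf k x.1 + h (x.2 - 1) * casf k x.1)).
  congr (_ + _); apply: eq_bigr => i _.
  by rewrite -mulrDr casD_add_sub torus_dot_unit; ring.
rewrite -mulr_sumr.
have -> : \sum_i zcos R (k i) = d%:R - vert_cost R k.
  by rewrite /vert_cost sumrB sumr_const card_ord opprB addrC subrK.
by ring.
Qed.

Lemma exp_neighbours (r : R) (z : int) : 0 < r -> z != 0 ->
  r ^+ `|z + 1| + r ^+ `|z - 1| = r ^+ `|z| * (r + r^-1).
Proof.
move=> r0 z0; have [j zE] : exists j, `|z|%N = j.+1 by exists `|z|.-1%N; lia.
have -> : r ^+ `|z| * (r + r^-1) = r ^+ j.+2 + r ^+ j.
  by rewrite zE mulrDr -exprSr [X in _ + X / _]exprSr mulfK ?gt_eqF.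
have [zp|zn] := ltP 0 z.
  by congr (_ ^+ _ + _ ^+ _); lia.
by rewrite [LHS]addrC; congr (_ ^+ _ + _ ^+ _); lia.
Qed.

(** This is where the spectral operator is recognised as the trace: the extension is harmonic off
    level 0, and its average after a step from level 0 is [Q f]. *)
Lemma harmonic_ext_step f x : c^-1 * \sum_s harmonic_ext f (move s x) =
  if x.2 == 0 then spec casf (@trace_eig R d N) f x.1 else harmonic_ext f x.
Proof.
have -> : \sum_s harmonic_ext f (move s x) =
    n^-1 * \sum_(k : T) hat casf f k *
      (((d%:R - vert_cost R k) * 2 * decay R k ^+ `|x.2| + decay R k ^+ `|x.2 + 1| +
        decay R k ^+ `|x.2 - 1|) * casf k x.1).
  rewrite /harmonic_ext -mulr_sumr exchange_big; congr (_ * _).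
  apply: eq_bigr => k _; rewrite -(sum_cas_step k x (fun z => decay R k ^+ `|z|)).
  by rewrite mulr_sumr; apply: eq_bigr => s _; ring.
have cN0 : c != 0 by rewrite gt_eqF.
have D0 : d.+1%:R != 0 :> R by rewrite pnatr_eq0.
have dE : d%:R = d.+1%:R - 1 :> R by rewrite -natr1 addrK.
case: eqVneq => [x0|xN0]; rewrite mulrCA; congr (_ * _); rewrite mulr_sumr;
  apply: eq_bigr => k _; rewrite mulrA mulrA.
  by rewrite x0 trace_eigE expr0 expr1 cE; field; rewrite addrC natr1 D0.
have := @decay_inv R d N k; have := decay_gt0 R k.
set r := decay R k; set v := vert_cost R k => r0 rE.
have ve : v = (r + r^-1) / 2 - 1 by lra.
have e : r ^+ `|x.2 + 1| + r ^+ `|x.2 - 1| = r ^+ `|x.2| * (r + r^-1).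
  exact: (exp_neighbours r0 xN0).
move: e; set a := r ^+ `|x.2|; set b := r ^+ `|x.2 + 1|; set b' := r ^+ `|x.2 - 1|.
move=> e; have {}e : b = a * (r + r^-1) - b' by rewrite -e addrK.
by rewrite e cE dE ve; field; rewrite addrC natr1 D0 gt_eqF.
Qed.

(** The probability, as a function of its starting point, that the trace avoids [A] at times 0, ...,
    j. *)
Definition hit_value A j := iter j (killed casf (@trace_eig R d N) A) (off R A).

Definition ext_bound f : R := n^-1 * \sum_(k : T) `|hat casf f k| * 2.

Lemma ext_bound_ge0 f : 0 <= ext_bound f.
Proof.
by apply: mulr_ge0; rewrite ?invr_ge0 // sumr_ge0 // => k _; rewrite mulr_ge0.
Qed.

Lemma harmonic_ext_bound f x : `|harmonic_ext f x| <= ext_bound f.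
Proof.
rewrite /harmonic_ext /ext_bound normrM ger0_norm ?invr_ge0 // ler_wpM2l ?invr_ge0 //.
apply: le_trans (ler_norm_sum _ _ _) _; apply: ler_sum => k _.
rewrite !normrM ler_pM ?mulr_ge0 ?normr_ge0 ?normr_cas //.
rewrite ger0_norm ?exprn_ge0 ?(ltW (decay_gt0 R k)) // ler_piMl //.
by rewrite exprn_ile1 ?decay_le1 ?(ltW (decay_gt0 R k)).
Qed.

Definition late t m x : R := avg m (fun l => (size (visits x l) <= t)%N%:R).

Lemma late_ge0 t m x : 0 <= late t m x.
Proof. by apply: avg_ge0. Qed.

Lemma late_le1 t m x : late t m x <= 1.
Proof.
rewrite -(avg_const m (1 : R) (step_gt0 d)); apply: avg_le => l _.
by case: (_ <= _)%N.
Qed.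

Lemma late_off t m x : x.2 != 0 ->
  late t m.+1 x = c^-1 * \sum_s late t m (move s x).
Proof.
move=> x0; rewrite /late /=; congr (_ * _); apply: eq_bigr => s _.
by apply: eq_avg => l; rewrite (negPf x0).
Qed.

Lemma late_on t m x : x.2 = 0 ->
  late t.+1 m.+1 x = c^-1 * \sum_s late t m (move s x).
Proof.
move=> x0; rewrite /late /=; congr (_ * _); apply: eq_bigr => s _.
by apply: eq_avg => l; rewrite x0 eqxx.
Qed.

(** The average and the extension obey the same one-step recursion, in which [t] drops at each
    visit. They differ only through the terminal values on walks with at most [t] visits, and there
    by at most [B], uniformly over the times up to [J] met on the way. *)
Lemma misses_converges A J B m t x : (t <= J)%N ->
  (forall j, (j <= J)%N -> ext_bound (hit_value A j) <= B) ->
  `|avg m (fun l => (misses A t x l)%:R : R) - harmonic_ext (hit_value A t) x| <=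
  B * late t m x.
Proof.
move=> + HB; have B0 : 0 <= B.
  exact: le_trans (ext_bound_ge0 _) (HB 0%N isT).
elim: m t x => [|m IH] t x tJ.
  rewrite /late /= /misses /=.
  have [x0|xN0] := eqVneq x.2 0; last first.
    rewrite /= mulr1 sub0r normrN.
    exact: le_trans (harmonic_ext_bound _ _) (HB _ tJ).
  rewrite /= harmonic_ext0 //; case: t tJ => [|t] tJ /=.
    by rewrite andbT /hit_value /= subrr normr0 mulr0.
  rewrite mulr1 sub0r normrN -harmonic_ext0 //.
  exact: le_trans (harmonic_ext_bound _ _) (HB _ tJ).
have step_bound j (g h : step d -> R) : (forall s, `|g s - h s| <= B * late j m (move s x)) ->
    `|c^-1 * \sum_s g s - c^-1 * \sum_s h s| <= B * (c^-1 * \sum_s late j m (move s x)).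
  move=> H; rewrite -mulrBr -sumrB normrM ger0_norm ?invr_ge0 // mulrCA ler_wpM2l ?invr_ge0 //.
  by rewrite mulr_sumr; apply: le_trans (ler_norm_sum _ _ _) _; exact: ler_sum.
have [x0|xN0] := eqVneq x.2 0; last first.
  rewrite late_off //.
  have := harmonic_ext_step (hit_value A t) x; rewrite (negPf xN0) => <-.
  have -> : avg m.+1 (fun l => (misses A t x l)%:R : R) =
    c^-1 * \sum_s avg m (fun l => (misses A t (move s x) l)%:R).
    congr (_ * _); apply: eq_bigr => s _; apply: eq_avg => l.
    by rewrite /misses visits_off.
  by apply: step_bound => s; exact: IH.
rewrite harmonic_ext0 //; case: t tJ => [|t] tJ.
  rewrite (_ : avg _ _ = hit_value A 0%N x.1).
    by rewrite subrr normr0 mulr_ge0 ?late_ge0.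
  rewrite -[RHS](avg_const m.+1 _ (step_gt0 d)); apply: eq_avg => l.
  by rewrite /misses visits_on //= take0 /= andbT.
rewrite late_on // /hit_value iterS -/(hit_value A t) /killed.
have := harmonic_ext_step (hit_value A t) x; rewrite x0 eqxx => <-.
have -> : avg m.+1 (fun l => (misses A t.+1 x l)%:R) =
    off R A x.1 * (c^-1 * \sum_s avg m (fun l => (misses A t (move s x) l)%:R)).
  rewrite [RHS]mulrCA /=; congr (_ * _); rewrite mulr_sumr; apply: eq_bigr => s _.
  rewrite -avgZ; apply: eq_avg => l; rewrite /misses (visits_on _ x0) /= ltnS /off.
  by rewrite andbCA; case: (x.1 \notin A) => /=; rewrite ?mul1r ?mul0r.
rewrite -mulrBr normrM; set D := `|_ - _|.
apply: (@le_trans _ _ (1 * D)).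
  by rewrite ler_wpM2r ?normr_ge0 // /off; case: (x.1 \in A); rewrite /= ?normr1 ?normr0.
by rewrite mul1r; apply: step_bound => s; apply: IH; exact: ltnW.
Qed.

Section Recurrence.
Context (rho : R) (rho0 : 0 < rho) (rho1 : rho <= 1).
(** Off level 0, rho^|z| is multiplied by [kappa] on average over a step. Discounting each step by 1
    / kappa, [theta] is the discount of a whole excursion from level 0 back to it. *)
Let kappa : R := (d%:R + (rho + rho^-1) / 2) / d.+1%:R.
Let theta : R := kappa^-1 * ((d%:R + rho) / d.+1%:R).

Let rhoV : 2 <= rho + rho^-1.
Proof.
rewrite -subr_ge0; have -> : rho + rho^-1 - 2 = (1 - rho) ^+ 2 / rho.
  by field; rewrite gt_eqF.
by rewrite divr_ge0 ?sqr_ge0 // ltW.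
Qed.

Let kappa1 : 1 <= kappa.
Proof.
by rewrite /kappa ler_pdivlMr ?ltr0n // mul1r -natr1 lerD2l; have := rhoV; lra.
Qed.

Let theta_ge0 : 0 <= theta.
Proof.
rewrite mulr_ge0 ?invr_ge0 ?(le_trans ler01 kappa1) // divr_ge0 // addr_ge0 //.
exact: ltW.
Qed.

Lemma theta_le1 : theta <= 1.
Proof.
rewrite /theta mulrC ler_pdivrMr ?(lt_le_trans ltr01 kappa1) // mul1r.
rewrite /kappa ler_pM2r ?invr_gt0 ?ltr0n // lerD2l.
by have := rhoV; have := rho1; lra.
Qed.

Let avg_rho x : c^-1 * \sum_s rho ^+ `|(move s x).2| =
  if x.2 == 0 then (d%:R + rho) / d.+1%:R else kappa * rho ^+ `|x.2|.
Proof.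
have D0 : d.+1%:R != 0 :> R by rewrite pnatr_eq0.
have dE : d%:R = d.+1%:R - 1 :> R by rewrite -natr1 addrK.
rewrite (sum_step (fun y => rho ^+ `|y.2|)) /= sumr_const card_ord -[_ *+ d]mulr_natl cE.
case: eqVneq => [->|xN0]; first by rewrite expr0 expr1; field.
rewrite (exp_neighbours rho0 xN0) /kappa; set a := rho ^+ _.
by field; rewrite ?(addrC 1) ?natr1 ?pnatr_eq0 ?gt_eqF.
Qed.

(* Supersolution coming from [E[kappa ^- tau] = rho ^ |z| * theta ^ t], where
   [tau] is the time of visit number [t] (counted from 0) to level 0. *)
Lemma late_supersolution t m x :
  late t m x <= 1 - rho ^+ `|x.2| * theta ^+ t + kappa ^- m.
Proof.
have k0 : 0 < kappa by exact: lt_le_trans kappa1.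
have w1 j (z : int) : rho ^+ `|z| * theta ^+ j <= 1.
  by apply: mulr_ile1; rewrite ?exprn_ge0 ?exprn_ile1 ?theta_le1 ?theta_ge0 ?(ltW rho0).
elim: m t x => [|m IH] t x.
  rewrite expr0 invr1; apply: le_trans (late_le1 _ _ _) _.
  by have := w1 t x.2; lra.
have qE : kappa ^- m = kappa * kappa ^- m.+1.
  by rewrite exprS invfM mulrA mulfV ?mul1r // gt_eqF.
(* If [w] is at most kappa^-(m+1), the claimed bound is at least 1. Otherwise the gain (kappa - 1) w
   of one step pays for the loss (kappa - 1) kappa^-(m+1). *)
set w := rho ^+ _ * _; have [wq|qw] := leP w (kappa ^- m.+1).
  by apply: le_trans (late_le1 _ _ _) _; lra.
have key : 1 - kappa * w + kappa ^- m <= 1 - w + kappa ^- m.+1.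
  have : 0 <= (kappa - 1) * (w - kappa ^- m.+1) by rewrite mulr_ge0 ?subr_ge0 // ltW.
  by rewrite qE; lra.
have step_le j : c^-1 * \sum_s late j m (move s x) <=
    1 - theta ^+ j * (c^-1 * \sum_s rho ^+ `|(move s x).2|) + kappa ^- m.
  apply: (@le_trans _ _ (c^-1 * \sum_s (1 - rho ^+ `|(move s x).2| * theta ^+ j + kappa ^- m))).
    by rewrite ler_wpM2l ?invr_ge0 //; apply: ler_sum => s _; exact: IH.
  have cst (a : R) : c^-1 * (a *+ #|{: step d}|) = a.
    by rewrite -[a *+ _]mulr_natl mulKf // gt_eqF.
  rewrite big_split sumrB /= -mulr_suml !sumr_const mulrDr mulrBr !cst.
  by rewrite mulrA [_ * theta ^+ j]mulrC.
have [x0|xN0] := eqVneq x.2 0; last first.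
  rewrite late_off //; apply: le_trans (step_le t) _.
  rewrite avg_rho (negPf xN0).
  by rewrite (_ : theta ^+ t * (kappa * rho ^+ `|x.2|) = kappa * w) // /w; ring.
case: t @w qw key => [|t] w qw key.
  rewrite (_ : late 0 m.+1 x = 0); last first.
    rewrite -[RHS](avg0 R (step d) m.+1); apply: eq_avg => l.
    by rewrite visits_on.
  by rewrite /w x0 expr0 mulr1 subrr add0r invr_ge0 exprn_ge0 // ltW.
rewrite late_on //; apply: le_trans (step_le t) _.
rewrite avg_rho x0 eqxx.
rewrite (_ : theta ^+ t * ((d%:R + rho) / d.+1%:R) = kappa * w) //.
have kt : kappa * theta = (d%:R + rho) / d.+1%:R.
  by rewrite {1}/theta mulVKf // gt_eqF.
by rewrite /w x0 expr0 mul1r exprS [RHS]mulrA kt mulrC.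
Qed.

Lemma theta_ge : 1 - theta <= rho^-1 - rho.
Proof.
have k0 : 0 < kappa by exact: lt_le_trans kappa1.
have iv : rho <= rho^-1 by apply: le_trans rho1 _; rewrite invf_ge1.
apply: (@le_trans _ _ (kappa * (1 - theta))).
  by rewrite ler_peMl ?kappa1 // subr_ge0 theta_le1.
have -> : kappa * (1 - theta) = (rho^-1 - rho) / 2 / d.+1%:R.
  rewrite mulrBr mulr1 /theta mulVKf ?gt_eqF // /kappa.
  by field; rewrite ?(addrC 1) ?natr1 ?pnatr_eq0 ?gt_eqF.
rewrite -mulrA ler_piMr ?subr_ge0 // -invfM invf_le1 ?mulr_gt0 ?ltr0n //.
by rewrite -(natrM _ 2) ler1n.
Qed.

End Recurrence.

(** [rho] is first taken so close to 1 that theta^t is nearly 1; then [kappa] > 1 is fixed and [m]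
    is taken large. Bernoulli's inequality serves both times. *)
Lemma late_vanishes t e : 0 < e ->
  exists m0, forall m (x : T), (m0 <= m)%N -> late t m (x, 0) <= e.
Proof.
(* Makes t (1 - theta) <= 2 t eta <= e / 2. *)
move=> e0; pose eta := e / (4 * t.+1%:R).
have eta0 : 0 < eta by rewrite divr_gt0 // mulr_gt0 ?ltr0n.
pose rho := (1 + eta)^-1.
have rho0 : 0 < rho by rewrite invr_gt0 addr_gt0.
have rho1 : rho < 1 by rewrite invf_lt1 ?addr_gt0 // ltrDl.
have := theta_le1 rho0 (ltW rho1); have := theta_ge rho0 (ltW rho1); have := late_supersolution rho0 (ltW rho1).
set kappa := _ / d.+1%:R; set theta := kappa^-1 * _ => sup th th1.
have kappa1 : 1 < kappa.
  rewrite /kappa ltr_pdivlMr ?ltr0n // mul1r -natr1 ltrD2l ltr_pdivlMr // mul1r.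
  rewrite -subr_gt0; have -> : rho + rho^-1 - 2 = (1 - rho) ^+ 2 / rho.
    by field; rewrite gt_eqF.
  by rewrite divr_gt0 // exprn_gt0 // subr_gt0.
have th0 : 0 <= theta.
  apply: mulr_ge0; first by rewrite invr_ge0 ltW // (lt_trans ltr01).
  by rewrite divr_ge0 ?addr_ge0 ?(ltW rho0).
have th2 : 1 - theta <= 2 * eta.
  apply: le_trans th _; rewrite /rho invrK.
  suff : 1 - eta <= (1 + eta)^-1 by lra.
  rewrite -[leRHS]mul1r ler_pdivlMr ?addr_gt0 //.
  have -> : (1 - eta) * (1 + eta) = 1 - eta ^+ 2 by ring.
  by rewrite gerBl sqr_ge0.
have bern j : 1 - j%:R * (1 - theta) <= theta ^+ j.
  elim: j => [|j IHj]; first by rewrite mul0r subr0.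
  rewrite exprS -natr1; apply: le_trans (ler_wpM2l th0 IHj).
  rewrite -subr_ge0; set a := _ - _.
  have -> : a = j%:R * (1 - theta) ^+ 2 by rewrite /a; ring.
  by rewrite mulr_ge0 ?sqr_ge0.
have [m0 m0P] : exists m0 : nat, 2 / e <= kappa ^+ m0.
  pose z := 2 / e / (kappa - 1).
  exists (Num.bound z).
  have zb : z <= (Num.bound z)%:R by apply/ltW/archi_boundP; rewrite !divr_ge0 ?subr_ge0 // ltW.
  have bern' j : 1 + j%:R * (kappa - 1) <= kappa ^+ j.
    elim: j => [|j IHj]; first by rewrite mul0r addr0.
    rewrite exprS -natr1; apply: le_trans (ler_wpM2l (le_trans ler01 (ltW kappa1)) IHj).
    rewrite -subr_ge0; set a := _ - _.
    have -> : a = j%:R * (kappa - 1) ^+ 2 by rewrite /a; ring.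
    by rewrite mulr_ge0 ?sqr_ge0.
  apply: le_trans (bern' _).
  by move: zb; rewrite /z ler_pdivrMr ?subr_gt0 //; lra.
exists m0 => m x mm0; apply: le_trans (sup t m (x, 0)) _.
rewrite expr0 mul1r.
have : 1 - theta ^+ t <= e / 2.
  have := bern t; have -> : e / 2 = t.+1%:R * (2 * eta) by rewrite /eta; field; rewrite addrC natr1 pnatr_eq0.
  have : t%:R * (1 - theta) <= t.+1%:R * (2 * eta).
    apply: (@le_trans _ _ (t%:R * (2 * eta))); first by rewrite ler_wpM2l.
    by rewrite ler_wpM2r ?ler_nat // mulr_ge0 // ltW.
  by lra.
have : kappa ^- m <= e / 2.
  rewrite -[leRHS]invf_div lef_pV2 ?posrE ?divr_gt0 ?exprn_gt0 ?(lt_trans ltr01 kappa1) //.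
  by apply: le_trans m0P _; rewrite ler_eXn2l.
by lra.
Qed.

End Excursions.

(** * Uncovered vertices *)

Section UncoveredSet.
Context (R : realType) (d N : nat).
Local Notation T := (torus d N).
Local Notation n := (#|{: T}|%:R : R).

Definition trace_avoid (A : {pred T}) t : R := avoid (@cas R d N) (@trace_eig R d N) A t.

Definition uncovered t x l : pred T := [pred y | y \notin take t.+1 (visits (x, 0) l)].

Lemma trace_avoid_harmonic A t :
  trace_avoid A t = n^-1 * \sum_x harmonic_ext (hit_value R A t) (x, 0).
Proof. by congr (_ * _); apply: eq_bigr => x _; rewrite harmonic_ext0. Qed.

Lemma mean_misses A B m t eta :
  (forall j, (j <= t)%N -> ext_bound (hit_value R A j) <= B) ->
  (forall x : T, late R t m (x, 0) <= eta) ->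
  `|n^-1 * (\sum_x avg m (fun l => (misses A t (x, 0) l)%:R : R)) - trace_avoid A t|
    <= B * eta.
Proof.
move=> HB Heta; have n0 : 0 < n := card_gt0R R (0 : T).
have B0 : 0 <= B.
  exact: le_trans (ext_bound_ge0 _) (HB 0%N isT).
rewrite trace_avoid_harmonic -mulrBr -sumrB normrM ger0_norm ?invr_ge0 ?ler0n //.
rewrite ler_pdivrMl //; apply: le_trans (ler_norm_sum _ _ _) _.
apply: (@le_trans _ _ (\sum_(x : T) B * eta)); last first.
  by rewrite sumr_const -[_ *+ _]mulr_natl.
apply: ler_sum => x _; apply: le_trans (misses_converges m (x, 0) (leqnn t) HB) _.
by rewrite ler_wpM2l.
Qed.

Lemma missesE t x l (y z : T) : misses (pred2 y z) t (x, 0) l =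
  [&& (t < size (visits (x, 0%R) l))%N, y \in uncovered t x l & z \in uncovered t x l].
Proof.
rewrite /misses /uncovered !inE; congr (_ && _).
set V := take _ _; apply/allP/andP => [H|[yV zV] u uV].
  by split; apply/negP => /H; rewrite !inE eqxx ?orbT.
rewrite !inE; apply/negP => /orP[/eqP uy|/eqP uz]; first by rewrite -uy uV in yV.
by rewrite -uz uV in zV.
Qed.

Lemma sum_misses_sq t x l (M : R) :
  (\sum_y \sum_z (misses (pred2 y z) t (x, 0) l)%:R) -
  2 * M * (\sum_y (misses (pred2 y y) t (x, 0) l)%:R) +
  M ^+ 2 * (t < size (visits (x, 0%R) l))%N%:R =
  (t < size (visits (x, 0%R) l))%N%:R * (#|uncovered t x l|%:R - M) ^+ 2.
Proof.
set b := (t < _)%N; set U := uncovered t x l.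
have U1 : \sum_y (y \in U)%:R = #|U|%:R :> R.
  rewrite -sum1_card natr_sum [RHS]big_mkcond; apply: eq_bigr => y _.
  by case: (y \in U).
have -> : \sum_y (misses (pred2 y y) t (x, 0) l)%:R = b%:R * #|U|%:R :> R.
  rewrite -U1 mulr_sumr; apply: eq_bigr => y _.
  by rewrite missesE -/b -/U andbb -natrM mulnb.
have -> : \sum_y \sum_z (misses (pred2 y z) t (x, 0) l)%:R = b%:R * #|U|%:R ^+ 2 :> R.
  rewrite expr2 -{1}U1 mulr_suml mulr_sumr; apply: eq_bigr => y _.
  rewrite -U1 !mulr_sumr; apply: eq_bigr => z _.
  by rewrite missesE -/b -/U -!natrM !mulnb.
by ring.
Qed.

Context (N3 : (3 <= N)%N) (disp : measure_display).
Context (Omega : measurableType disp) (P : probability Omega R).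
Context (X : nat -> Omega -> cylinder d N) (hX : is_srw P X).

(* First-moment bound for close uncovered pairs, second-moment bound
   (Chebyshev) for having fewer than [k] uncovered points. *)
Lemma pr_uncovered_le (E : set Omega) (close : rel T) (k t : nat) (M : R) :
  measurable E -> k%:R < M ->
  (forall x l w, E w -> path_event X (x, 0) l w ->
    (t < size (visits (x, 0%R) l))%N ->
    (#|uncovered t x l| < k)%N \/
    exists y z, [/\ y != z, close y z, y \in uncovered t x l & z \in uncovered t x l]) ->
  pr P E <= ((\sum_y \sum_z trace_avoid (pred2 y z) t) -
              2 * M * (\sum_y trace_avoid (pred2 y y) t) + M ^+ 2) / (M - k%:R) ^+ 2 +
            \sum_y \sum_(z | (z != y) && close y z) trace_avoid (pred2 y z) t.
Proof.
move=> mE kM HE; set K := (M - k%:R) ^+ 2.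
have K0 : 0 < K by rewrite exprn_gt0 ?subr_gt0.
have M0 : 0 < M by apply: le_lt_trans kM.
have n0 : 0 < n := card_gt0R R (0 : T).
pose mis (y z x : T) (l : seq (step d)) : R := (misses (pred2 y z) t (x, 0) l)%:R.
pose lat (x : T) (l : seq (step d)) : R := (size (visits ((x : T), 0%R) l) <= t)%N%:R.
pose reach (x : T) (l : seq (step d)) : R := (t < size (visits ((x : T), 0%R) l))%N%:R.
(* [f] dominates [E]: its terms cover walks with too few visits, the Chebyshev quotient and the
   number of close uncovered pairs. *)
pose f (x : T) (l : seq (step d)) : R := lat x l + (K^-1 * (((\sum_y \sum_z mis y z x l) +
   (- (2 * M)) * (\sum_y mis y y x l)) + M ^+ 2 * reach x l) +
   \sum_y \sum_(z | (z != y) && close y z) mis y z x l).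
have sqE x l : ((\sum_y \sum_z mis y z x l) +
   (- (2 * M)) * (\sum_y mis y y x l)) + M ^+ 2 * reach x l =
   reach x l * (#|uncovered t x l|%:R - M) ^+ 2.
  by rewrite -sum_misses_sq mulNr.
have sum0 x l : 0 <= \sum_y \sum_(z | (z != y) && close y z) mis y z x l.
  by apply: sumr_ge0 => y _; apply: sumr_ge0.
have sq0 x l : 0 <= K^-1 * (reach x l * (#|uncovered t x l|%:R - M) ^+ 2).
  by rewrite mulr_ge0 ?invr_ge0 ?(ltW K0) // mulr_ge0 ?sqr_ge0.
have f0 x l : 0 <= f x l by rewrite /f sqE !addr_ge0.
have f1 x l w : E w -> path_event X (x, 0) l w -> 1 <= f x l.
  move=> Ew pw; rewrite /f sqE.
  have [le|lt] := leqP (size (visits (x, 0%R) l)) t.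
    by rewrite /lat le lerDl addr_ge0.
  rewrite {1}/lat leqNgt lt add0r {1}/reach lt mul1r.
  have [Uk|[y [z [yz cyz yU zU]]]] := HE x l w Ew pw lt.
    rewrite -[leLHS]addr0 lerD // ler_pdivlMl // mulr1 /K.
    have Uk' : #|uncovered t x l|%:R <= k%:R :> R by rewrite ler_nat ltnW.
    by rewrite -[leRHS]sqrrN opprB ler_pXn2r ?nnegrE //; lra.
  rewrite -[leLHS]add0r lerD //.
    by have := sq0 x l; rewrite /reach lt mul1r.
  rewrite (bigD1 y) //= (bigD1 z) /=; last by rewrite eq_sym yz.
  rewrite -addrA {1}/mis missesE lt yU zU lerDl addr_ge0 //; apply: sumr_ge0 => u _ //.
  by apply: sumr_ge0.
set rhs := (X in _ <= X).
(* One constant for all pairs and all times up to [t]; it does not depend on [m]. *)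
pose B := \sum_y \sum_z \sum_(j < t.+1) ext_bound (hit_value R (pred2 y z : {pred T}) j).
have ext0 g : 0 <= @ext_bound R d N g := ext_bound_ge0 g.
have B0 : 0 <= B by do 3 (apply: sumr_ge0 => ? _).
have HB y z j : (j <= t)%N -> ext_bound (hit_value R (pred2 y z : {pred T}) j) <= B.
  rewrite -ltnS => jt; rewrite /B (bigD1 y) //= (bigD1 z) //= (bigD1 (Ordinal jt)) //=.
  by rewrite -!addrA lerDl !addr_ge0 //; do ?[apply: sumr_ge0 => ? _].
(* Collects the coefficients of all errors of size [eta], so that eta = e / G makes their sum
   [e]. *)
pose G := 1 + (K^-1 * (n ^+ 2 * B + 2 * M * (n * B)) + n ^+ 2 * B).
have G0 : 0 < G.
  rewrite ltr_wpDr //; apply: addr_ge0; last by rewrite mulr_ge0 ?sqr_ge0.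
  apply: mulr_ge0; first by rewrite invr_ge0 ltW.
  by apply: addr_ge0; [rewrite mulr_ge0 ?sqr_ge0|rewrite !mulr_ge0 ?ler0n ?(ltW M0)].
apply/ler_addgt0Pr => e e0; pose eta := e / G.
have eta0 : 0 < eta by rewrite divr_gt0.
have [m Hm] := @late_vanishes R d N t eta eta0.
have {}Hm x : late R t m ((x : T), 0) <= eta by exact: (Hm m x (leqnn m)).
apply: le_trans (pr_le_avg hX N3 mE f0 (m := m) _) _ => [x l w _|]; first exact: f1.
pose av (g : T -> seq (step d) -> R) : R := n^-1 * \sum_(x : T) avg m (g x).
have avD (g h : T -> seq (step d) -> R) : av (fun x l => g x l + h x l) = av g + av h.
  by rewrite /av -mulrDr -big_split; congr (_ * _); apply: eq_bigr => x _; rewrite avgD.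
have avZ a (g : T -> seq (step d) -> R) : av (fun x l => a * g x l) = a * av g.
  by rewrite /av mulrCA [in RHS]mulr_sumr; congr (_ * _); apply: eq_bigr => x _; rewrite avgZ.
have av_sum (Q : pred T) (F : T -> T -> seq (step d) -> R) :
    av (fun x l => \sum_(y | Q y) F y x l) = \sum_(y | Q y) av (F y).
  rewrite /av -mulr_sumr exchange_big; congr (_ * _).
  by apply: eq_bigr => x _; rewrite avg_sum.
have av_cst a : av (fun _ _ => a) = a.
  rewrite /av; under eq_bigr do rewrite (avg_const m a (step_gt0 d)).
  by rewrite sumr_const -[a *+ _]mulr_natl mulKf // gt_eqF.
have av_le (g h : T -> seq (step d) -> R) : (forall x l, g x l <= h x l) -> av g <= av h.
  move=> gh; rewrite /av ler_wpM2l ?invr_ge0 ?ler0n //; apply: ler_sum => x _.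
  by apply: avg_le => l _; exact: gh.
have av_lat : av lat <= eta.
  rewrite /av ler_pdivrMl //; apply: (@le_trans _ _ (\sum_(x : T) eta)); last first.
    by rewrite sumr_const -[eta *+ _]mulr_natl.
  by apply: ler_sum => x _; exact: Hm.
have av_reach : av reach <= 1.
  rewrite -[leRHS]av_cst; apply: av_le => x l; by rewrite /reach lern1; case: (_ < _)%N.
have err y z : `|av (mis y z) - trace_avoid (pred2 y z) t| <= B * eta.
  by apply: mean_misses => // j jt; exact: HB.
have err_le y z : av (mis y z) <= trace_avoid (pred2 y z) t + B * eta.
  by have := err y z; rewrite ler_norml => /andP[_]; rewrite lerBlDl addrC.
have err_ge y z : trace_avoid (pred2 y z) t - B * eta <= av (mis y z).
  by have := err y z; rewrite ler_norml => /andP[+ _]; rewrite lerBrDl addrC.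
have sum_cst (a : R) : \sum_(y : T) a = n * a.
  by rewrite sumr_const -[a *+ _]mulr_natl.
have B1 : 0 <= B * eta by rewrite mulr_ge0 // ltW.
rewrite -/(av f) /f avD avD avZ avD avD !avZ !av_sum.
have b1 : \sum_y av (fun x l => \sum_z mis y z x l) <=
    \sum_y \sum_z trace_avoid (pred2 y z) t + n ^+ 2 * (B * eta).
  rewrite -[_ + _](_ : \sum_(y : T) (\sum_z trace_avoid (pred2 y z) t + n * (B * eta)) = _).
    apply: ler_sum => y _; rewrite av_sum -sum_cst -big_split /=.
    by apply: ler_sum => z _; exact: err_le.
  by rewrite big_split /= sum_cst mulrA expr2.
have b2 : \sum_y trace_avoid (pred2 y y) t - n * (B * eta) <= \sum_y av (mis y y).
  by rewrite -sum_cst -sumrB; apply: ler_sum => y _; exact: err_ge.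
have b3 : \sum_y av (fun x l => \sum_(z | (z != y) && close y z) mis y z x l) <=
    \sum_y \sum_(z | (z != y) && close y z) trace_avoid (pred2 y z) t + n ^+ 2 * (B * eta).
  rewrite -[_ + _](_ : \sum_(y : T) (\sum_(z | (z != y) && close y z) trace_avoid (pred2 y z) t + n * (B * eta)) = _).
    apply: ler_sum => y _; rewrite av_sum.
    apply: (@le_trans _ _ (\sum_(z | (z != y) && close y z) (trace_avoid (pred2 y z) t + B * eta))).
      by apply: ler_sum => z _; exact: err_le.
    rewrite big_split /= lerD2l -sum_cst [leLHS]big_mkcond /=.
    by apply: ler_sum => z _; case: ifP.
  by rewrite big_split /= sum_cst mulrA expr2.
have -> : rhs + e = rhs + G * eta by rewrite /eta mulrCA mulfV ?mulr1 // gt_eqF.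
rewrite /rhs /G.
move: b1 b2 b3; set s1 := \sum_y av _; set s2 := \sum_y av _; set s3 := \sum_y av _.
set t1 := \sum_y _; set t3 := \sum_y _; set t2 := \sum_y _ => b1 b2 b3.
have -> : (t1 - 2 * M * t2 + M ^+ 2) / K + t3 + (1 + (K^-1 * (n ^+ 2 * B + 2 * M * (n * B)) + n ^+ 2 * B)) * eta
  = eta + (K^-1 * ((t1 + n ^+ 2 * (B * eta)) + - (2 * M) * (t2 - n * (B * eta)) + M ^+ 2 * 1) +
     (t3 + n ^+ 2 * (B * eta))) by ring.
rewrite lerD // lerD // ler_wpM2l ?invr_ge0 ?(ltW K0) // lerD //.
  by rewrite lerD // ler_wnM2l // oppr_le0 mulr_ge0 // ltW.
by rewrite ler_wpM2l ?sqr_ge0.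
Qed.

End UncoveredSet.

(** * From the last vertices to the uncovered set *)

Section LastVertices.
Context (R : realType) (d N : nat) (N3 : (3 <= N)%N) (disp : measure_display).
Context (Omega : measurableType disp) (P : probability Omega R).
Local Notation T := (torus d N).
Local Notation C := (cylinder d N).
Context (X : nat -> Omega -> C) (hX : is_srw P X).
Context (Y : 'I_#|{: T}| -> Omega -> C).
Context (hYmeas : forall i, discrete_measurable_fun (Y i)).
Context (hY : {ae P, forall w, ordered_by_entrance R X Y w}).

Lemma measurable_rel2 (f g : Omega -> C) (D : C -> C -> Prop) :
  discrete_measurable_fun f -> discrete_measurable_fun g ->
  measurable [set w | D (f w) (g w)].
Proof.
move=> mf mg.
rewrite (_ : [set w | _] = \bigcup_(i in [set: nat]) (if (choice.unpickle i : option C) is Some a then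
    f @^-1` [set a] `&` g @^-1` [set b | D a b] else set0)).
  apply: bigcup_measurable => i _; case: (choice.unpickle i) => [a|] //.
  by apply: measurableI; [exact: mf|exact: mg].
apply/seteqP; split => [w /= Dw|w [i _]].
  by exists (choice.pickle (f w)) => //; rewrite choice.pickleK.
by case: (choice.unpickle i) => [a [/= <-]|].
Qed.

(** Turns a position in the list of visits into a time of the walk before which level 0 was met only
    at vertices of the same truncated list. *)
Lemma visits_first_time (x : C) l t y : y \in take t.+1 (visits x l) ->
  exists i, [/\ (i <= size l)%N, walk x l i = (y, 0) &
    forall j, (j < i)%N -> (walk x l j).2 = 0 ->
      (walk x l j).1 \in take t.+1 (visits x l)].
Proof.
have walk0 (z : C) l' : walk z l' 0 = z by rewrite /walk take0.
elim: l x t => [|s l IH] x t.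
  have [x0|xN0] := eqVneq x.2 0; last by rewrite visits_off.
  rewrite visits_on //= in_cons orbF => /eqP ->; exists 0%N; split => //.
  by rewrite walk0 -x0 -surjective_pairing.
have [x0|xN0] := eqVneq x.2 0; last first.
  rewrite visits_off // => /IH [i [il wi H]]; exists i.+1; split => // -[|j] ji.
    by rewrite walk0 => /eqP; rewrite (negPf xN0).
  exact: H.
rewrite visits_on //= in_cons => /orP[/eqP ->|].
  by exists 0%N; split => //; rewrite walk0 -x0 -surjective_pairing.
case: t => [|t]; first by rewrite take0.
move=> /IH [i [il wi H]]; exists i.+1; split => // -[|j] ji.
  by rewrite walk0 inE eqxx.
by move=> w0; rewrite inE H ?orbT.
Qed.

Lemma hitting_time_le_uncovered (x y z : T) l w t : path_event X (x, 0) l w ->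
  y \notin uncovered t x l -> z \in uncovered t x l ->
  (hitting_time R X [set ((y, 0%R) : C)] w <= hitting_time R X [set ((z, 0%R) : C)] w)%E.
Proof.
rewrite /uncovered !inE negbK => pw /visits_first_time [i [il wi H]] zU.
apply: le_ereal_inf_tmp => _ [j /= Xj <-].
apply: (@le_trans _ _ (i%:R%:E)); first by apply: ereal_inf_lbound; exists i => //=; rewrite pw.
rewrite lee_fin ler_nat leqNgt; apply/negP => ji.
have wj : walk (x, 0) l j = (z, 0) by rewrite -pw // (leq_trans (ltnW ji)).
by have := H j ji; rewrite wj /= (negPf zU) => /(_ erefl).
Qed.

(** Were [Y i] covered, every uncovered vertex would be hit no earlier, hence be some [Y m] with m <
    i; there would be at most i < k of them. *)
Lemma last_vertices_uncovered (x : T) l w t k : path_event X (x, 0) l w ->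
  ordered_by_entrance R X Y w -> (k <= #|uncovered t x l|)%N ->
  forall i : 'I_#|{: T}|, (i < k)%N -> exists2 y, Y i w = (y, 0) & y \in uncovered t x l.
Proof.
move=> pw [[Yfun Yinj Ysurj] _ Ydecr _] kU i ik.
have YE j : Y j w = ((Y j w).1, 0).
  by have : level0 (Y j w) := Yfun j I; rewrite /level0 /=; case: (Y j w) => a b /= ->.
exists (Y i w).1; first exact: YE.
apply: contraT => yU; suff : (#|uncovered t x l| <= i)%N by move=> /(leq_trans kU); rewrite leqNgt ik.
pose f (m : 'I_i) : T := (Y (widen_ord (ltnW (ltn_ord i)) m) w).1.
apply: (@leq_trans #|codom f|); last by apply: leq_trans (leq_image_card f _) _; rewrite card_ord.
apply: subset_leq_card; apply/fintype.subsetP => z zU.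
have [m _ Ym] : exists2 m, setT m & Y m w = (z, 0) by apply: (Ysurj (z, 0)).
have mi : (m < i)%N.
  rewrite ltn_neqAle; apply/andP; split.
    by apply: contraNneq yU => /val_inj <-; rewrite Ym.
  rewrite leqNgt; apply/negP => /Ydecr; rewrite ltNge Ym YE => /negP; apply.
  exact: hitting_time_le_uncovered pw yU zU.
apply/codomP; exists (Ordinal mi); rewrite /f.
by rewrite (_ : widen_ord _ _ = m) ?Ym //; exact: val_inj.
Qed.

Definition close_rel (r : R) : rel T :=
  [rel y z | cyl_dist R ((y, 0) : C) (z, 0) <= r].

Lemma pr_close_pair_le (k t : nat) (r M : R) : k%:R < M ->
  (P [set w | exists i j : 'I_#|{: T}|,
      (i < j < k)%N /\ (cyl_dist R (Y i w) (Y j w) <= r)%R] <=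
   (((\sum_y \sum_z trace_avoid R (pred2 y z : {pred T}) t) -
       2 * M * (\sum_y trace_avoid R (pred2 y y : {pred T}) t) + M ^+ 2) / (M - k%:R) ^+ 2 +
     \sum_y \sum_(z | (z != y) && close_rel r y z) trace_avoid R (pred2 y z : {pred T}) t)%R%:E)%E.
Proof.
move=> kM; set Ev := [set w | _].
have mEv : measurable Ev.
  rewrite (_ : Ev = \bigcup_(ij in [set: 'I_#|{: T}| * 'I_#|{: T}|])
      (if (ij.1 < ij.2 < k)%N then
        [set w | cyl_dist R (Y ij.1 w) (Y ij.2 w) <= r] else set0)).
    apply: fin_bigcup_measurable => // -[i j] _ /=; case: ifP => // _.
    exact: (@measurable_rel2 (Y i) (Y j) (fun a b => cyl_dist R a b <= r)).
  apply/seteqP; split => [w [i [j [ijk H]]]|w [[i j] _] /=].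
    by exists (i, j) => //=; rewrite ijk.
  by case: ifP => // ijk H; exists i, j.
have [Z [mZ Z0 HZ]] := hY.
have mE : measurable (Ev `\` Z) by exact: measurableD.
have -> : P Ev = P (Ev `\` Z).
  have PZ : P (Ev `&` Z) = 0%E.
    apply/eqP; rewrite eq_le measure_ge0 andbT -Z0 le_measure ?inE //.
    exact: measurableI.
  transitivity (P (Ev `\` Z) + P (Ev `&` Z))%E; first exact: measureDI.
  by rewrite PZ adde0.
rewrite prE // lee_fin; apply: (pr_uncovered_le N3 hX mE kM) => x l w [[i [j [/andP[ij jk] dij]]] Zw] pw lt.
have ord : ordered_by_entrance R X Y w.
  by apply: contrapT => nord; apply: Zw; apply: HZ.
have [lek|gtk] := ltnP #|uncovered t x l| k; [by left|right].
have [y Yi yU] := last_vertices_uncovered pw ord gtk (ltn_trans ij jk).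
have [z Yj zU] := last_vertices_uncovered pw ord gtk jk.
exists y, z; split=> //; last by rewrite /close_rel /= -Yi -Yj.
apply/negP => /eqP yz; have [[_ Yinj _] _ _ _] := ord.
have : i = j by apply: Yinj; rewrite ?inE //= Yi Yj yz.
by move=> e; rewrite e ltnn in ij.
Qed.

End LastVertices.

Lemma expr_1B_le (R : realType) (x : R) m : 0 <= 1 - x -> (1 - x) ^+ m <= expR (- (m%:R * x)).
Proof.
move=> x1; rewrite -mulrN expRM_natl lerXn2r ?nnegrE ?expR_ge0 //.
by have := expR_ge1Dx (- x); rewrite addrC addrC.
Qed.

Lemma expr_1B_ge (R : realType) (x : R) m : 0 < x < 1 ->
  expR (- (m%:R * (x / (1 - x)))) <= (1 - x) ^+ m.
Proof.
move=> /andP[x0 x1]; have y0 : 0 < 1 - x by rewrite subr_gt0.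
rewrite -mulrN expRM_natl lerXn2r ?nnegrE ?expR_ge0 ?(ltW y0) //.
rewrite expRN invf_ple ?posrE ?expR_gt0 //.
apply: le_trans (expR_ge1Dx _); rewrite le_eqVlt; apply/orP; left; apply/eqP.
by field; rewrite gt_eqF.
Qed.

Lemma expR_le_1D2 (R : realType) (x : R) : 0 <= x <= 1 / 2 -> expR x <= 1 + 2 * x.
Proof.
move=> /andP[x0 x2]; have h : 0 < 1 - x by lra.
apply: (@le_trans _ _ (1 - x)^-1); last by rewrite -div1r ler_pdivrMr //; nra.
rewrite -[expR x]invrK -expRN lef_pV2 ?posrE ?expR_gt0 //.
by have := expR_ge1Dx (- x).
Qed.

(** * Moments of the number of uncovered vertices *)

Section UncoveredMoments.
Context (R : realType) (d N : nat) (d2 : (2 <= d)%N) (N3 : (3 <= N)%N).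
Local Notation T := (torus d N).
Local Notation n := (#|{: T}|%:R : R).
Local Notation tau := (N%:R * d.+1%:R : R).
Local Notation G := (@torus_green R d N).
Local Notation g0 := (G 0).
Local Notation K2 := (n^-1 * \sum_k (green_weight (0 : T) (@trace_eig R d N) k) ^+ 2).

Let N1 : (1 < N)%N. Proof. exact: ltn_trans N3. Qed.
Let pN : (Zp_trunc N).+2 = N. Proof. by rewrite Zp_cast. Qed.

Lemma torus_card : n = N%:R ^+ d.
Proof. by rewrite card_ffun !card_ord natrX pN. Qed.

Lemma torus_card_ge : N%:R ^+ 2 <= n.
Proof. by rewrite torus_card ler_weXn2l // ler1n ltnW. Qed.

Let tau1 : d.+1%:R <= tau.
Proof. by rewrite ler_peMl // ler1n ltnW. Qed.

Let tau0 : 0 < tau. Proof. by rewrite mulr_gt0 ?ltr0n // ltnW. Qed.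

Lemma green0_ge : 1 / 4 <= g0.
Proof.
apply: torus_green0_ge; rewrite card_ffun !card_ord pN.
by rewrite -(exp1n d) ltn_exp2r // ltnW.
Qed.

Lemma green0_le : g0 <= 48 * (d%:R * d.+1%:R).
Proof.
rewrite torus_green0 ler_pdivrMl ?(card_gt0R R (0 : T)) // mulrC.
exact: sum_trace_weight.
Qed.

Lemma green_sq_le : K2 <= 12 * (d%:R * d.+1%:R ^+ 2) * (1 + ln N%:R) ^+ 2.
Proof.
rewrite ler_pdivrMl ?(card_gt0R R (0 : T)) // mulrC.
have pE : (Zp_trunc N).+2%:R = N%:R :> R by rewrite pN.
by have := @sum_trace_weight_sq R d N d2; rewrite pE.
Qed.

Let weight_le k : green_weight (0 : T) (@trace_eig R d N) k <= tau.
Proof.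
have pE : (Zp_trunc N).+2%:R = N%:R :> R by rewrite pN.
by have := @trace_weight_le_gap R d N k; rewrite pE.
Qed.

Let diag (x : T) : green (@cas R d N) 0 (@trace_eig R d N) x x = g0.
Proof. by rewrite trace_greenE subrr. Qed.

(** The requirement on the bottom of the spectrum is met because kap >= tau >= d + 1. *)
Let slack (kap : R) : tau <= kap -> d%:R / d.+1%:R <= 1 - kap^-1.
Proof.
move=> kt; have k0 : 0 < kap by exact: lt_le_trans kt.
have -> : d%:R / d.+1%:R = 1 - d.+1%:R^-1 :> R.
  have -> : d%:R = d.+1%:R - 1 :> R by rewrite -natr1 addrK.
  by rewrite mulrBl mulfV ?pnatr_eq0 // mul1r.
by rewrite lerD2l lerN2 lef_pV2 ?posrE ?ltr0n // (le_trans tau1).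
Qed.

Lemma pair_uncovered_le (y z : T) gam s : G (y - z) <= gam -> 0 <= g0 + gam ->
  trace_avoid R (pred2 y z) s.*2 <=
  expR (- (s.*2%:R * (n * (g0 + gam) / 2 + tau)^-1)).
Proof.
move=> Gg gg; set kap := _ + tau.
have kt : tau <= kap by rewrite lerDr divr_ge0 // mulr_ge0.
have k1 := slack kt.
apply: (@le_trans _ _ ((1 - kap^-1) ^+ s.*2)); last first.
  by apply: expr_1B_le; apply: le_trans k1; rewrite divr_ge0.
have := @avoid_pair_le R T (@cas R d N) (@cas_sym R d N) (@cas_orth R d N) 0 (@cas0 R d N)
  (@trace_eig R d N) (trace_eig0 R d N) (@trace_eig_lt1 R d N) tau weight_le g0 diag
  (pred2 y z) y z gam (d%:R / d.+1%:R) s.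
apply.
- by rewrite inE eqxx.
- by rewrite inE eqxx orbT.
- by rewrite trace_greenE.
- exact: lt_le_trans kt.
- by rewrite divr_gt0 ?ltr0n // ltnW.
- by move=> k; exact: trace_eig_ge.
- exact: k1.
Qed.

Lemma avoid_ext (A B : {pred T}) t : A =i B -> trace_avoid R A t = trace_avoid R B t.
Proof.
move=> AB; congr (_ * _); apply: eq_bigr => x _.
have oE : off R A =1 off R B by move=> y; rewrite /off AB.
elim: t x => [|t IH] x //=.
by rewrite /killed oE (eq_spec _ _ _ IH).
Qed.

Lemma point_uncovered_ge (x : T) e s : 0 < e -> 1 < n * g0 ->
  n * (1 - (n * g0)^-1) ^+ s.*2 -
  (1 + e^-1) * ((1 - (n * g0 + tau)^-1) ^+ s.*2 * (K2 / g0 ^+ 2)) <=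
  (1 + e) * (n * trace_avoid R (pred2 x x) s.*2).
Proof.
move=> e0 ng; rewrite (@avoid_ext _ (pred1 x)); last by move=> y; rewrite !inE orbb.
rewrite -(torus_green_sq R x).
have gp : 0 < g0 by apply: lt_le_trans green0_ge; lra.
apply: (@avoid_point_ge R T (@cas R d N) (@cas_sym R d N) (@cas_orth R d N) 0 (@cas0 R d N)
  (@trace_eig R d N) (trace_eig0 R d N) (@trace_eig_lt1 R d N) tau weight_le g0 diag
  x (d%:R / d.+1%:R) e s) => //.
- by rewrite divr_gt0 ?ltr0n // ltnW.
- by move=> k; exact: trace_eig_ge.
- by apply: slack; rewrite lerDr mulr_ge0 // ltW.
Qed.

(** Markov's inequality for G^2. *)
Lemma card_large_green_le a : 0 < a ->
  #|[pred z : T | a < G z]|%:R * a ^+ 2 <= K2.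
Proof.
move=> a0; rewrite -(torus_green_sq R (0 : T)) /dot.
rewrite [leRHS](reindex_inj (@oppr_inj T)) /=.
have -> : #|[pred z : T | a < G z]|%:R * a ^+ 2 = \sum_(z : T | a < G z) a ^+ 2.
  by rewrite sumr_const mulr_natl.
rewrite big_mkcond /=; apply: ler_sum => z _; rewrite trace_greenE sub0r opprK -expr2.
by case: ifPn => [az|_]; [rewrite ler_pXn2r ?nnegrE ?ltW // (lt_trans a0)|rewrite sqr_ge0].
Qed.

End UncoveredMoments.

Lemma natr_card (R : pzSemiRingType) (I : finType) (A : pred I) :
  #|A|%:R = \sum_i (A i)%:R :> R.
Proof.
rewrite -sum1_card natr_sum big_mkcond; apply: eq_bigr => i _.
by rewrite unfold_in; case: (A i).
Qed.

Section MomentBounds.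
Context (R : realType) (d N : nat) (d2 : (2 <= d)%N) (N3 : (3 <= N)%N).
Local Notation T := (torus d N).
Local Notation n := (#|{: T}|%:R : R).
Local Notation tau := (N%:R * d.+1%:R : R).
Local Notation G := (@torus_green R d N).
Local Notation g0 := (G 0).
Local Notation K2 := (n^-1 * \sum_k (green_weight (0 : T) (@trace_eig R d N) k) ^+ 2).
Local Notation C0 := (48 * (d%:R * d.+1%:R) : R).
Context (M eta : R) (M1 : 1 <= M) (eta0 : 0 < eta).
Local Notation ell := (ln (n / M)).
Context (Mn : M < n) (n16 : 16 <= n) (taun : tau <= n / 8).
Context (H1 : 16 * (tau * ell + 1) <= eta * n).
Context (H3 : M * expR 1 * (K2 * (ell / eta) ^+ 2) * expR (- (ell / (8 * C0))) <= eta).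
Context (H4 : (1 + eta^-1) * (M * expR eta * (16 * K2)) <= eta * n).

(* After t steps about [n * exp (- t / (n * g0))] vertices are uncovered; this is
   half of the t for which this number equals [M], as the bounds above are stated
   for an even number of steps. *)
Definition cover_steps : nat := Num.truncn (n * g0 * ell / 2).
Local Notation t := (cover_steps.*2).
Local Notation p y z := (trace_avoid R (pred2 y z : {pred T}) t).

Let n0 : 0 < n. Proof. exact: (card_gt0R R (0 : T)). Qed.
Let M0 : 0 < M. Proof. exact: lt_le_trans ltr01 M1. Qed.
Let g4 : 1 / 4 <= g0. Proof. exact: green0_ge. Qed.
Let gC : g0 <= C0. Proof. exact: green0_le. Qed.
Let tau0 : 0 < tau. Proof. by rewrite mulr_gt0 ?ltr0n // (ltn_trans _ N3). Qed.
Let ell0 : 0 < ell. Proof. by rewrite ln_gt0 // ltr_pdivlMr // mul1r. Qed.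
Let tauell : 0 < tau * ell. Proof. exact: mulr_gt0. Qed.
Let Tn : n / 4 <= n * g0. Proof. by rewrite ler_pM2l //; have := g4; lra. Qed.
Let expell : expR (- ell) = M / n.
Proof. by rewrite expRN lnK ?posrE ?divr_gt0 // invf_div. Qed.

Let t_le : t%:R <= n * g0 * ell.
Proof.
have x0 : 0 <= n * g0 * ell / 2.
  by rewrite divr_ge0 // mulr_ge0 ?(ltW ell0) // mulr_ge0 ?(ltW n0) //; have := g4; lra.
have /andP[] := truncn_itv x0; rewrite -/cover_steps => tx _.
by rewrite -mul2n natrM; lra.
Qed.

Let t_ge : n * g0 * ell - 2 <= t%:R.
Proof.
have x0 : 0 <= n * g0 * ell / 2.
  by rewrite divr_ge0 // mulr_ge0 ?(ltW ell0) // mulr_ge0 ?(ltW n0) //; have := g4; lra.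
have /andP[] := truncn_itv x0; rewrite -/cover_steps => _ tx.
by rewrite -mul2n natrM; move: tx; rewrite -[cover_steps.+1%:R]natr1; lra.
Qed.

Let exp_rate (a kap : R) : 0 < kap -> a * kap <= t%:R -> expR (- (t%:R * kap^-1)) <= expR (- a).
Proof. by move=> k0 ak; rewrite ler_expR lerN2 ler_pdivlMr. Qed.

Let diag_rate : expR (- (t%:R * (n * g0 + tau)^-1)) <= M / n * expR eta.
Proof.
apply: (@le_trans _ _ (expR (- (ell - eta)))).
  apply: exp_rate; first by rewrite addr_gt0 // mulr_gt0 //; have := g4; lra.
  apply: le_trans t_ge.
  have : eta * (n / 4) <= eta * (n * g0) by rewrite ler_pM2l.
  have : 0 < eta * tau by exact: mulr_gt0.
  by have := H1; have := tauell; lra.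
by rewrite opprB addrC expRD expell.
Qed.

Lemma diag_uncovered_le (y : T) : p y y <= M / n * expR eta.
Proof.
have := @pair_uncovered_le R d N d2 N3 y y g0 cover_steps; rewrite subrr.
have -> : n * (g0 + g0) / 2 = n * g0 by field.
move=> H; apply: le_trans (H _ _) diag_rate; first exact: lexx.
by have := g4; lra.
Qed.

(** The threshold makes G(y - z) cost n ell (eta / ell) = n eta. This and 2 (tau ell + 1) <= eta n /
    8 are absorbed by (9/2) eta n g0 >= (9/8) eta n, whence the 9. *)
Lemma good_pair_uncovered_le (y z : T) : G (y - z) <= eta / ell ->
  p y z <= (M / n) ^+ 2 * expR (9 * eta).
Proof.
move=> Gyz; have ge0 : 0 <= eta / ell by rewrite divr_ge0 // ltW.
apply: le_trans (pair_uncovered_le d2 N3 cover_steps Gyz _) _.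
  by have := g4; lra.
have -> : (M / n) ^+ 2 * expR (9 * eta) = expR (- (ell *+ 2 - 9 * eta)).
  by rewrite -expell -expRM_natl -expRD; congr expR; ring.
have ee : ell * (eta / ell) = eta by rewrite mulrCA mulfV ?mulr1 // gt_eqF.
apply: exp_rate.
  by rewrite ltr_wpDl // divr_ge0 // mulr_ge0 ?(ltW n0) //; have := g4; lra.
apply: le_trans t_ge; set q := eta / ell in ge0 ee *.
have : eta * (n / 4) <= eta * (n * g0) by rewrite ler_pM2l.
have : 0 <= eta * (n * q) by rewrite mulr_ge0 ?(ltW eta0) // mulr_ge0 ?(ltW n0).
have : 0 < eta * tau by exact: mulr_gt0.
have := H1; set e' := ell in ee * => h1 h2 h3 h4.
have -> : (e' *+ 2 - 9 * eta) * (n * (g0 + q) / 2 + tau) =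
   n * g0 * e' + n * (e' * q) + 2 * (tau * e') - 9 / 2 * (eta * (n * g0))
   - 9 / 2 * (eta * (n * q)) - 9 * (eta * tau) by field.
by rewrite ee; lra.
Qed.

(** The gap 1/2 lowers n g0 by n / 4 in the rate, and n / 8 of this survives [tau]. As g0 <= C0, the
    exponent gains ell / (8 C0); the factor expR 1 pays for rounding [t]. *)
Lemma bad_pair_uncovered_le (y z : T) : y != z ->
  p y z <= expR 1 * (M / n) * expR (- (ell / (8 * C0))).
Proof.
move=> yz; have yz0 : y - z != 0 by rewrite subr_eq0.
apply: le_trans (pair_uncovered_le d2 N3 cover_steps (torus_green_gap R yz0) _) _.
  by have := g4; lra.
have -> : expR 1 * (M / n) * expR (- (ell / (8 * C0))) =
    expR (- (ell + ell / (8 * C0) - 1)).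
  by rewrite -expell -!expRD; congr expR; ring.
have kE : n * (g0 + (g0 - 1 / 2)) / 2 + tau = n * g0 - n / 4 + tau by field.
have k0 : 0 < n * g0 - n / 4 + tau by have := Tn; have := tau0; lra.
rewrite kE; apply: exp_rate => //.
have C00 : 0 < C0 by apply: lt_le_trans gC; have := g4; lra.
set q := ell / (8 * C0).
have qg : n * (q * g0) <= n * (ell / 8).
  rewrite ler_pM2l //.
  have -> : q * g0 = ell / 8 * (g0 / C0) by rewrite /q invfM; ring.
  by rewrite -[leRHS]mulr1 ler_wpM2l ?divr_ge0 ?(ltW ell0) // ler_pdivrMr // mul1r.
have q0 : 0 < q by rewrite divr_gt0 // mulr_gt0.
have [le0|gt0] := leP (ell + q - 1) 0.
  apply: (@le_trans _ _ 0) => //.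
  by rewrite mulr_le0_ge0 // ltW.
apply: le_trans t_ge.
apply: (@le_trans _ _ ((ell + q - 1) * (n * g0 - n / 8))).
  by rewrite ler_pM2l //; have := taun; lra.
have : 0 <= n * q by rewrite mulr_ge0 ?(ltW n0) ?(ltW q0).
have := qg; have := Tn; have := n16.
set e' := ell => h1 h2 h3 h4.
have -> : (e' + q - 1) * (n * g0 - n / 8) =
  n * g0 * e' - n * (e' / 8) + n * (q * g0) - n * q / 8 - n * g0 + n / 8 by field.
by lra.
Qed.

Let large := [pred z : T | eta / ell < G z].

Let card_large : #|large|%:R <= K2 * (ell / eta) ^+ 2.
Proof.
have q0 : 0 < eta / ell by rewrite divr_gt0.
rewrite -ler_pdivrMr ?exprn_gt0 ?divr_gt0 // -exprVn invf_div.
exact: card_large_green_le.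
Qed.

Let bad_total : n * (#|large|%:R * (expR 1 * (M / n) * expR (- (ell / (8 * C0))))) <= eta.
Proof.
apply: le_trans H3.
have -> : n * (#|large|%:R * (expR 1 * (M / n) * expR (- (ell / (8 * C0))))) =
  (M * expR 1) * (#|large|%:R * expR (- (ell / (8 * C0)))).
  by field; rewrite gt_eqF.
rewrite -[leRHS]mulrA ler_wpM2l ?mulr_ge0 ?expR_ge0 ?(ltW M0) //.
by rewrite ler_wpM2r ?expR_ge0.
Qed.

(** Bad pairs are summed without regard to [close]; only good pairs see the density D / n. With
    [close] always true this also gives the second moment. *)
Lemma sum_close_uncovered_le (close : rel T) (D : R) :
  (forall y : T, #|[pred z : T | close y z]|%:R <= D) ->
  \sum_(y : T) \sum_(z | (z != y) && close y z) p y z <=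
  eta + D / n * (M ^+ 2 * expR (9 * eta)).
Proof.
move=> HD; set good := (M / n) ^+ 2 * expR (9 * eta).
set bad := expR 1 * (M / n) * expR (- (ell / (8 * C0))).
have good0 : 0 <= good by rewrite mulr_ge0 ?expR_ge0 ?sqr_ge0.
have bad0 : 0 <= bad by rewrite !mulr_ge0 ?expR_ge0 ?invr_ge0 ?(ltW M0) ?(ltW n0).
apply: (@le_trans _ _ (\sum_(y : T) (#|large|%:R * bad + D * good))); last first.
  rewrite sumr_const -[_ *+ _]mulr_natl mulrDr lerD //.
  by rewrite le_eqVlt; apply/orP; left; apply/eqP; rewrite /good; field; rewrite gt_eqF.
apply: ler_sum => y _.
apply: (@le_trans _ _ (\sum_(z : T) ((large (y - z))%:R * bad + (close y z)%:R * good))).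
  rewrite big_mkcond /=; apply: ler_sum => z _.
  case: ifPn => [/andP[zy cyz]|_]; last by rewrite addr_ge0 // mulr_ge0.
  rewrite cyz mul1r /=; case: ltP => [_|le].
    by rewrite mul1r -[leLHS]addr0 lerD // bad_pair_uncovered_le // eq_sym.
  by rewrite mul0r add0r good_pair_uncovered_le.
rewrite big_split /= -!mulr_suml lerD //.
  rewrite ler_wpM2r // (natr_card R large).
  have inj : injective (fun z : T => y - z) by move=> a b /addrI /oppr_inj.
  by rewrite [leRHS](reindex_inj inj).
by rewrite ler_wpM2r //; apply: le_trans (HD y); rewrite (natr_card R [pred z | close y z]).
Qed.

Lemma sum_uncovered_le :
  \sum_(y : T) \sum_(z : T) p y z <= M * expR eta + eta + M ^+ 2 * expR (9 * eta).
Proof.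
have -> : \sum_(y : T) \sum_(z : T) p y z = \sum_(y : T) p y y +
    \sum_(y : T) \sum_(z | (z != y) && true) p y z.
  rewrite -big_split; apply: eq_bigr => y _ /=.
  by rewrite (bigD1 y) //=; congr (_ + _); apply: eq_bigl => z; rewrite andbT.
rewrite -addrA lerD //.
  apply: (@le_trans _ _ (\sum_(y : T) (M / n * expR eta))).
    by apply: ler_sum => y _; exact: diag_uncovered_le.
  rewrite sumr_const -[_ *+ _]mulr_natl le_eqVlt; apply/orP; left; apply/eqP.
  by field; rewrite gt_eqF.
apply: le_trans (sum_close_uncovered_le (close := fun _ _ => true) (D := n) _) _.
  by move=> y; rewrite ler_nat max_card.
by rewrite divff ?mul1r // gt_eqF.
Qed.

Lemma sum_point_uncovered_ge : (M * (1 - eta) - eta) / (1 + eta) <= \sum_(y : T) p y y.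
Proof.
have ge1 : 0 < 1 + eta by rewrite addr_gt0.
have K20 : 0 <= K2.
  by rewrite mulr_ge0 ?invr_ge0 ?(ltW n0) // sumr_ge0 // => k _; rewrite sqr_ge0.
have T1 : n / 8 <= n * g0 - 1 by have := Tn; have := n16; lra.
have T0 : 0 < n * g0 by have := Tn; have := n16; lra.
suff H (y : T) : (M * (1 - eta) - eta) / (1 + eta) <= n * p y y.
  rewrite -(ler_pM2l n0); apply: (@le_trans _ _ (\sum_(y : T) n * p y y)); last first.
    by rewrite mulr_sumr.
  apply: (@le_trans _ _ (\sum_(y : T) ((M * (1 - eta) - eta) / (1 + eta)))).
    by rewrite sumr_const -[leRHS]mulr_natl.
  by apply: ler_sum => y _; exact: H.
rewrite ler_pdivrMr // [leRHS]mulrC.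
have ng1 : 1 < n * g0 by have := T1; have := n16; lra.
apply: le_trans (@point_uncovered_ge R d N d2 N3 y eta cover_steps eta0 ng1).
apply: lerB.
  have x1 : 0 < (n * g0)^-1 < 1 by rewrite invr_gt0 T0 /= invf_lt1.
  apply: le_trans (ler_wpM2l (ltW n0) (@expr_1B_ge R _ t x1)).
  have -> : (n * g0)^-1 / (1 - (n * g0)^-1) = (n * g0 - 1)^-1.
    by field; apply/and3P; split; rewrite gt_eqF //; have := T1; have := n16; have := g4; lra.
  (* By the first condition, replacing n g0 by n g0 - 1 costs at most [eta] in the exponent. *)
  apply: (@le_trans _ _ (n * expR (- (ell + eta)))).
    rewrite opprD expRD expell [_ * (_ * _)]mulrA [n * (M / n)]mulrCA mulfV ?gt_eqF // mulr1.
    by rewrite ler_pM2l //; exact: expR_ge1Dx.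
  rewrite ler_pM2l // ler_expR lerN2 ler_pdivrMr; last by have := T1; have := n16; lra.
  apply: le_trans t_le _.
  have : eta * (n / 8) <= eta * (n * g0 - 1) by rewrite ler_pM2l.
  have tau1 : 1 <= tau.
    by rewrite -natrM ler1n muln_gt0 /= andbT; exact: ltn_trans N3.
  have : ell <= tau * ell by rewrite ler_peMl // ltW.
  by have := H1; have := ell0; lra.
apply: (@le_trans _ _ ((1 + eta^-1) * (M / n * expR eta * (16 * K2)))); last first.
  rewrite -(ler_pM2l n0) [n * eta]mulrC; apply: le_trans H4.
  move: K2 => K; rewrite (_ : n * _ = (n * n^-1) * ((1 + eta^-1) * (M * expR eta * (16 * K)))).
    by rewrite mulfV ?mul1r // gt_eqF.
  by ring.
rewrite ler_wpM2l ?addr_ge0 ?invr_ge0 ?(ltW eta0) // ler_pM //.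
- by rewrite exprn_ge0 // subr_ge0 invf_le1 ?addr_gt0 //; have := T1; have := tau0; have := n16; lra.
- by rewrite divr_ge0 ?sqr_ge0.
- apply: le_trans diag_rate; apply: expr_1B_le.
  by rewrite subr_ge0 invf_le1 ?addr_gt0 //; have := T1; have := tau0; have := n16; lra.
rewrite mulrC ler_wpM2r // invf_ple ?posrE ?exprn_gt0 //; last by have := g4; lra.
have -> : 16^-1 = (1 / 4) ^+ 2 :> R by field.
by rewrite ler_pXn2r ?nnegrE //; have := g4; lra.
Qed.

End MomentBounds.

(** * Asymptotics *)

Section Asymptotics.
Context (R : realType).

Lemma eventually_nat_ge (x : R) : \forall N \near \oo, x <= N%:R.
Proof.
exists (Num.truncn `|x|).+1 => // N /= lt.
apply: le_trans (ler_norm x) _; apply: ltW; apply: lt_le_trans (truncnS_gt _) _.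
by rewrite ler_nat.
Qed.

(** exp (a L) is the fifth power of exp (a L / 5) >= m (1 + L); the spare factor 1 + L beats C /
    m^5. *)
Lemma expR_dominates_poly (a C : R) : 0 < a -> 0 <= C ->
  \forall N \near \oo, C * (1 + ln N%:R) ^+ 4 <= expR (a * ln N%:R).
Proof.
move=> a0 C0; pose m := Num.min 1 (a / 5).
have m0 : 0 < m by rewrite lt_min ltr01 divr_gt0.
have m1 : m <= 1 by rewrite ge_min lexx.
have ma : m <= a / 5 by rewrite ge_min lexx orbT.
near=> N.
have N1 : 1 <= N%:R :> R by near: N; exact: eventually_nat_ge.
have NC : expR (C / m ^+ 5) <= N%:R :> R by near: N; exact: eventually_nat_ge.
have Np : 0 < N%:R :> R by exact: lt_le_trans N1.
set L := ln N%:R; have L0 : 0 <= L by rewrite ln_ge0.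
have LC : C / m ^+ 5 <= L by rewrite -[leLHS]expRK ler_ln ?posrE ?expR_gt0.
have -> : a * L = 5%:R * (a / 5 * L) by field.
rewrite expRM_natl; apply: (@le_trans _ _ ((m * (1 + L)) ^+ 5)); last first.
  rewrite lerXn2r ?nnegrE ?expR_ge0 //; first by rewrite mulr_ge0 ?addr_ge0 // ltW.
  apply: le_trans (expR_ge1Dx _).
  have : m * L <= a / 5 * L by rewrite ler_wpM2r.
  by move: m1; rewrite mulrDr mulr1; lra.
have L1 : 0 < 1 + L by rewrite ltr_wpDr.
rewrite exprMn [(1 + L) ^+ 5]exprS [leRHS]mulrA ler_wpM2r ?exprn_ge0 ?(ltW L1) //.
have m5 : 0 < m ^+ 5 by rewrite exprn_gt0.
move: LC; rewrite ler_pdivrMr // => LC.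
by rewrite mulrDr mulr1 [X in _ + X]mulrC; lra.
Unshelve. all: by end_near. Qed.

Section Conditions.
Context (d : nat) (d2 : (2 <= d)%N) (M eta : R) (M1 : 1 <= M) (eta0 : 0 < eta).
Local Notation C0 := (48 * (d%:R * d.+1%:R) : R).
Local Notation C2 := (12 * (d%:R * d.+1%:R ^+ 2) : R).

(** The last three conditions say in turn that relaxation and rounding are negligible in the
    exponents, that bad pairs contribute at most [eta], and that the correction to the test function
    is small. At fixed [M] and [eta] they compare N log N, log^4 times a negative power of n, and
    log^2 with their bounds. *)
Definition moment_conditions N : Prop :=
  let n := #|{: torus d N}|%:R : R in
  let tau := N%:R * d.+1%:R : R in
  let ell := ln (n / M) in
  let K2 := n^-1 * \sum_k (green_weight (0 : torus d N) (@trace_eig R d N) k) ^+ 2 in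
  [/\ (3 <= N)%N, M < n, 16 <= n & tau <= n / 8] /\
  [/\ 16 * (tau * ell + 1) <= eta * n,
    M * expR 1 * (K2 * (ell / eta) ^+ 2) * expR (- (ell / (8 * C0))) <= eta &
    (1 + eta^-1) * (M * expR eta * (16 * K2)) <= eta * n].

Lemma eventually_moment_conditions : \forall N \near \oo, moment_conditions N.
Proof.
have M0 : 0 < M by exact: lt_le_trans M1.
have C00 : 0 < C0 by rewrite !mulr_gt0 ?ltr0n // (leq_trans _ d2).
have C20 : 0 <= C2 by rewrite !mulr_ge0 ?exprn_ge0.
pose c1 := (16 * (d.+1%:R * d%:R) + 16) / eta : R.
have c10 : 0 <= c1 by rewrite divr_ge0 ?addr_ge0 ?mulr_ge0 // ltW.
(* [K2] and ell^2 bring (1 + L)^2 each: this is the origin of the fourth power. *)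
pose c3 := M * expR 1 * (C2 * (d%:R / eta) ^+ 2) * expR (ln M / (8 * C0)) / eta : R.
have c30 : 0 <= c3.
  rewrite divr_ge0 ?(ltW eta0) // mulr_ge0 ?expR_ge0 // mulr_ge0 ?mulr_ge0 ?expR_ge0 ?sqr_ge0 //;
    by rewrite ?invr_ge0 ltW.
pose c4 := (1 + eta^-1) * (M * expR eta * (16 * C2)) / eta : R.
have c40 : 0 <= c4.
  by rewrite divr_ge0 ?(ltW eta0) // mulr_ge0 ?addr_ge0 ?invr_ge0 ?(ltW eta0) // !mulr_ge0 ?expR_ge0 ?(ltW M0).
near=> N.
have N4 : 4 <= N%:R :> R by near: N; exact: eventually_nat_ge.
have NM : M + 1 <= N%:R :> R by near: N; exact: eventually_nat_ge.
have N8 : 8 * d.+1%:R <= N%:R :> R by near: N; exact: eventually_nat_ge.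
have P1 : c1 * (1 + ln N%:R) ^+ 4 <= expR (1 * ln N%:R) by near: N; exact: expR_dominates_poly.
have P4 : c4 * (1 + ln N%:R) ^+ 4 <= expR (1 * ln N%:R) by near: N; exact: expR_dominates_poly.
have P3 : c3 * (1 + ln N%:R) ^+ 4 <= expR (d%:R / (8 * C0) * ln N%:R).
  near: N; apply: expR_dominates_poly => //.
  by rewrite divr_gt0 ?mulr_gt0 ?ltr0n // (leq_trans _ d2).
have N3 : (3 <= N)%N by rewrite -(ler_nat R); lra.
have Np : 0 < N%:R :> R by lra.
rewrite !mul1r !lnK ?posrE // in P1 P4.
rewrite /moment_conditions; set n := #|_|%:R; set K2 := n^-1 * _; cbv zeta.
have nN2 : N%:R ^+ 2 <= n by exact: torus_card_ge.
have n_ge x : x * N%:R <= N%:R ^+ 2 -> x * N%:R <= n by move=> h; exact: le_trans nN2.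
have NN : N%:R <= n.
  by rewrite -[leLHS]mul1r; apply: n_ge; rewrite expr2 ler_pM2r //; lra.
have n0 : 0 < n by exact: lt_le_trans NN.
set L := ln N%:R in P1 P3 P4 *; have L0 : 0 <= L by rewrite ln_ge0 //; lra.
have lnn : ln n = d%:R * L.
  by rewrite /n (torus_card _ _ N3) lnXn // mulr_natl.
have ellE : ln (n / M) = d%:R * L - ln M by rewrite ln_div ?posrE // lnn.
have lnM : 0 <= ln M by rewrite ln_ge0.
have Mn : M < n by apply: lt_le_trans NN; lra.
have ell0 : 0 <= ln (n / M) by rewrite ln_ge0 // ler_pdivlMr // mul1r ltW.
have ellL : ln (n / M) <= d%:R * L by rewrite ellE; lra.
set ell := ln (n / M) in ellE ell0 ellL *.
have K2L : K2 <= C2 * (1 + L) ^+ 2 by exact: green_sq_le.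
have K20 : 0 <= K2.
  by rewrite mulr_ge0 ?invr_ge0 ?(ltW n0) // sumr_ge0 // => k _; rewrite sqr_ge0.
clearbody K2.
have L1 : 1 <= 1 + L by lra.
have L14 : 1 + L <= (1 + L) ^+ 4 by rewrite -[leLHS]expr1 ler_weXn2l.
have L24 : (1 + L) ^+ 2 <= (1 + L) ^+ 4 by rewrite ler_weXn2l.
split; split => //.
- by have : 16 <= N%:R ^+ 2 :> R by [nra]; lra.
- have : 8 * d.+1%:R * N%:R <= n by apply: n_ge; rewrite expr2 ler_pM2r.
  by rewrite ler_pdivlMr //; lra.
- have h1 : (16 * (d.+1%:R * d%:R) + 16) * (1 + L) <= eta * N%:R.
    move: P1; rewrite /c1 mulrAC ler_pdivrMr // [_ * eta]mulrC; apply: le_trans.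
    by rewrite ler_wpM2l // addr_ge0 ?mulr_ge0.
  have h2 : eta * N%:R * N%:R <= eta * n.
    by rewrite -mulrA ler_pM2l // -expr2.
  apply: le_trans h2; apply: (@le_trans _ _ ((16 * (d.+1%:R * d%:R) + 16) * (1 + L) * N%:R)).
    have a1 : d.+1%:R * ell <= d.+1%:R * (d%:R * L) by rewrite ler_wpM2l.
    have a2 : N%:R * (d.+1%:R * ell) <= N%:R * (d.+1%:R * (d%:R * L)) by rewrite ler_wpM2l // ltW.
    have a3 : 0 <= N%:R * (d.+1%:R * d%:R) :> R by rewrite mulr_ge0 ?mulr_ge0 // ltW.
    have a4 : 0 <= N%:R * L by rewrite mulr_ge0 // ltW.
    rewrite (_ : N%:R * d.+1%:R * ell = N%:R * (d.+1%:R * ell)); last by ring.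
    rewrite (_ : _ * (1 + L) * N%:R = 16 * (N%:R * (d.+1%:R * (d%:R * L))) +
      16 * (N%:R * (d.+1%:R * d%:R)) + 16 * (N%:R * L) + 16 * N%:R); last by ring.
    by lra.
  by rewrite ler_wpM2r // ltW.
- have e1 : expR (- (ell / (8 * C0))) = expR (ln M / (8 * C0)) * expR (- (d%:R / (8 * C0) * L)).
    by rewrite -expRD ellE; congr expR; ring.
  set X := expR (d%:R / (8 * C0) * L) in P3.
  have X0 : 0 < X by exact: expR_gt0.
  rewrite e1 [expR (- (_ * L))]expRN -/X mulrA ler_pdivrMr //.
  move: P3; rewrite /c3 mulrAC ler_pdivrMr // [X * eta]mulrC; apply: le_trans.
  rewrite [leRHS]mulrAC ler_wpM2r ?expR_ge0 // -!mulrA.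
  rewrite ler_wpM2l ?(ltW M0) // ler_wpM2l ?expR_ge0 //.
  apply: (@le_trans _ _ ((C2 * (1 + L) ^+ 2) * ((d%:R / eta) ^+ 2 * (1 + L) ^+ 2))); last first.
    by rewrite le_eqVlt; apply/orP; left; apply/eqP; ring.
  apply: ler_pM => //; first exact: sqr_ge0.
  rewrite -exprMn ler_pXn2r ?nnegrE ?divr_ge0 ?mulr_ge0 ?invr_ge0 ?(ltW eta0) //; try lra.
  rewrite mulrAC ler_pM2r ?invr_gt0 //; apply: le_trans ellL _.
  by rewrite ler_wpM2l //; lra.
- have h2 : eta * N%:R <= eta * n by rewrite ler_pM2l.
  apply: le_trans h2; move: P4; rewrite /c4 mulrAC ler_pdivrMr // [_ * eta]mulrC; apply: le_trans.
  rewrite -[leRHS]mulrA ler_wpM2l ?addr_ge0 ?invr_ge0 ?(ltW eta0) //.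
  rewrite -[leRHS]mulrA ler_wpM2l ?mulr_ge0 ?expR_ge0 ?(ltW M0) //.
  by rewrite -[leRHS]mulrA ler_pM2l //; apply: le_trans K2L _; rewrite ler_wpM2l.
Unshelve. all: by end_near. Qed.

End Conditions.
End Asymptotics.

(** With r >= 1 the box has side 2 K + 1 <= 2 r + 3 <= 5 r, and (5 delta)^d <= 5 delta is all that
    the limit requires. *)
Lemma card_close_rel_le (R : realType) (d N : nat) (delta : R) (y : torus d N) :
  (2 <= d)%N -> (3 <= N)%N -> 5 * delta <= 1 -> 1 <= delta * N%:R ->
  #|[pred z : torus d N | close_rel (delta * N%:R) y z]|%:R <=
  5 * delta * #|{: torus d N}|%:R.
Proof.
move=> d2 N3 d5 dN; set r := delta * N%:R.
have r0 : 0 <= r by exact: le_trans ler01 dN.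
have Np : 0 < N%:R :> R by rewrite ltr0n (leq_trans _ N3).
have de0 : 0 < delta by rewrite -(pmulr_lgt0 _ Np); exact: lt_le_trans ltr01 dN.
pose K := (Num.truncn r).+1.
have rK : r < K%:R by exact: Num.Theory.truncnS_gt.
have Kr : K%:R <= r + 1.
  by rewrite /K -natr1 lerD2r; have /andP[] := truncn_itv r0.
have := @card_close_le R d N N3 y r K rK; rewrite -(ler_nat R) natrX => H.
apply: (le_trans H); rewrite torus_card //.
apply: (@le_trans _ _ ((5 * r) ^+ d)).
  have r1 : 1 <= r by [].
  have b : (2 * K).+1%:R <= 5 * r by rewrite -natr1 natrM; lra.
  by apply: lerXn2r => //; rewrite nnegrE // mulr_ge0.
rewrite /r mulrA exprMn ler_wpM2r ?exprn_ge0 //.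
by rewrite -[leRHS]expr1 ler_wiXn2l ?mulr_ge0 ?(ltW de0) // ltnW.
Qed.

Lemma pr_close_last_le (R : realType) (d N : nat) (disp : measure_display)
    (Omega : measurableType disp) (P : probability Omega R)
    (X : nat -> Omega -> cylinder d N)
    (Y : 'I_#|{: torus d N}| -> Omega -> cylinder d N) (k : nat) (M eta delta : R) :
  (2 <= d)%N -> is_srw P X -> (forall i, discrete_measurable_fun (Y i)) ->
  {ae P, forall w, ordered_by_entrance R X Y w} ->
  moment_conditions d M eta N -> k%:R + 1 <= M -> 0 < eta <= 1 / 18 ->
  5 * delta <= 1 -> 1 <= delta * N%:R ->
  (P [set w | exists i j : 'I_#|{: torus d N}|,
      (i < j < k)%N /\ (cyl_dist R (Y i w) (Y j w) <= delta * N%:R)%R] <=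
   ((M + eta * (22 * M ^+ 2 + 4 * M + 1)) / (M - k%:R) ^+ 2 + eta +
     10 * delta * M ^+ 2)%R%:E)%E.
Proof.
move=> d2 hX mY hY [[N3 Mn n16 taun] [H1 H3 H4]] kM /andP[eta0 eta18] d5 dN.
have M1 : 1 <= M by apply: le_trans kM; rewrite lerDr.
have kM' : k%:R < M by lra.
have K0 : 0 < (M - k%:R) ^+ 2 by rewrite exprn_gt0 // subr_gt0.
apply: le_trans (pr_close_pair_le N3 hX mY hY (cover_steps d N M).*2 (delta * N%:R) kM') _.
rewrite lee_fin.
have e9 : expR (9 * eta) <= 1 + 18 * eta.
  by apply: le_trans (expR_le_1D2 _) _; lra.
have e1 : expR eta <= 1 + 2 * eta by apply: expR_le_1D2; lra.
have M20 : 0 <= M ^+ 2 by exact: sqr_ge0.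
have b1 := sum_uncovered_le d2 N3 M1 eta0 Mn n16 taun H1 H3.
have b2 := sum_point_uncovered_ge d2 N3 M1 eta0 Mn n16 H1 H4.
have n0 : 0 < #|{: torus d N}|%:R :> R by lra.
have b3 := sum_close_uncovered_le d2 N3 M1 eta0 Mn n16 taun H1 H3
  (fun y => card_close_rel_le y d2 N3 d5 dN).
rewrite mulfK ?gt_eqF // in b3.
move: b1 b2 b3; set s1 := \sum_y \sum_z _; set s3 := \sum_y _; set s2 := \sum_y _.
move=> b1 b2 b3; rewrite -[leRHS]addrA lerD //.
  (* The terms in M^2 cancel to leading order; 22 = 18 + 4 collects their errors, 18 from the pairs
     and 4 from the cross term. *)
  rewrite ler_pM2r ?invr_gt0 //.
  have b1' : s1 <= M * (1 + 2 * eta) + eta + M ^+ 2 * (1 + 18 * eta).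
    by apply: le_trans b1 _; rewrite lerD // ?lerD ?ler_wpM2l //; lra.
  have b2' : M * (1 - 2 * eta) - eta <= s2.
    apply: le_trans b2; rewrite ler_pdivlMr; last by lra.
    have : 0 <= eta ^+ 2 by exact: sqr_ge0.
    have : 0 <= M * eta ^+ 2 by rewrite mulr_ge0 ?sqr_ge0 //; lra.
    by lra.
  have : 2 * M * (M * (1 - 2 * eta) - eta) <= 2 * M * s2.
    by rewrite ler_wpM2l //; lra.
  by move: b1'; lra.
apply: le_trans b3 _; rewrite lerD2l -[10 * _ * _]mulrA.
have de0 : 0 <= delta.
  have Np : 0 < N%:R :> R by rewrite ltr0n (leq_trans _ N3).
  by rewrite -(pmulr_lge0 _ Np); lra.
have : M ^+ 2 * expR (9 * eta) <= M ^+ 2 * 2 by rewrite ler_wpM2l //; lra.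
move=> h; apply: le_trans (ler_wpM2l _ h) _; first by rewrite mulr_ge0.
by lra.
Qed.

(** [M] is chosen first: M - k >= M / 2 and M >= 16 / e give M / (M - k)^2 <= e / 4. Then [eta] and
    [delta0] are taken small in terms of [M]. *)
Lemma error_budget (R : realFieldType) (k e : R) : 0 <= k -> 0 < e ->
  exists M eta delta0 : R, [/\ k + 1 <= M, 0 < eta <= 1 / 18, 0 < delta0 &
    forall delta, delta <= delta0 ->
      (M + eta * (22 * M ^+ 2 + 4 * M + 1)) / (M - k) ^+ 2 + eta + 10 * delta * M ^+ 2 <= e].
Proof.
move=> k0 e0; pose q := 16 / e; pose M := 2 * k + q + 1.
have q0 : 0 < q by rewrite divr_gt0.
have kM : k + 1 <= M by rewrite /M; lra.
have M0 : 0 < M by lra.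
have M2 : M <= 2 * (M - k) by rewrite /M; lra.
have Mk : 1 <= M - k by lra.
have qM : q <= M by rewrite /M; lra.
have Me : 16 <= e * M by move: qM; rewrite /q ler_pdivrMr // mulrC.
pose A := 22 * M ^+ 2 + 4 * M + 1.
have M20 : 0 < M ^+ 2 by rewrite exprn_gt0.
have A1 : 1 <= A by rewrite /A; clear -M20 M0; lra.
have A0 : 0 < A by exact: lt_le_trans A1.
have eA0 : 0 < e / (8 * A) by rewrite divr_gt0 // mulr_gt0.
pose eta := Num.min (1 / 18) (e / (8 * A)).
have eta0 : 0 < eta by rewrite lt_min eA0 divr_gt0.
have etaA : eta * A <= e / 8.
  have : eta <= e / (8 * A) by rewrite ge_min lexx orbT.
  by rewrite invfM mulrA ler_pdivlMr.
exists M, eta, (e / (40 * M ^+ 2)); split => //.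
- by rewrite eta0 ge_min lexx.
- by rewrite divr_gt0 // mulr_gt0.
move=> delta dM; rewrite -/A mulrDl.
have K1 : 1 <= (M - k) ^+ 2 by rewrite exprn_ege1.
have K0 : 0 < (M - k) ^+ 2 by exact: lt_le_trans K1.
have MK : M / (M - k) ^+ 2 <= e / 4.
  rewrite ler_pdivrMr // -(@ler_pM2l _ (16 : R)) //.
  apply: (@le_trans _ _ (e * M * M)); first by rewrite ler_pM2r.
  have : e * M ^+ 2 <= e * (2 * (M - k)) ^+ 2.
    by rewrite ler_pM2l //; apply: lerXn2r => //; rewrite nnegrE ltW // (lt_le_trans M0).
  by rewrite exprMn expr2 mulrA; clear; lra.
have AK : eta * A / (M - k) ^+ 2 <= e / 8.
  rewrite ler_pdivrMr //; apply: le_trans etaA _.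
  by rewrite ler_peMr // divr_ge0 // ltW.
have etae : eta <= e / 8 by apply: le_trans etaA; rewrite ler_peMr // ltW.
have cl : 10 * delta * M ^+ 2 <= e / 4.
  by move: dM; rewrite ler_pdivlMr ?mulr_gt0 //; clear; lra.
by clear -MK AK etae cl e0; lra.
Qed.

Theorem corollary2p3 (R : realType) (d : nat) (hd : (2 <= d)%N)
  (disp : nat -> measure_display)
  (Omega : forall N : nat, measurableType (disp N))
  (P : forall N : nat, probability (Omega N) R)
  (X : forall N : nat, nat -> Omega N -> cylinder d N)
  (hX : forall N : nat, (2 <= N)%N -> is_srw (P N) (X N))
  (Y : forall N : nat, 'I_#|{: torus d N}| -> Omega N -> cylinder d N)
  (hYmeas : forall N : nat, (2 <= N)%N ->
    forall i : 'I_#|{: torus d N}|, discrete_measurable_fun (Y N i))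
  (hY : forall N : nat, (2 <= N)%N ->
    {ae P N, forall w, ordered_by_entrance R (X N) (Y N) w})
  (k : nat) (hk : (2 <= k)%N) :
  limn_esup (fun N : nat =>
    P N [set w | exists i j : 'I_#|{: torus d N}|,
           (i < j < k)%N /\ cyl_dist R (Y N i w) (Y N j w) <= delta * N%:R])
    @[delta --> 0^'+] --> 0%E.
Proof.
set F := fun delta : R => limn_esup _.
have F_ge0 delta : (0 <= F delta)%E.
  apply: limf_esup_ge0 => [|N]; last exact: measure_ge0.
  exact: filter_not_empty.
have F_le e : 0 < e -> \forall delta \near 0^'+, (F delta <= e%:E)%E.
  move=> e0; have [M [eta [delta0 [kM eta_itv de0 budget]]]] := error_budget (ler0n R k) e0.
  have M1 : 1 <= M by apply: le_trans kM; rewrite lerDr.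
  have eta0 : 0 < eta by case/andP: eta_itv.
  near=> delta.
  have delta_gt0 : 0 < delta by near: delta; exact: nbhs_right_gt.
  have d5 : delta <= 5^-1 by near: delta; apply: nbhs_right_le.
  have dM : delta <= delta0 by near: delta; exact: nbhs_right_le.
  have [N0 _ HN0] := eventually_moment_conditions hd M1 eta0.
  (* The ball count needs delta N >= 1, so this threshold depends on [delta]; [N] tends to infinity
     before [delta] tends to 0. *)
  have [N1 _ HN1] := eventually_nat_ge delta^-1.
  apply: ge_ereal_inf; exists (ereal_sup [set P N [set w | exists i j : 'I_#|{: torus d N}|,
      (i < j < k)%N /\ cyl_dist R (Y N i w) (Y N j w) <= delta * N%:R] |
      N in [set N | (maxn N0 N1 <= N)%N]]).
    by exists [set N | (maxn N0 N1 <= N)%N] => //; exists (maxn N0 N1).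
  apply: ge_ereal_sup => _ [N /= NN <-].
  have cond : moment_conditions d M eta N.
    by apply: HN0 => /=; apply: leq_trans NN; exact: leq_maxl.
  have dN : 1 <= delta * N%:R.
    rewrite mulrC -ler_pdivrMr // div1r; apply: HN1 => /=.
    by apply: leq_trans NN; exact: leq_maxr.
  have N2 : (2 <= N)%N by case: cond => -[N3 _ _ _] _; exact: ltnW.
  have d5' : 5 * delta <= 1 by rewrite -ler_pdivlMl // mulr1.
  apply: le_trans (pr_close_last_le hd (hX N N2) (hYmeas N N2) (hY N N2) cond kM eta_itv d5' dN) _.
  by rewrite lee_fin budget // ltW.
have F0 : F delta @[delta --> 0^'+] --> 0%E; last exact: F0.
(* The limit is taken in the reals, which requires the upper limits to be finite near 0. *)
have Ffin : \forall delta \near 0^'+, F delta \is a fin_num.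
  have := F_le 1 ltr01; apply: filterS => delta Fd.
  rewrite ge0_fin_numE //; exact: le_lt_trans Fd (ltry _).
apply: cvg_EFin => //; apply/cvgrPdist_le => e e0.
have := F_le e e0; apply: filterS2 Ffin => delta fin Fd /=.
rewrite sub0r normrN ger0_norm ?fine_ge0 // -lee_fin fineK //.
Unshelve. all: by end_near. Qed.
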